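(* For each $n$ (with $p=p(n)$), let $(x_i,y_i)\in\mathbb{R}^{p+1}\times\mathbb{R}$, $i\in[n]$, be i.i.d. and satisfy the feature and response assumptions (F1)-(F3) and (Y1)-(Y4) given in the context. Let $\hat\beta_k$, $k\in\{0\}\cup[K]$, be the gradient descent iterates with step sizes $\delta_0,\dots,\delta_{K-1}$ and initialization $\hat\beta_0$. Assume there are constants $\Delta,B_0,\zeta_L,\zeta_U$ (independent of $n,p$) such that (1) $\sum_{k=1}^K\delta_{k-1}\le\Delta$, (2) $\|\hat\beta_0\|_2\le B_0$, and (3) $0<\zeta_L\le p/n\le\zeta_U<\infty$. Furthermore, let $K=o\big(n(\log n)^{-3/2}\big)$. Then, as $n,p\to\infty$, $$\max_{k\in[K]}\big|\widehat R^{\mathrm{loo}}(\hat\beta_k)-R(\hat\beta_k)\big|\longrightarrow0\quad\text{almost surely}.$$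
   Context: A distribution $\mu$ satisfies the $T_2$-inequality with constant $\sigma(\mu)\ge0$ if $W_2(\mu,\nu)\le\sqrt{2\sigma^2(\mu)D_{\mathrm{KL}}(\nu\|\mu)}$ for every distribution $\nu$, where $W_2$ is the 2-Wasserstein distance and $D_{\mathrm{KL}}$ the Kullback-Leibler divergence. Feature assumptions: (F1) $x_i^\top=((\Sigma^{1/2}z_i)^\top,1)$, where $z_i\in\mathbb{R}^p$ has i.i.d. entries drawn from a distribution $\mu_z$ and $\Sigma\in\mathbb{R}^{p\times p}$ is positive semidefinite. (F2) $\mu_z$ has mean $0$, variance $1$ and satisfies the $T_2$-inequality with constant $\sigma_z$. (F3) $\|\Sigma\|_{\mathrm{op}}\le\sigma_\Sigma$. Response assumptions: (Y1) $y_i=f(x_i)+\varepsilon_i$, where $\varepsilon_i$ is independent of $x_i$ and drawn from a distribution $\mu_\varepsilon$. (Y2) $\mu_\varepsilon$ has mean $0$ and satisfies the $T_2$-inequality with constant $\sigma_\varepsilon$. (Y3) $f:\mathbb{R}^{p+1}\to\mathbb{R}$ is $L_f$-Lipschitz continuous, where (without loss of generality) $L_f\le1$. (Y4) $\mathbb{E}[y_i^8]\le m_8$, $\mathbb{E}[y_i^4]\le m_4$, $\mathbb{E}[y_i^2]\le m_2$. The constants $\sigma_z,\sigma_\Sigma,\sigma_\varepsilon,m_2,m_4,m_8$ do not change with $n,p$. $[K]=\{1,\dots,K\}$; $K$ and the step sizes may depend on $n$. $X\in\mathbb{R}^{n\times(p+1)}$ has rows $x_i^\top$ and $y=(y_i)_{i\le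 n}$. Gradient descent with positive step sizes from a fixed (non-random) initial vector $\hat\beta_0\in\mathbb{R}^{p+1}$: $\hat\beta_k=\hat\beta_{k-1}+\frac{\delta_{k-1}}{n}X^\top(y-X\hat\beta_{k-1})$, $k\in[K]$. The leave-one-out iterate is the same procedure run without the $i$-th sample: $\hat\beta_{0,-i}=\hat\beta_0$ and $\hat\beta_{k,-i}=\hat\beta_{k-1,-i}+\frac{\delta_{k-1}}{n}X_{-i}^\top(y_{-i}-X_{-i}\hat\beta_{k-1,-i})$, where $X_{-i},y_{-i}$ are $X,y$ with the $i$-th row/entry removed. $R(\hat\beta_k)=\mathbb{E}_{x_0,y_0}[(y_0-x_0^\top\hat\beta_k)^2\mid X,y]$, where $(x_0,y_0)$ is independent of the training data with the same distribution as $(x_1,y_1)$, and $\widehat R^{\mathrm{loo}}(\hat\beta_k)=\frac1n\sum_{i=1}^n(y_i-x_i^\top\hat\beta_{k,-i})^2$. *)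

(* Defs.v *)
From HB Require Import structures.
From mathcomp Require Import all_boot all_order all_algebra.
From mathcomp Require Import all_classical all_reals all_analysis.

Set Implicit Arguments.
Unset Strict Implicit.
Unset Printing Implicit Defensive.

Import Order.TTheory GRing.Theory Num.Theory.
Import numFieldNormedType.Exports.

Local Open Scope classical_set_scope.
Local Open Scope ring_scope.

(* The norm [`|_|] that MathComp-Analysis puts on matrices
   is the sup norm of the entries, hence the explicit definitions. *)

Definition l2norm (R : realType) (m : nat) (v : 'cV[R]_m) : R :=
  Num.sqrt (\sum_i v i 0 ^+ 2).

Definition opnorm (R : realType) (m n : nat) (A : 'M[R]_(m, n)) : R :=
  sup [set l2norm (A *m v) | v in [set v : 'cV[R]_n | l2norm v <= 1]].

Definition l2_lipschitz (R : realType) (m : nat) (L : R) (f : 'cV[R]_m -> R) :=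
  forall u v, `|f u - f v| <= L * l2norm (u - v).

Definition is_psd (R : realType) (m : nat) (A : 'M[R]_m) :=
  A^T = A /\ forall v : 'cV[R]_m, 0 <= (v^T *m A *m v) 0 0.

(* [S] is the square root of [A]: a positive semidefinite matrix has exactly
   one positive semidefinite square root. *)
Definition is_psd_sqrt (R : realType) (m : nat) (S A : 'M[R]_m) :=
  is_psd S /\ S *m S = A.

Section OptimalTransport.
Local Open Scope ereal_scope.
Local Open Scope charge_scope.
Context (R : realType).
Implicit Types mu nu : probability (measurableTypeR R) R.

Definition KL_divergence nu mu : \bar R :=
  if pselect (nu `<< mu) then
    \int[nu]_x lne (('d (charge_of_finite_measure nu) '/d mu) x)
  else +oo.

Definition coupling mu nu :
    set (probability (measurableTypeR R * measurableTypeR R)%type R) :=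
  [set pi | forall A : set (measurableTypeR R), measurable A ->
     pi (A `*` setT) = mu A /\ pi (setT `*` A) = nu A].

Definition W2 mu nu : \bar R :=
  sqrte (ereal_inf
    [set \int[pi]_z (((z.1 : R) - (z.2 : R)) ^+ 2)%R%:E | pi in coupling mu nu]).

(* When the divergence is infinite the inequality is void, also for
   [sigma = 0]; this is spelled out because [0 * +oo = 0] in [\bar R]. *)
Definition T2_inequality mu (sigma : R) :=
  (0 <= sigma)%R /\
  forall nu, KL_divergence nu mu < +oo ->
    W2 mu nu <= sqrte ((2 * sigma ^+ 2)%R%:E * KL_divergence nu mu).

End OptimalTransport.

(* The Borel sigma-algebra on matrices, generated by the entries. *)
Definition mx_cylinders (R : realType) (m n : nat) : set (set 'M[R]_(m, n)) :=
  [set A | exists i j (B : set (measurableTypeR R)),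
     measurable B /\ A = [set M : 'M[R]_(m, n) | B (M i j)]].

Definition borel_mx (R : realType) (m n : nat) :=
  g_sigma_algebraType (@mx_cylinders R m n).

HB.instance Definition _ (R : realType) (m n : nat) :=
  Measurable.on (borel_mx R m n).

Section Randomness.
Context (d : measure_display) (Omega : measurableType d) (R : realType).
Context (P : probability Omega R).

(* Mutual independence of a finite family. Subfamilies need no separate
   mention: take [B i = setT] for the members left out. *)
Definition independent_family (I : finType) (d' : measure_display)
    (T : measurableType d') (U : I -> Omega -> T) :=
  forall B : I -> set T, (forall i, measurable (B i)) ->
    P (\bigcap_i (U i @^-1` B i)) = (\prod_i P (U i @^-1` B i))%E.

Definition independent (d1 d2 : measure_display) (T1 : measurableType d1)
    (T2 : measurableType d2) (U : Omega -> T1) (V : Omega -> T2) :=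
  forall A B, measurable A -> measurable B ->
    P (U @^-1` A `&` V @^-1` B) = (P (U @^-1` A) * P (V @^-1` B))%E.

Definition same_law (d' : measure_display) (T : measurableType d')
    (U V : Omega -> T) :=
  forall B, measurable B -> P (U @^-1` B) = P (V @^-1` B).

Definition has_law (d' : measure_display) (T : measurableType d')
    (U : Omega -> T) (mu : probability T R) :=
  forall B, measurable B -> P (U @^-1` B) = mu B.

(* [C] is a version of the conditional expectation of [Y] given [D]. *)
Definition is_cond_expectation (d' : measure_display) (T : measurableType d')
    (D : Omega -> T) (Y C : Omega -> R) :=
  [/\ forall B : set (measurableTypeR R), measurable B ->
        g_sigma_algebra_preimage D (C @^-1` B),
      P.-integrable setT (EFin \o C) &
      forall A, g_sigma_algebra_preimage D A ->
        (\int[P]_(w in A) (C w)%:E = \int[P]_(w in A) (Y w)%:E)%E].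

End Randomness.

(* The normalization [n] is a separate argument because the leave-one-out
   iterates use [n - 1] samples but still divide by [n]. *)
Fixpoint gd (R : realType) (m q n : nat) (X : 'M[R]_(m, q)) (y : 'cV[R]_m)
    (delta : nat -> R) (b0 : 'cV[R]_q) (k : nat) : 'cV[R]_q :=
  if k is k'.+1 then
    let b := gd n X y delta b0 k' in
    b + (delta k' / n%:R) *: (X^T *m (y - X *m b))
  else b0.

Section LeaveOneOut.
Context (R : realType) (n q : nat).
Implicit Types (x : 'I_n -> 'cV[R]_q) (y : 'I_n -> R) (delta : nat -> R).

Definition design_mx x : 'M[R]_(n, q) := \matrix_(i, j) x i j 0.

Definition response_vec y : 'cV[R]_n := \col_i y i.

Definition gd_iter x y delta b0 k : 'cV[R]_q :=
  gd n (design_mx x) (response_vec y) delta b0 k.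

Definition gd_iter_loo x y delta b0 (i : 'I_n) k : 'cV[R]_q :=
  gd n (row' i (design_mx x)) (row' i (response_vec y)) delta b0 k.

Definition sq_loss (x : 'cV[R]_q) (y : R) (b : 'cV[R]_q) : R :=
  (y - (x^T *m b) 0 0) ^+ 2.

Definition loo_risk x y delta b0 k : R :=
  n%:R^-1 * \sum_i sq_loss (x i) (y i) (gd_iter_loo x y delta b0 i k).

End LeaveOneOut.

(* Main.v *)
(** Write the risk gap at step [k] as the difference between the leave-one-out
    average of the squared losses and the population risk of the full iterate. Along
    a gradient step both quantities change by [delta k] times an expression that is
    bilinear in the gradient and in the sum of two consecutive iterates, so that the
    gap telescopes and its maximum over [k] is bounded by the initial gap plus a sum
    with weights [delta l] of total mass at most [Delta]; no union bound over the
    iterations is needed.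

    To control one summand, split the samples into blocks of length [m] and replace
    the iterates without sample [i] and the full iterates by the iterates without the
    whole block of [i]. On an event on which the design matrix has operator norm
    [O(sqrt n)], a Gronwall argument bounds the distance between these iterates by the
    normalized residuals on the block; as the block is independent of the iterates run
    without it, the eighth moment of the resulting error is [O((m / n) ^ 4)]. After
    the replacement the summands of a block are centered and independent given the
    other blocks, so that the fourth moment of the average is [O(1 / m ^ 2)]. Markov's
    inequality with [m] of order [n ^ (2 / 3)] yields failure probabilities
    [O(n ^ (- 4 / 3))], and Borel-Cantelli concludes.

    The moments of the features and the bound on the design matrix come from the
    subgaussian tails that the [T2] inequality provides for each coordinate of [z],
    the latter through a net argument. *)

From HB Require Import structures.
Require Import Defs.
From mathcomp Require Import all_boot all_order all_algebra.
From mathcomp Require Import all_classical all_reals all_analysis.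
From mathcomp Require Import measurable_realfun ring lra.

Set Implicit Arguments.
Unset Strict Implicit.
Unset Printing Implicit Defensive.

Import Order.TTheory GRing.Theory Num.Theory.
Import numFieldNormedType.Exports.

Local Open Scope classical_set_scope.
Local Open Scope ring_scope.

(** * Independent samples and moments *)

(** The obstacle is dependence: the summand of sample [i] in the leave-one-out average involves all
    the other samples. Removing a whole block moves the iterates further, but all summands of the
    block then share one iterate that has seen none of them. The bounds on the iterates hold only on
    an event, and restricting to an event of the full sample would destroy this independence. Each
    summand is therefore truncated by an event of the retained rows only; the event of the full
    sample implies all of these, because a bound over the lattice net passes to subsets of the rows.
    The exponents come from the moments of the responses: an increment of the loss is a product of
    two linear forms in the sample, so that eight moments of the data give four of the increment.
    The centered part thus contributes [m ^ -2]. The squared residuals on a block are averaged with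
    total mass [m / n], and their fourth moment contributes [(m / n) ^ 4]. The two terms balance at
    [m = n ^ (2 / 3)]. *)

Section Independence.
Local Open Scope ereal_scope.
Context (R : realType) (d : measure_display) (Omega : measurableType d).
Variable P : probability Omega R.

(** The joint law of an independent pair is the product of its marginals, and Tonelli applies. The
    iterated integral runs over [Omega] twice, so that no second probability space is introduced. *)
Lemma independent_tonelli (d1 d2 : measure_display) (T1 : measurableType d1)
    (T2 : measurableType d2) (U : {RV P >-> T1}) (V : {RV P >-> T2})
    (F : T1 * T2 -> \bar R) :
  independent P U V -> measurable_fun setT F -> (forall u, 0 <= F u) ->
  \int[P]_w F (U w, V w) = \int[P]_w \int[P]_w' F (U w', V w).
Proof.
move=> UV mF F0.
have mUV : measurable_fun setT (fun w => (U w, V w)).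
  by apply/measurable_fun_pairP; split; exact: measurable_funPT.
pose UVmix := isMeasurableFun.Build _ _ _ _ _ mUV.
pose UVp : {RV P >-> (T1 * T2)%type} := HB.pack (fun w => (U w, V w)) UVmix.
have -> : \int[P]_w F (U w, V w) = \int[distribution P UVp]_z F z.
  by rewrite ge0_integral_distribution.
have -> : \int[distribution P UVp]_z F z =
    \int[distribution P U \x distribution P V]_z F z.
  apply: eq_measure_integral => A mA _; apply/esym.
  by apply: product_measure_unique => //= B C mB mC; exact: UV.
rewrite fubini_tonelli2//.
have mG := measurable_fun_fubini_tonelli_G F mF F0 (m1 := distribution P U).
transitivity (\int[P]_w fubini_G (distribution P U) F (V w)).
  by apply: ge0_integral_distribution => // y; exact: integral_ge0.
apply: eq_integral => w _; rewrite /fubini_G.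
apply: (ge0_integral_distribution U (f := fun u => F (u, V w))) => //.
exact: measurableT_comp.
Qed.

End Independence.

Section Resampling.
Local Open Scope ereal_scope.
Context (R : realType) (d d' : measure_display) (Omega : measurableType d).
Context (T : measurableType d') (P : probability Omega R) (n : nat).
Variable U : 'I_n -> {RV P >-> T}.

Definition sample (w : Omega) : n.-tuple T := [tuple U i w | i < n].

Definition upd (i : 'I_n) (u : T) (t : n.-tuple T) : n.-tuple T :=
  [tuple if j == i then u else tnth t j | j < n].

Lemma tnth_upd i u t j : tnth (upd i u t) j = if j == i then u else tnth t j.
Proof. by rewrite tnth_mktuple. Qed.

Lemma measurable_sample : measurable_fun setT sample.
Proof.
apply/measurable_fun_tnthP => i.
apply: (eq_measurable_fun (U i)); last exact: measurable_funPT.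
by move=> w _ /=; rewrite tnth_mktuple.
Qed.

Lemma measurable_upd i :
  measurable_fun setT (fun z : T * n.-tuple T => upd i z.1 z.2).
Proof.
apply/measurable_fun_tnthP => j.
have [ji|ji] := eqVneq j i.
  apply: (eq_measurable_fun fst) => [z _ /=|]; last exact: measurable_fst.
  by rewrite tnth_mktuple ji eqxx.
apply: (eq_measurable_fun ((@tnth n T ^~ j) \o snd)).
  by move=> z _ /=; rewrite tnth_mktuple (negbTE ji).
by apply: measurableT_comp; [exact: measurable_tnth|exact: measurable_snd].
Qed.

Let rect (B : 'I_n -> set T) : set (n.-tuple T) :=
  [set t | forall j, B j (tnth t j)].

Let rects := [set rect B | B in [set B | forall j, measurable (B j)]].

(** The sigma-algebra on tuples is generated by single coordinates. Boxes generate it too and are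
    stable under intersection, as uniqueness of measures requires. *)
Let measurable_rects : measurable = <<s rects >>.
Proof.
apply/seteqP; split; last first.
  apply: smallest_sub; first exact: sigma_algebra_measurable.
  move=> _ [B mB <-].
  have -> : rect B = \bigcap_(j in [set: 'I_n]) ((@tnth n T ^~ j) @^-1` B j).
    by apply/seteqP; split => [t Bt j _|t Bt j]; [exact: Bt|exact: (Bt j I)].
  apply: fin_bigcap_measurable => // j _.
  by rewrite -[X in measurable X]setTI; exact: measurable_tnth.
apply: smallest_sub; first exact: smallest_sigma_algebra.
rewrite -bigcup_seq => A [/= i _] [B mB <-]; rewrite setTI.
apply: sub_sigma_algebra.
exists (fun j => if j == i then B else setT).
  by move=> j /=; case: ifP.
apply/seteqP; split => t /=; first by move/(_ i); rewrite eqxx.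
by move=> Bt j; case: eqVneq => // ->.
Qed.

Hypothesis indepU : independent_family P U.

(** By independence, redrawing the [i]-th sample leaves the law of the whole sample unchanged. The
    inner integral plays the role of the conditional expectation given the other samples. *)
Lemma sample_resample (i : 'I_n) (F : n.-tuple T -> \bar R) :
  measurable_fun setT F -> (forall t, 0 <= F t) ->
  \int[P]_w F (sample w) =
  \int[P]_w \int[P]_w' F (upd i (U i w') (sample w)).
Proof.
move=> mF F0.
pose S := isMeasurableFun.Build _ _ _ _ _ measurable_sample.
pose Sp : {RV P >-> (n.-tuple T : measurableType _)} := HB.pack sample S.
have mV : measurable_fun setT (fun z : T * n.-tuple T => upd i z.1 z.2).
  exact: measurable_upd.
have -> : \int[P]_w F (sample w) = \int[distribution P Sp]_z F z.
  by rewrite ge0_integral_distribution.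
have mFV : measurable_fun setT (fun z : T * n.-tuple T => F (upd i z.1 z.2)).
  exact: measurableT_comp mF mV.
have -> : \int[P]_w \int[P]_w' F (upd i (U i w') (sample w)) =
    \int[(distribution P (U i) \x distribution P Sp)%E]_z F (upd i z.1 z.2).
  rewrite (fubini_tonelli2 (fun z => F (upd i z.1 z.2)))//.
  set FV := (fun z => F (upd i z.1 z.2)) in mFV *.
  have mG := measurable_fun_fubini_tonelli_G FV mFV
    (fun=> F0 _) (m1 := distribution P (U i)).
  transitivity (\int[P]_w fubini_G (distribution P (U i)) FV (sample w)).
    apply: eq_integral => w _; rewrite /fubini_G; apply/esym.
    apply: (ge0_integral_distribution (U i)
      (f := fun u => FV (u, sample w))) => //.
    - by apply: (measurableT_comp mFV); exact: measurable_pair2.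
    - by move=> u; exact: F0.
  apply/esym; apply: (ge0_integral_distribution Sp) => // y.
  by apply: integral_ge0 => u _; exact: F0.
(* It remains to identify the law of the sample with the image under [upd i] of a product measure;
   agreement on boxes suffices. *)
rewrite -(@ge0_integral_pushforward _ _ _ _ _ _ mV _ setT F)//.
apply: eq_measure_integral => A mA _.
apply: (@measure_unique _ _ _ rects (fun=> setT)) => //.
- move=> _ _ [B mB <-] [C mC <-]; exists (fun j => B j `&` C j).
    by move=> j; exact: measurableI.
  by apply/seteqP; split => t /=; [move=> BC; split=> j; case: (BC j)|
    move=> [Bt Ct] j; split].
- by move=> _; exists (fun=> setT) => //; apply/seteqP; split.
- by rewrite bigcup_const//.
- move=> _ [B mB <-].
  transitivity (P (\bigcap_i (U i @^-1` B i))).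
    rewrite /distribution /pushforward /=; congr (P _).
    apply/seteqP; split => w /= Bw j; first by have := Bw j; rewrite tnth_mktuple.
    by rewrite tnth_mktuple; exact: Bw.
  rewrite indepU//.
  (* In the preimage of a box, the [i]-th side constrains only the fresh value, so the overwritten
     coordinate becomes free. *)
  pose B' j := if j == i then setT else B j.
  have E : (fun z : T * n.-tuple T => upd i z.1 z.2) @^-1` rect B =
      B i `*` rect B'.
    apply/seteqP; split => -[u t] /=.
      move=> But; split; first by have := But i; rewrite tnth_upd eqxx.
      by move=> j; rewrite /B'; case: eqVneq => // ji; have := But j;
         rewrite tnth_upd (negbTE ji).
    move=> [Bu Bt] j; rewrite tnth_upd; case: eqVneq => [->//|ji].
    by have := Bt j; rewrite /B' (negbTE ji).
  transitivity ((distribution P (U i) \x distribution P Sp) (B i `*` rect B'));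
    last by rewrite -E.
  have mB' j : measurable (B' j) by rewrite /B'; case: ifP.
  rewrite product_measure1E//; last first.
    by rewrite measurable_rects; apply: sub_sigma_algebra; exists B'.
  transitivity (P (U i @^-1` B i) * P (\bigcap_i (U i @^-1` B' i))).
    rewrite indepU// (bigD1 i)//= [in RHS](bigD1 i)//= [X in _ = _ * (P (_ @^-1` X) * _)]/B' eqxx.
    rewrite preimage_setT probability_setT mul1e; congr (_ * _).
    by apply: eq_bigr => j /negbTE ji; rewrite /B' ji.
  congr (_ * P _); apply/seteqP; split => w /= Bw j.
    by rewrite tnth_mktuple; exact: Bw.
  by have := Bw j; rewrite tnth_mktuple; exact.
- by move=> k; apply: le_lt_trans (ltry 1%R); exact: probability_le1.
Qed.

End Resampling.

Ltac mfun := repeat first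
  [ exact: measurable_cst | exact: measurable_funPT | exact: measurable_id | by []
  | apply: measurable_funX | apply: measurable_funB | apply: measurable_funD
  | apply: measurable_funM | apply: measurable_funN | apply: measurable_sum => ?
  | apply: measurableT_comp (@normr_measurable _ _) _
  | apply: measurable_maxr ].

Section Moments.
Context (R : realType) (d : measure_display) (Omega : measurableType d).
Variable P : probability Omega R.
Implicit Types F G : Omega -> R.

Definition mean F := (\int[P]_w (F w)%:E)%E.

Definition mean_le F (M : R) := (mean F <= M%:E)%E.

Lemma mean_ge0 F : (forall w, 0 <= F w) -> (0 <= mean F)%E.
Proof. by move=> F0; apply: integral_ge0 => w _; rewrite lee_fin. Qed.

Lemma le_mean F G : measurable_fun setT F -> measurable_fun setT G ->
  (forall w, 0 <= F w) -> (forall w, F w <= G w) -> (mean F <= mean G)%E.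
Proof.
move=> mF mG F0 FG; apply: ge0_le_integral => //.
- by move=> w _; rewrite lee_fin.
- exact/measurable_EFinP.
- exact/measurable_EFinP.
- by move=> w _; rewrite lee_fin.
Qed.

Lemma mean_cst (c : R) : mean (fun=> c) = c%:E.
Proof.
transitivity (c%:E * P setT)%E; first exact: (integral_cst P measurableT).
by rewrite probability_setT mule1.
Qed.

Lemma meanD F G : measurable_fun setT F -> measurable_fun setT G ->
  (forall w, 0 <= F w) -> (forall w, 0 <= G w) ->
  mean (fun w => F w + G w) = (mean F + mean G)%E.
Proof.
move=> mF mG F0 G0.
transitivity (\int[P]_w ((F w)%:E + (G w)%:E))%E; first by [].
apply: ge0_integralD => //.
- by move=> w _; rewrite lee_fin.
- exact/measurable_EFinP.
- by move=> w _; rewrite lee_fin.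
- exact/measurable_EFinP.
Qed.

(** The source of nearly all moment bounds below: a pointwise bound by a nonnegative combination
    passes to the means, and nonnegativity spares every integrability condition. *)
Lemma mean_le_lincomb (I : Type) (r : seq I) (pr : pred I) F (G : I -> Omega -> R)
    (c : I -> R) (c0 : R) (M : I -> R) :
  measurable_fun setT F -> (forall i, measurable_fun setT (G i)) ->
  (forall w, 0 <= F w) -> 0 <= c0 ->
  (forall i, pr i -> 0 <= c i) -> (forall i w, pr i -> 0 <= G i w) ->
  (forall i, pr i -> mean_le (G i) (M i)) ->
  (forall w, F w <= c0 + \sum_(i <- r | pr i) c i * G i w) ->
  mean_le F (c0 + \sum_(i <- r | pr i) c i * M i).
Proof.
move=> mF mG F0 c00 cp0 G0 GM FG; rewrite /mean_le.
(* Signs are known only on [pr], so the other functions are replaced by 0 before integration. *)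
pose G' i w := if pr i then c i * G i w else 0.
have G'0 i w : 0 <= G' i w.
  by rewrite /G'; case: ifPn => // p; rewrite mulr_ge0 ?cp0 ?G0.
have mG' i : measurable_fun setT (G' i).
  by rewrite /G'; case: (pr i); mfun.
have e w : \sum_(i <- r | pr i) c i * G i w = \sum_(i <- r) G' i w.
  by rewrite big_mkcond.
apply: (@le_trans _ _ (mean (fun w => c0 + \sum_(i <- r) G' i w))).
  apply: le_mean => //; first by mfun.
  by move=> w; rewrite -e.
rewrite meanD//; last 2 first.
- by mfun.
- by move=> w; rewrite sumr_ge0.
rewrite mean_cst EFinD leeD2l// /mean.
under eq_integral do rewrite -sumEFin.
rewrite ge0_integral_sum//; last 2 first.
- by move=> i; apply/measurable_EFinP.
- by move=> i w _; rewrite lee_fin.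
rewrite (big_mkcond pr) -sumEFin; apply: lee_sum => i _.
rewrite /G'; case: ifPn => p; last by rewrite -/(mean (fun=> 0)) mean_cst.
under eq_integral do rewrite EFinM.
rewrite ge0_integralZl_EFin//.
- by rewrite EFinM; apply: lee_wpmul2l; [rewrite lee_fin cp0|exact: GM].
- by move=> w _; rewrite lee_fin G0.
- exact/measurable_EFinP.
- exact: cp0.
Qed.

Lemma mean_leZ F G (c M : R) : measurable_fun setT F -> measurable_fun setT G ->
  (forall w, 0 <= F w) -> 0 <= c -> (forall w, 0 <= G w) ->
  mean_le G M -> (forall w, F w <= c * G w) ->
  mean_le F (c * M).
Proof.
move=> mF mG F0 c0 G0 GM FG.
have := @mean_le_lincomb unit [:: tt] xpredT F (fun=> G) (fun=> c) 0 (fun=> M)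
  mF (fun=> mG) F0 (lexx _) (fun _ _ => c0) (fun _ w _ => G0 w) (fun _ _ => GM).
by rewrite big_seq1 add0r; apply=> w; rewrite big_seq1 add0r.
Qed.

Lemma mean_le_cst F (c : R) : measurable_fun setT F -> (forall w, 0 <= F w) ->
  (forall w, F w <= c) -> mean_le F c.
Proof.
by move=> mF F0 Fc; rewrite /mean_le -[leRHS]mean_cst; apply: le_mean.
Qed.

Lemma integrable_le_pow4 F (M : R) : measurable_fun setT F ->
  mean_le (fun w => F w ^+ 4) M -> P.-integrable setT (EFin \o F).
Proof.
move=> mF FM; apply/integrableP; split; first exact/measurable_EFinP.
apply: (@le_lt_trans _ _ (mean (fun w => 1 + F w ^+ 4))).
  apply: (@le_mean (fun w => `|F w|)); [by mfun|by mfun|by []|move=> w].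
  have -> : F w ^+ 4 = (`|F w| ^+ 2) ^+ 2.
    by rewrite real_normK ?num_real// -exprM.
  (* [1 + a ^ 4 - a = (a ^ 2 - 1 / 2) ^ 2 + (a - 1 / 2) ^ 2 + 1 / 2]. *)
  by have : 0 <= `|F w| by []; move: `|F w| => a a0;
    have := sqr_ge0 (a ^+ 2 - 2^-1); have := sqr_ge0 (a - 2^-1); lra.
rewrite meanD//; [|by mfun|by move=> w; rewrite exprn_even_ge0].
by rewrite mean_cst lte_add_pinfty ?ltry// (le_lt_trans FM) ?ltry.
Qed.

Lemma markov_pow F (k : nat) (e M : R) : measurable_fun setT F ->
  0 < e -> mean_le (fun w => `|F w| ^+ k) M ->
  let A := [set w | e <= `|F w|] in (P A <= (M / e ^+ k)%:E)%E.
Proof.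
move=> mF e0 FM; rewrite /=.
have mA : measurable [set w | e <= `|F w|].
  rewrite -[X in measurable X]setTI.
  exact: (measurable_fun_ler (measurable_cst e) (measurableT_comp (@normr_measurable _ setT) mF)) _ _.
have ek : 0 < e ^+ k by rewrite exprn_gt0.
have -> : P [set w | e <= `|F w| ] = mean (\1_[set w | e <= `|F w|]).
  by rewrite /mean integral_indic// setIT.
rewrite mulrC.
apply: (@mean_leZ _ (fun w => `|F w| ^+ k)) => //.
- by mfun.
- by rewrite invr_ge0 ltW.
move=> w; rewrite indicE; case: (boolP (w \in _)) => [|_]; last first.
  by rewrite mulr_ge0 ?invr_ge0 ?exprn_ge0// ltW.
rewrite inE /= => eF; rewrite mulrC ler_pdivlMr// mul1r lerXn2r// ?nnegrE ltW//.
Qed.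

End Moments.

(** * Fourth moments of sums of conditionally centered terms *)

Section BlockMoment.
Context (R : realType) (d d' : measure_display) (Omega : measurableType d).
Context (T : measurableType d') (P : probability Omega R) (n : nat).
Variable U : 'I_n -> {RV P >-> T}.
Hypothesis indepU : independent_family P U.

Lemma mean_resample (i : 'I_n) (F : n.-tuple T -> R) :
  measurable_fun setT F -> (forall t, 0 <= F t) ->
  mean P (fun w => F (sample U w)) =
  (\int[P]_w mean P (fun w' => F (upd i (U i w') (sample U w))))%E.
Proof.
move=> mF F0; rewrite /mean.
by rewrite (sample_resample indepU i (F := EFin \o F))//; exact/measurable_EFinP.
Qed.

Lemma measurable_resampled (i : 'I_n) (F : n.-tuple T -> R) t :
  measurable_fun setT F -> measurable_fun setT (fun w' => F (upd i (U i w') t)).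
Proof.
move=> mF; apply: measurableT_comp mF _.
apply: (measurableT_comp (measurable_upd i) (g := fun w' => (U i w', t))).
exact: measurableT_comp (measurable_pair2 _) _.
Qed.

(** A conditional bound given the other samples, followed by total expectation. As [G] may depend on
    the tuple, the lemma can be iterated over several samples. *)
Lemma mean_le_resample (i : 'I_n) (F : n.-tuple T -> R) (G : n.-tuple T -> R) M :
  measurable_fun setT F -> (forall t, 0 <= F t) ->
  measurable_fun setT G -> (forall t, 0 <= G t) ->
  (forall t, mean_le P (fun w' => F (upd i (U i w') t)) (G t)) ->
  mean_le P (fun w => G (sample U w)) M ->
  mean_le P (fun w => F (sample U w)) M.
Proof.
move=> mF F0 mG G0 FG GM; apply: le_trans GM.
rewrite (mean_resample i)//; apply: ge0_le_integral => //.
- by move=> w _; exact: mean_ge0.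
- apply: (measurableT_comp _ (measurable_sample U) (f := fun t => mean P (fun w' => F (upd i (U i w') t)))).
  have mH : measurable_fun setT
    (fun z : Omega * n.-tuple T => (F (upd i (U i z.1) z.2))%:E).
    apply/measurable_EFinP; apply: measurableT_comp mF _.
    apply: (measurableT_comp (measurable_upd i) (g := fun z => (U i z.1, z.2))).
    apply/measurable_fun_pairP; split => /=; last exact: measurable_snd.
    by apply: (measurableT_comp (measurable_funPT (U i))); exact: measurable_fst.
  apply: (measurable_fun_fubini_tonelli_G _ mH _ (m1 := P)).
  by move=> z; rewrite lee_fin.
- by apply/measurable_EFinP; exact: measurableT_comp mG (measurable_sample U).
- by move=> w _; exact: FG.
Qed.

(** The coefficient of [s ^ 4] exceeds 1 by [1 / m] only, so that [m] successive steps cost a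
    bounded factor. The term linear in [z] is kept exact because its mean will vanish. *)
Lemma pow4_step (m s z : R) : 1 <= m ->
  (s + z) ^+ 4 <= (1 + m^-1) * s ^+ 4 + 19 * m * z ^+ 4 + 4 * s ^+ 3 * z.
Proof.
move=> m1; have m0 : 0 < m by lra.
(* [4 s z ^ 3 <= 2 s ^ 2 z ^ 2 + 2 z ^ 4] raises the coefficient of [s ^ 2 z ^ 2] from 6 to 8; then
   [16 m + 3 <= 19 m]. *)
suff H : 8 * (s ^+ 2 * z ^+ 2) <= m^-1 * s ^+ 4 + 16 * m * z ^+ 4.
  have h4 : 0 <= z ^+ 4 by rewrite exprn_even_ge0.
  have h5 : z ^+ 4 <= m * z ^+ 4 by rewrite ler_peMl.
  have := sqr_ge0 (s * z - z ^+ 2).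
  have -> : (s + z) ^+ 4 = s ^+ 4 + 4 * s ^+ 3 * z + 6 * (s ^+ 2 * z ^+ 2) + 4 * s * z ^+ 3 + z ^+ 4 by ring.
  have -> : (s * z - z ^+ 2) ^+ 2 = s ^+ 2 * z ^+ 2 - 2 * s * z ^+ 3 + z ^+ 4 by ring.
  lra.
have : 0 <= m^-1 * (s ^+ 2 - 4 * m * z ^+ 2) ^+ 2.
  by rewrite mulr_ge0 ?sqr_ge0// invr_ge0 ltW.
have -> : m^-1 * (s ^+ 2 - 4 * m * z ^+ 2) ^+ 2 =
  m^-1 * s ^+ 4 + 16 * m * z ^+ 4 - 8 * (s ^+ 2 * z ^+ 2) by field; lra.
by rewrite subr_ge0.
Qed.

(** The only signed term is linear in [Z]; it is split off as [B], which is integrable with mean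
    zero. *)
Lemma mean_pow4_step (Z : Omega -> R) (m s M : R) : 1 <= m ->
  measurable_fun setT Z -> mean P Z = 0 -> mean_le P (fun w => Z w ^+ 4) M ->
  mean_le P (fun w => (s + Z w) ^+ 4) ((1 + m^-1) * s ^+ 4 + 19 * m * M).
Proof.
move=> m1 mZ Z0 ZM.
have iZ : P.-integrable setT (EFin \o Z) by exact: integrable_le_pow4 mZ ZM.
have m0 : 0 < m by lra.
pose A w := (1 + m^-1) * s ^+ 4 + 19 * m * Z w ^+ 4.
pose B w := 4 * s ^+ 3 * Z w.
have mA : measurable_fun setT A by rewrite /A; mfun.
have c0 : 0 <= (1 + m^-1) * s ^+ 4.
  by rewrite mulr_ge0 ?exprn_even_ge0// addr_ge0// invr_ge0 ltW.
have A0 w : 0 <= A w.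
  by rewrite addr_ge0// mulr_ge0 ?exprn_even_ge0//; lra.
have AM : mean_le P A ((1 + m^-1) * s ^+ 4 + 19 * m * M).
  have := @mean_le_lincomb _ _ _ P unit [:: tt] xpredT A (fun _ w => Z w ^+ 4)
    (fun=> 19 * m) ((1 + m^-1) * s ^+ 4) (fun=> M) mA.
  rewrite big_seq1; apply => //.
  - by move=> _; mfun.
  - by move=> _ _; lra.
  - by move=> _ w _; rewrite exprn_even_ge0.
  - by move=> w; rewrite big_seq1.
have iA : P.-integrable setT (EFin \o A).
  apply/integrableP; split; first exact/measurable_EFinP.
  have -> : (\int[P]_w `|(EFin \o A) w|)%E = mean P A.
    by apply: eq_integral => w _ /=; rewrite ger0_norm.
  by apply: le_lt_trans AM _; exact: ltry.
have iB : P.-integrable setT (EFin \o B).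
  by apply: eq_integrable (integrableZl measurableT (4 * s ^+ 3) iZ) => // w _.
have B0 : mean P B = 0.
  transitivity ((4 * s ^+ 3)%:E * mean P Z)%E; last by rewrite Z0 mule0.
  exact: (integralZl measurableT iZ).
apply: (@le_trans _ _ (mean P (fun w => A w + B w))).
  by apply: le_mean; [mfun|mfun|move=> w; rewrite exprn_even_ge0|
    move=> w; exact: pow4_step].
have -> : mean P (fun w => A w + B w) = (mean P A + mean P B)%E.
  exact: (integralD_EFin measurableT iA iB).
by rewrite B0 adde0.
Qed.

(** Samples are integrated out one at a time: while sample [i] is redrawn, the rest of the sum is a
    constant, since its terms ignore that sample. Centering yields the factor [m ^ 2] where
    convexity alone would give [m ^ 4]. *)
Lemma mean_sum_pow4 (A : seq 'I_n) (m : nat) (M : R)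
    (zeta : 'I_n -> n.-tuple T -> R) :
  uniq A -> (size A <= m)%N -> (0 < m)%N -> 0 <= M ->
  (forall i, measurable_fun setT (zeta i)) ->
  {in A &, forall i j, i != j -> forall u t, zeta j (upd i u t) = zeta j t} ->
  {in A, forall i t, mean P (fun w' => zeta i (upd i (U i w') t)) = 0} ->
  {in A, forall i t, mean_le P (fun w' => zeta i (upd i (U i w') t) ^+ 4) M} ->
  mean_le P (fun w => (\sum_(i <- A) zeta i (sample U w)) ^+ 4)
    (19 * expR 1 * m%:R ^+ 2 * M).
Proof.
move=> uA sA m0 M0 mz indz z0 zM.
have m0R : 0 < m%:R :> R by rewrite ltr0n.
have m1 : 1 <= m%:R :> R by rewrite ler1n.
have em k : (k <= m)%N -> (1 + m%:R^-1) ^+ k <= expR 1 :> R.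
  move=> km; apply: (@le_trans _ _ ((expR m%:R^-1) ^+ k)).
    by rewrite lerXn2r ?nnegrE ?expR_ge0 ?expR_ge1Dx// addr_ge0// invr_ge0 ltW.
  rewrite -expRM_natl ler_expR -[leRHS](@mulfV _ m%:R) ?gt_eqF//.
  by rewrite ler_wpM2r ?invr_ge0 ?ler_nat// ltW.
(* The induction carries the solution of [a (k + 1) = (1 + 1 / m) a k + 19 m M] with [a 0 = 0]. *)
suff H : mean_le P (fun w => (\sum_(i <- A) zeta i (sample U w)) ^+ 4)
    (19 * m%:R ^+ 2 * M * ((1 + m%:R^-1) ^+ size A - 1)).
  apply: le_trans H _; rewrite lee_fin.
  have -> : 19 * expR 1 * m%:R ^+ 2 * M = 19 * m%:R ^+ 2 * M * expR 1 by ring.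
  rewrite ler_wpM2l//; first by rewrite !mulr_ge0 ?exprn_ge0 ?(ltW m0R)//.
  by rewrite (le_trans _ (em _ sA))// lerBlDr lerDl.
elim: A uA sA indz z0 zM => [|i A IH] /=.
  move=> _ _ _ _ _; rewrite subrr mulr0.
  under eq_fun do rewrite big_nil expr0n.
  by apply: mean_le_cst => //; mfun.
move=> /andP[iA uA] sA indz z0 zM.
pose S t := \sum_(j <- A) zeta j t.
have mS : measurable_fun setT S by rewrite /S; mfun.
have Su u t : S (upd i u t) = S t.
  rewrite /S big_seq [RHS]big_seq; apply: eq_bigr => j jA.
  apply: indz; rewrite ?inE ?eqxx ?jA ?orbT//.
  by apply: contraNneq iA => ->.
have m2 : 0 <= 1 + m%:R^-1 :> R by rewrite addr_ge0// invr_ge0 ltW.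
have g0 t : 0 <= (1 + m%:R^-1) * S t ^+ 4 + 19 * m%:R * M.
  by rewrite addr_ge0// mulr_ge0 ?exprn_even_ge0// mulr_ge0 ?(ltW m0R).
apply: (@mean_le_resample i (fun t => (\sum_(j <- i :: A) zeta j t) ^+ 4)
   (fun t => (1 + m%:R^-1) * S t ^+ 4 + 19 * m%:R * M)).
- by mfun.
- by move=> t; rewrite exprn_even_ge0.
- by mfun.
- exact: g0.
- move=> t.
  have := @mean_pow4_step (fun w' => zeta i (upd i (U i w') t)) m%:R (S t) M m1.
  under [X in _ -> _ -> _ -> mean_le _ X _]eq_fun => w'.
    rewrite -(Su (U i w') t) addrC.
    over.
  under [X in _ -> mean_le _ X _]eq_fun do rewrite big_cons -/(S _).
  apply; [exact: measurable_resampled|apply: z0|apply: zM]; exact: mem_head.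
have {}IH := IH uA (ltnW sA) _ _ _.
have := @mean_le_lincomb _ _ _ P unit [:: tt] xpredT
  (fun w => (1 + m%:R^-1) * S (sample U w) ^+ 4 + 19 * m%:R * M)
  (fun _ w => S (sample U w) ^+ 4) (fun=> 1 + m%:R^-1) (19 * m%:R * M)
  (fun=> 19 * m%:R ^+ 2 * M * ((1 + m%:R^-1) ^+ size A - 1)).
rewrite big_seq1.
have -> : 19 * m%:R * M + (1 + m%:R^-1) * (19 * m%:R ^+ 2 * M * ((1 + m%:R^-1) ^+ size A - 1))
  = 19 * m%:R ^+ 2 * M * ((1 + m%:R^-1) ^+ (size A).+1 - 1).
  rewrite (exprS (1 + _)); move: (_ ^+ size A) m0R => X; move: (m%:R : R) => r r0.
  by field; lra.
have mSs : measurable_fun setT (fun w => S (sample U w)).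
  exact: measurableT_comp mS (measurable_sample U).
apply.
- by mfun.
- by move=> _; mfun.
- by move=> w; exact: g0.
- by rewrite !mulr_ge0 ?(ltW m0R).
- by [].
- by move=> _ w _; rewrite exprn_even_ge0.
- move=> _ _; apply: IH.
  + by move=> j k jA kA; apply: indz; rewrite inE ?jA ?kA orbT.
  + by move=> j jA; apply: z0; rewrite inE jA orbT.
  + by move=> j jA; apply: zM; rewrite inE jA orbT.
- by move=> w; rewrite big_seq1 addrC.
Qed.

End BlockMoment.

(** * Gradient descent and removal of samples *)

Section WeightedSums.
Context (R : realType) (I : Type).
Implicit Types (r : seq I) (pr : pred I) (w a b : I -> R).

Lemma weighted_cauchy r pr w a b : (forall i, pr i -> 0 <= w i) ->
  (\sum_(i <- r | pr i) w i * (a i * b i)) ^+ 2 <=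
  (\sum_(i <- r | pr i) w i * a i ^+ 2) * (\sum_(i <- r | pr i) w i * b i ^+ 2).
Proof.
move=> w0; elim: r => [|i r IH]; first by rewrite !big_nil expr0n mulr0.
rewrite !big_cons; case: ifPn => // pi.
have A0 : 0 <= \sum_(j <- r | pr j) w j * a j ^+ 2.
  by apply: sumr_ge0 => j pj; rewrite mulr_ge0 ?w0 ?sqr_ge0.
have B0 : 0 <= \sum_(j <- r | pr j) w j * b j ^+ 2.
  by apply: sumr_ge0 => j pj; rewrite mulr_ge0 ?w0 ?sqr_ge0.
move: (w0 _ pi) IH A0 B0; move: (w i) (a i) (b i) => v x y v0.
move: (\sum_(_ <- _ | _) _) => S.
move: (\sum_(_ <- _ | _) _ * a _ ^+ 2) => A.
move: (\sum_(_ <- _ | _) _ * b _ ^+ 2) => B IH A0 B0.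
(* The cross terms of the expanded product: [S ^ 2 <= A B] and the inequality of arithmetic and
   geometric means. *)
suff H : 2 * (S * (x * y)) <= A * y ^+ 2 + B * x ^+ 2.
  have : v * (2 * (S * (x * y))) <= v * (A * y ^+ 2 + B * x ^+ 2) by rewrite ler_wpM2l.
  have -> : (v * (x * y) + S) ^+ 2 = S ^+ 2 + v * (2 * (S * (x * y))) + v ^+ 2 * (x * y) ^+ 2 by ring.
  have -> : (v * x ^+ 2 + A) * (v * y ^+ 2 + B) =
    A * B + v * (A * y ^+ 2 + B * x ^+ 2) + v ^+ 2 * (x * y) ^+ 2 by ring.
  lra.
have H0 : 0 <= A * y ^+ 2 + B * x ^+ 2 by apply: addr_ge0; apply: mulr_ge0 => //; exact: sqr_ge0.
apply: le_trans (ler_norm _) _; rewrite -ler_sqr ?nnegrE// real_normK ?num_real//.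
have -> : (2 * (S * (x * y))) ^+ 2 = 4 * (x * y) ^+ 2 * S ^+ 2 by ring.
apply: (@le_trans _ _ (4 * (x * y) ^+ 2 * (A * B))).
  by rewrite ler_wpM2l// mulr_ge0 ?sqr_ge0.
rewrite -subr_ge0.
have -> : (A * y ^+ 2 + B * x ^+ 2) ^+ 2 - 4 * (x * y) ^+ 2 * (A * B) =
  (A * y ^+ 2 - B * x ^+ 2) ^+ 2 by ring.
exact: sqr_ge0.
Qed.

Lemma sum_cauchy r pr a b :
  (\sum_(i <- r | pr i) a i * b i) ^+ 2 <=
  (\sum_(i <- r | pr i) a i ^+ 2) * (\sum_(i <- r | pr i) b i ^+ 2).
Proof.
have := @weighted_cauchy r pr (fun=> 1) a b (fun _ _ => ler01).
have e (F : I -> R) : \sum_(i <- r | pr i) 1 * F i = \sum_(i <- r | pr i) F i.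
  by apply: eq_bigr => i _; rewrite mul1r.
by rewrite (e (fun i => a i * b i)) (e (fun i => a i ^+ 2)) (e (fun i => b i ^+ 2)).
Qed.

Lemma weighted_sqr r pr w a : (forall i, pr i -> 0 <= w i) ->
  (\sum_(i <- r | pr i) w i * a i) ^+ 2 <=
  (\sum_(i <- r | pr i) w i) * (\sum_(i <- r | pr i) w i * a i ^+ 2).
Proof.
move=> w0; have := @weighted_cauchy r pr w (fun=> 1) a w0.
under eq_bigr do rewrite mul1r.
by under [X in _ <= X * _ -> _]eq_bigr do rewrite expr1n mulr1.
Qed.

(** Jensen's inequality for weights that need not sum to 1, by squaring twice; one more squaring
    gives eighth powers. *)
Lemma weighted_pow4 r pr w a : (forall i, pr i -> 0 <= w i) ->
  (\sum_(i <- r | pr i) w i * a i) ^+ 4 <=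
  (\sum_(i <- r | pr i) w i) ^+ 3 * (\sum_(i <- r | pr i) w i * a i ^+ 4).
Proof.
move=> w0; have W0 : 0 <= \sum_(i <- r | pr i) w i by exact: sumr_ge0.
rewrite (exprM _ 2 2).
apply: (@le_trans _ _ (((\sum_(i <- r | pr i) w i) *
    (\sum_(i <- r | pr i) w i * a i ^+ 2)) ^+ 2)).
  rewrite lerXn2r ?nnegrE ?sqr_ge0 ?weighted_sqr//.
  by rewrite mulr_ge0// sumr_ge0// => i pi; rewrite mulr_ge0 ?w0 ?sqr_ge0.
rewrite exprMn (exprSr _ 2) -mulrA ler_wpM2l ?sqr_ge0//.
under [X in _ <= _ * X]eq_bigr do rewrite (exprM _ 2 2).
exact: weighted_sqr.
Qed.

Lemma weighted_pow8 r pr w a : (forall i, pr i -> 0 <= w i) ->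
  (\sum_(i <- r | pr i) w i * a i) ^+ 8 <=
  (\sum_(i <- r | pr i) w i) ^+ 7 * (\sum_(i <- r | pr i) w i * a i ^+ 8).
Proof.
move=> w0; have W0 : 0 <= \sum_(i <- r | pr i) w i by exact: sumr_ge0.
rewrite (exprM _ 4 2).
apply: (@le_trans _ _ (((\sum_(i <- r | pr i) w i) ^+ 3 *
    (\sum_(i <- r | pr i) w i * a i ^+ 4)) ^+ 2)).
  have e4 x : 0 <= x ^+ 4 :> R by rewrite exprn_even_ge0.
  rewrite lerXn2r ?nnegrE ?weighted_pow4//.
  by rewrite mulr_ge0 ?exprn_ge0// sumr_ge0// => i pi; rewrite mulr_ge0 ?w0.
rewrite exprMn -exprM (exprSr _ 6) -mulrA ler_wpM2l ?exprn_ge0//.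
under [X in _ <= _ * X]eq_bigr do rewrite (exprM _ 4 2).
exact: weighted_sqr.
Qed.

End WeightedSums.

Lemma eq_lexx (R : realType) (a b : R) : a = b -> a <= b.
Proof. by move=> ->. Qed.

Section Euclidean.
Context (R : realType).

Definition dot m (u v : 'cV[R]_m) : R := (u^T *m v) 0 0.

Lemma dotE m (u v : 'cV[R]_m) : dot u v = \sum_i u i 0 * v i 0.
Proof. by rewrite /dot mxE; apply: eq_bigr => i _; rewrite mxE. Qed.

Lemma dotC m (u v : 'cV[R]_m) : dot u v = dot v u.
Proof. by rewrite !dotE; apply: eq_bigr => i _; rewrite mulrC. Qed.

Lemma dotDr m (u v w : 'cV[R]_m) : dot u (v + w) = dot u v + dot u w.
Proof. by rewrite /dot mulmxDr mxE. Qed.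

Lemma dotZr m (u v : 'cV[R]_m) a : dot u (a *: v) = a * dot u v.
Proof. by rewrite /dot -scalemxAr mxE. Qed.

Lemma dotNr m (u v : 'cV[R]_m) : dot u (- v) = - dot u v.
Proof. by rewrite /dot mulmxN mxE. Qed.

Lemma dotBr m (u v w : 'cV[R]_m) : dot u (v - w) = dot u v - dot u w.
Proof. by rewrite dotDr dotNr. Qed.

Lemma dot_adj m n (X : 'M[R]_(m, n)) u v : dot u (X *m v) = dot (X^T *m u) v.
Proof. by rewrite /dot trmx_mul trmxK mulmxA. Qed.

Lemma l2norm_ge0 m (v : 'cV[R]_m) : 0 <= l2norm v.
Proof. exact: sqrtr_ge0. Qed.

Lemma sqr_l2norm m (v : 'cV[R]_m) : l2norm v ^+ 2 = \sum_i v i 0 ^+ 2.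
Proof. by rewrite sqr_sqrtr// sumr_ge0// => i _; rewrite sqr_ge0. Qed.

Lemma dotvv m (v : 'cV[R]_m) : dot v v = l2norm v ^+ 2.
Proof. by rewrite sqr_l2norm dotE. Qed.

Lemma l2norm_le m (v : 'cV[R]_m) c : 0 <= c ->
  (l2norm v <= c) = (\sum_i v i 0 ^+ 2 <= c ^+ 2).
Proof. by move=> c0; rewrite -sqr_l2norm ler_sqr ?nnegrE ?l2norm_ge0. Qed.

Lemma dot_le m (u v : 'cV[R]_m) : `|dot u v| <= l2norm u * l2norm v.
Proof.
rewrite -ler_sqr ?nnegrE ?mulr_ge0 ?l2norm_ge0// real_normK ?num_real//.
by rewrite exprMn !sqr_l2norm dotE; exact: sum_cauchy.
Qed.

Lemma l2norm0 m : l2norm (0 : 'cV[R]_m) = 0.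
Proof. by rewrite /l2norm big1 ?sqrtr0// => i _; rewrite mxE expr0n. Qed.

Lemma l2norm0_eq0 m (v : 'cV[R]_m) : l2norm v = 0 -> v = 0.
Proof.
move=> v0; apply/colP => i; rewrite mxE.
have := sqr_l2norm v; rewrite v0 expr0n => /esym/eqP.
rewrite psumr_eq0 => [/allP/(_ i (mem_index_enum _))|j _]; last exact: sqr_ge0.
by rewrite /= sqrf_eq0 => /eqP.
Qed.

Lemma l2normZ m a (v : 'cV[R]_m) : l2norm (a *: v) = `|a| * l2norm v.
Proof.
rewrite /l2norm; under eq_bigr do rewrite mxE exprMn.
by rewrite -mulr_sumr sqrtrM ?sqr_ge0// sqrtr_sqr.
Qed.

Lemma l2normN m (v : 'cV[R]_m) : l2norm (- v) = l2norm v.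
Proof. by rewrite -scaleN1r l2normZ normrN1 mul1r. Qed.

Lemma l2normD m (u v : 'cV[R]_m) : l2norm (u + v) <= l2norm u + l2norm v.
Proof.
have s0 : 0 <= l2norm u + l2norm v by rewrite addr_ge0 ?l2norm_ge0.
rewrite -ler_sqr ?nnegrE ?l2norm_ge0//.
have -> : l2norm (u + v) ^+ 2 = l2norm u ^+ 2 + 2 * dot u v + l2norm v ^+ 2.
  rewrite -!dotvv dotDr dotC dotDr [dot (u + v) v]dotC dotDr [dot v u]dotC.
  by ring.
have := le_trans (ler_norm _) (dot_le u v).
have -> : (l2norm u + l2norm v) ^+ 2 =
  l2norm u ^+ 2 + 2 * (l2norm u * l2norm v) + l2norm v ^+ 2 by ring.
lra.
Qed.

Lemma l2normB m (u v : 'cV[R]_m) : l2norm (u - v) <= l2norm u + l2norm v.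
Proof. by rewrite -(l2normN v); exact: l2normD. Qed.

Lemma l2norm_entry m (v : 'cV[R]_m) i : `|v i 0| <= l2norm v.
Proof.
rewrite -ler_sqr ?nnegrE ?l2norm_ge0// sqr_l2norm real_normK ?num_real//.
by rewrite (bigD1 i)//= lerDl sumr_ge0// => j _; rewrite sqr_ge0.
Qed.

(** An operator norm bound in bilinear form: it is symmetric under transposition and is what a net
    argument delivers. *)
Definition opbound m n (X : 'M[R]_(m, n)) (L : R) :=
  forall u v, `|dot u (X *m v)| <= L * l2norm u * l2norm v.

Lemma opbound_mulmx m n (X : 'M[R]_(m, n)) L v : 0 <= L ->
  opbound X L -> l2norm (X *m v) <= L * l2norm v.
Proof.
move=> L0 /(_ (X *m v) v); rewrite dotvv ger0_norm ?sqr_ge0// expr2.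
have [->|vn0] := eqVneq (l2norm (X *m v)) 0.
  by rewrite mulr_ge0 ?l2norm_ge0.
have v0 : 0 < l2norm (X *m v) by rewrite lt_neqAle eq_sym vn0 l2norm_ge0.
by rewrite mulrAC ler_pM2r.
Qed.

Lemma opbound_tr m n (X : 'M[R]_(m, n)) L : opbound X L -> opbound X^T L.
Proof. by move=> XL u v; rewrite dot_adj trmxK dotC mulrAC. Qed.

End Euclidean.

Section Masking.
Context (R : realType) (n : nat).

(** Removed samples become zero rows instead of being deleted. The matrix format stays fixed,
    successive removals intersect, and a zero row with zero response adds nothing to a gradient. *)
Definition mask_rows (S : pred 'I_n) m (M : 'M[R]_(n, m)) : 'M[R]_(n, m) :=
  \matrix_(i, j) if S i then M i j else 0.

Lemma mask_mulmx S m q (M : 'M[R]_(n, m)) (B : 'M[R]_(m, q)) :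
  mask_rows S (M *m B) = mask_rows S M *m B.
Proof.
apply/matrixP => i j; rewrite !mxE; case: ifPn => Si.
  by apply: eq_bigr => k _; rewrite mxE Si.
by rewrite big1// => k _; rewrite mxE (negbTE Si) mul0r.
Qed.

Lemma mask_sub S m (A B : 'M[R]_(n, m)) :
  mask_rows S (A - B) = mask_rows S A - mask_rows S B.
Proof. by apply/matrixP => i j; rewrite !mxE; case: ifP; rewrite ?subrr. Qed.

Lemma mask_dot S (u v : 'cV[R]_n) : dot u (mask_rows S v) = dot (mask_rows S u) v.
Proof.
rewrite !dotE; apply: eq_bigr => i _; rewrite !mxE.
by case: ifP; rewrite ?mulr0 ?mul0r.
Qed.

Lemma mask_mask S S' m (M : 'M[R]_(n, m)) :
  mask_rows S (mask_rows S' M) = mask_rows (predI S S') M.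
Proof. by apply/matrixP => i j; rewrite !mxE /=; case: (S i). Qed.

Lemma mask_rowsT m (M : 'M[R]_(n, m)) : mask_rows predT M = M.
Proof. by apply/matrixP => i j; rewrite !mxE. Qed.

Lemma eq_mask_rows S S' m (M : 'M[R]_(n, m)) : S =1 S' ->
  mask_rows S M = mask_rows S' M.
Proof. by move=> SS'; apply/matrixP => i j; rewrite !mxE SS'. Qed.

Lemma mask_split S m (M : 'M[R]_(n, m)) :
  mask_rows (predC S) M = M - mask_rows S M.
Proof.
by apply/matrixP => i j; rewrite !mxE /=; case: (S i); rewrite /= ?subrr ?subr0.
Qed.

Lemma l2norm_mask S (v : 'cV[R]_n) : l2norm (mask_rows S v) <= l2norm v.
Proof.
rewrite l2norm_le ?l2norm_ge0// sqr_l2norm; apply: ler_sum => i _.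
by rewrite mxE; case: ifP => // _; rewrite expr0n sqr_ge0.
Qed.

Lemma mask_trmul S m q (A : 'M[R]_(n, m)) (B : 'M[R]_(n, q)) :
  (mask_rows S A)^T *m mask_rows S B = A^T *m mask_rows S B.
Proof.
apply/matrixP => i j; rewrite !mxE; apply: eq_bigr => k _; rewrite !mxE.
by case: ifP => //; rewrite !mulr0.
Qed.

End Masking.

(** * Gradient steps and their stability under removal of samples *)

Section Gradient.
Context (R : realType) (n q : nat).
Implicit Types (X : 'M[R]_(n, q)) (y : 'cV[R]_n) (b : 'cV[R]_q).

(** The negative gradient of [l2norm (y - X *m b) ^ 2 / (2 n)]. *)
Definition grad X y b : 'cV[R]_q := n%:R^-1 *: (X^T *m (y - X *m b)).

Lemma gdS X y delta b0 k :
  gd n X y delta b0 k.+1 =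
  gd n X y delta b0 k + delta k *: grad X y (gd n X y delta b0 k).
Proof. by rewrite /= /grad scalerA. Qed.

Lemma grad_mask S X y b :
  grad (mask_rows (predC S) X) (mask_rows (predC S) y) b =
  grad X y b - n%:R^-1 *: (X^T *m mask_rows S (y - X *m b)).
Proof.
rewrite /grad -mask_mulmx -mask_sub mask_trmul -scalerBr -mulmxBr.
by rewrite mask_split.
Qed.

Lemma grad_sub X y b b' :
  grad X y b - grad X y b' = - (n%:R^-1 *: (X^T *m (X *m (b - b')))).
Proof.
rewrite /grad -scalerBr -mulmxBr.
have -> : y - X *m b - (y - X *m b') = - (X *m (b - b')).
  rewrite mulmxBr; move: (X *m b) (X *m b') => u v.
  by apply/colP => i; rewrite !mxE; ring.
by rewrite mulmxN scalerN.
Qed.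

(** Since [1 + c * delta l <= expR (c * delta l)], the growth factors combine into the exponential
    of the total step size, whatever the number of steps. *)
Lemma gronwall (c : R) (delta e a : nat -> R) k :
  0 <= c -> (forall l, 0 <= delta l) -> (forall l, 0 <= e l) -> 0 <= a 0%N ->
  (forall l, a l.+1 <= (1 + c * delta l) * a l + delta l * e l) ->
  a k <= expR (c * \sum_(l < k) delta l) * (a 0%N + \sum_(l < k) delta l * e l).
Proof.
move=> c0 d0 e0 a0 aS; elim: k => [|k IH].
  by rewrite !big_ord0 mulr0 expR0 mul1r addr0.
rewrite !big_ord_recr /= [c * (_ + _)]mulrDr expRD.
set D := \sum_(l < k) delta l in IH *; set E := \sum_(l < k) _ in IH *.
have D0 : 0 <= D by apply: sumr_ge0 => l _.
have E0 : 0 <= E by apply: sumr_ge0 => l _; rewrite mulr_ge0.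
have cd : 0 <= c * delta k by rewrite mulr_ge0.
have H1 := expR_ge1Dx (c * delta k).
have H2 : 1 <= expR (c * D) by rewrite -expR0 ler_expR mulr_ge0.
have H3 : 0 <= delta k * e k by rewrite mulr_ge0.
apply: le_trans (aS k) _; rewrite addrA [X in _ <= X]mulrDr.
apply: lerD.
  rewrite [X in _ <= X * _]mulrC -mulrA.
  apply: (@le_trans _ _ ((1 + c * delta k) * (expR (c * D) * (a 0%N + E)))).
    by rewrite ler_wpM2l// addr_ge0.
  by rewrite ler_wpM2r// mulr_ge0 ?expR_ge0// addr_ge0.
rewrite ler_peMl//; apply: (le_trans H2).
rewrite ler_peMr ?expR_ge0//; apply: le_trans H1.
by rewrite lerDl.
Qed.

Variables (delta : nat -> R) (b0 : 'cV[R]_q) (L Y D B0 : R).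
Hypothesis n0 : (0 < n)%N.
Hypotheses (L0 : 0 <= L) (Y0 : 0 <= Y).
Hypothesis delta0 : forall l, 0 <= delta l.
Hypothesis deltaD : forall k, \sum_(l < k) delta l <= D.
Hypothesis b0B0 : l2norm b0 <= B0.

Let sn : R := Num.sqrt n%:R.

Let sn0 : 0 < sn. Proof. by rewrite sqrtr_gt0 ltr0n. Qed.

Let snn : sn * sn = n%:R. Proof. by rewrite -expr2 sqr_sqrtr. Qed.

Lemma l2norm_adj_scaled X (v : 'cV[R]_n) : opbound X (L * sn) ->
  l2norm (n%:R^-1 *: (X^T *m v)) <= L * (sn^-1 * l2norm v).
Proof.
move=> XL; rewrite l2normZ ger0_norm ?invr_ge0//.
apply: (@le_trans _ _ (n%:R^-1 * (L * sn * l2norm v))).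
  rewrite ler_wpM2l ?invr_ge0// opbound_mulmx//; last exact: opbound_tr.
  by rewrite mulr_ge0 ?(ltW sn0).
rewrite -snn; apply: eq_lexx; move: (l2norm v) => r; field.
by rewrite gt_eqF.
Qed.

(** The scale [sqrt n] of both the design and the responses cancels the normalization, so the bound
    is free of [n]. A gradient step is treated as an expansion by at most [1 + L ^ 2 * delta l],
    never as a contraction. *)
Definition gd_bound : R := expR (L ^+ 2 * D) * (B0 + D * (L * Y)).
Definition grad_bound : R := L * (Y + L * gd_bound).

Let D0 : 0 <= D. Proof. by apply: le_trans (deltaD 0); rewrite big_ord0. Qed.
Let B00 : 0 <= B0. Proof. exact: le_trans (l2norm_ge0 _) b0B0. Qed.

Lemma gd_bound_ge0 : 0 <= gd_bound.
Proof. by rewrite mulr_ge0 ?expR_ge0// addr_ge0// !mulr_ge0. Qed.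

Lemma grad_bound_ge0 : 0 <= grad_bound.
Proof. by rewrite mulr_ge0// addr_ge0// mulr_ge0// gd_bound_ge0. Qed.

Lemma l2norm_grad X y b : opbound X (L * sn) -> l2norm y <= Y * sn ->
  l2norm (grad X y b) <= L * (Y + L * l2norm b).
Proof.
move=> XL yY; apply: le_trans (l2norm_adj_scaled _ XL) _.
rewrite ler_wpM2l//.
apply: (@le_trans _ _ (sn^-1 * (Y * sn + L * sn * l2norm b))).
  rewrite ler_wpM2l ?invr_ge0 ?(ltW sn0)//.
  apply: le_trans (l2normB _ _) _; rewrite lerD// opbound_mulmx//.
  by rewrite mulr_ge0 ?(ltW sn0).
by apply: eq_lexx; move: (l2norm b) => r; field; rewrite gt_eqF.
Qed.

Lemma gd_le X y k : opbound X (L * sn) -> l2norm y <= Y * sn ->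
  l2norm (gd n X y delta b0 k) <= gd_bound.
Proof.
move=> XL yY.
have := @gronwall (L ^+ 2) delta (fun=> L * Y)
  (fun k => l2norm (gd n X y delta b0 k)) k.
move=> H; apply: le_trans (H _ _ _ _ _) _ => //.
- by rewrite sqr_ge0.
- by move=> l; rewrite mulr_ge0.
- exact: l2norm_ge0.
- move=> l; rewrite gdS; apply: le_trans (l2normD _ _) _.
  rewrite l2normZ ger0_norm//.
  have := l2norm_grad (gd n X y delta b0 l) XL yY.
  move: (l2norm (grad _ _ _)) (l2norm (gd _ _ _ _ _ _)) => g b gb.
  have -> : (1 + L ^+ 2 * delta l) * b + delta l * (L * Y) =
    b + delta l * (L * (Y + L * b)) by ring.
  by rewrite lerD2l ler_wpM2l.
rewrite /gd_bound -mulr_suml; apply: ler_pM.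
- exact: expR_ge0.
- by rewrite addr_ge0 ?l2norm_ge0// !mulr_ge0// sumr_ge0.
- by rewrite ler_expR ler_wpM2l ?sqr_ge0.
- by apply: lerD => //=; apply: ler_wpM2r; [exact: mulr_ge0|exact: deltaD].
Qed.

Lemma grad_le X y k : opbound X (L * sn) -> l2norm y <= Y * sn ->
  l2norm (grad X y (gd n X y delta b0 k)) <= grad_bound.
Proof.
move=> XL yY; apply: le_trans (l2norm_grad _ XL yY) _.
by rewrite ler_wpM2l// lerD2l ler_wpM2l// gd_le.
Qed.

(* Gronwall bound on the distance between the iterates with and without the
   samples in [A], in terms of the residuals of the latter on [A]. *)
Definition stab X y (A : pred 'I_n) k : R :=
  let b l := gd n (mask_rows (predC A) X) (mask_rows (predC A) y) delta b0 l in
  let rho l := sn^-1 * l2norm (mask_rows A (y - X *m b l)) in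
  expR (L ^+ 2 * D) * \sum_(l < k) delta l * (L * rho l).

(** The difference of the two recursions expands by [1 + L ^ 2 * delta l] and is driven by the
    residuals on [A] of the iterates that have not seen [A]. These residuals, and not those of the
    full iterates, can be controlled by independence. *)
Lemma stab_gd X y A k : opbound X (L * sn) ->
  l2norm (gd n X y delta b0 k -
    gd n (mask_rows (predC A) X) (mask_rows (predC A) y) delta b0 k) <=
  stab X y A k.
Proof.
move=> XL; rewrite /stab.
set X' := mask_rows _ X; set y' := mask_rows _ y.
set b := gd n X y delta b0; set b' := gd n X' y' delta b0.
pose r l : 'cV[R]_n := mask_rows A (y - X *m b' l).
have r0 l : 0 <= L * (sn^-1 * l2norm (r l)).
  by rewrite !mulr_ge0 ?invr_ge0 ?l2norm_ge0 ?(ltW sn0).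
have := @gronwall (L ^+ 2) delta (fun l => L * (sn^-1 * l2norm (r l)))
  (fun l => l2norm (b l - b' l)) k.
move=> H; apply: le_trans (H _ _ _ _ _) _ => //; first by rewrite sqr_ge0.
- exact: l2norm_ge0.
- move=> l; rewrite /b /b' !gdS -/b -/b' grad_mask -/(r l).
  set g := grad X y (b l); set g' := grad X y (b' l).
  have gg : g - g' = - (n%:R^-1 *: (X^T *m (X *m (b l - b' l)))).
    exact: grad_sub.
  have -> : b l + delta l *: g - (b' l + delta l *: (g' - n%:R^-1 *: (X^T *m r l)))
     = (b l - b' l) + delta l *: ((g - g') + n%:R^-1 *: (X^T *m r l)).
    by apply/colP => i; rewrite !mxE; ring.
  apply: le_trans (l2normD _ _) _; rewrite l2normZ ger0_norm// gg.
  have h1 : l2norm (- (n%:R^-1 *: (X^T *m (X *m (b l - b' l))))) <=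
     L ^+ 2 * l2norm (b l - b' l).
    rewrite l2normN; apply: le_trans (l2norm_adj_scaled _ XL) _.
    rewrite expr2 -mulrA ler_wpM2l//.
    apply: (@le_trans _ _ (sn^-1 * (L * sn * l2norm (b l - b' l)))).
      rewrite ler_wpM2l ?invr_ge0 ?(ltW sn0)// opbound_mulmx//.
      by rewrite mulr_ge0 ?(ltW sn0).
    by apply: eq_lexx; move: (l2norm _) => s; field; rewrite gt_eqF.
  have h2 := l2norm_adj_scaled (r l) XL.
  rewrite mulrDl mul1r -addrA lerD2l.
  rewrite [L ^+ 2 * _]mulrC -mulrA -mulrDr ler_wpM2l//.
  by apply: le_trans (l2normD _ _) _; rewrite lerD.
- rewrite /= subrr l2norm0 add0r; apply: ler_wpM2r.
    by apply: sumr_ge0 => l _; rewrite mulr_ge0.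
  by rewrite ler_expR; apply: ler_wpM2l; [exact: sqr_ge0|exact: deltaD].
Qed.

Lemma stab_grad X y A k (X' := mask_rows (predC A) X)
    (y' := mask_rows (predC A) y) (b' := gd n X' y' delta b0 k) :
  opbound X (L * sn) ->
  l2norm (grad X y (gd n X y delta b0 k) - grad X' y' b') <=
  L ^+ 2 * stab X y A k + L * (sn^-1 * l2norm (mask_rows A (y - X *m b'))).
Proof.
move=> XL; rewrite /X' /y' grad_mask.
set b := gd n X y delta b0 k.
have -> : grad X y b - (grad X y b' - n%:R^-1 *: (X^T *m mask_rows A (y - X *m b')))
  = - (n%:R^-1 *: (X^T *m (X *m (b - b')))) +
    n%:R^-1 *: (X^T *m mask_rows A (y - X *m b')).
  rewrite opprB addrCA addrC; congr (_ + _).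
  exact: grad_sub.
apply: le_trans (l2normD _ _) _; apply: lerD; last exact: l2norm_adj_scaled.
rewrite l2normN; apply: le_trans (l2norm_adj_scaled _ XL) _.
rewrite expr2 -mulrA ler_wpM2l//.
apply: (@le_trans _ _ (sn^-1 * (L * sn * l2norm (b - b')))).
  rewrite ler_wpM2l ?invr_ge0 ?(ltW sn0)// opbound_mulmx//.
  by rewrite mulr_ge0 ?(ltW sn0).
have -> : sn^-1 * (L * sn * l2norm (b - b')) = L * l2norm (b - b').
  by move: (l2norm _) => s; field; rewrite gt_eqF.
by rewrite ler_wpM2l// stab_gd.
Qed.

End Gradient.

(** * Operator norm bounds from a finite lattice net *)

Section LatticeNet.
Context (R : realType).

(** Sign and magnitude of each coordinate, in a finite type so that points can be counted. The two
    signs of zero only enlarge the count. *)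
Definition net_index (m : nat) := {ffun 'I_m -> bool * 'I_(4 * m).+1}.

(* Lattice points of mesh [1 / (4 sqrt m)]; those satisfying [in_net] lie in the
   unit ball. *)
Definition net_point m (k : net_index m) : 'cV[R]_m :=
  \col_j ((-1) ^+ (k j).1 * (((k j).2 : nat)%:R / (4 * Num.sqrt m%:R))).

Definition in_net m (k : net_index m) := (\sum_j (k j).2 ^ 2 <= 16 * m)%N.

Lemma net_scale_gt0 m : (0 < m)%N -> 0 < 4 * Num.sqrt m%:R :> R.
Proof. by move=> m0; rewrite mulr_gt0// sqrtr_gt0 ltr0n. Qed.

Lemma sqr_net_scale m : (4 * Num.sqrt m%:R) ^+ 2 = 16 * m%:R :> R.
Proof. by rewrite exprMn sqr_sqrtr//; congr (_ * _); ring. Qed.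

Lemma sqr_l2norm_net_point m (k : net_index m) : (0 < m)%N ->
  l2norm (net_point k) ^+ 2 = (\sum_j (k j).2 ^ 2)%N%:R / (16 * m%:R).
Proof.
move=> m0; rewrite sqr_l2norm natr_sum mulr_suml; apply: eq_bigr => j _.
rewrite mxE exprMn sqrr_sign mul1r exprMn exprVn sqr_net_scale.
by rewrite natrX.
Qed.

Lemma l2norm_net_point m (k : net_index m) : (0 < m)%N -> in_net k ->
  l2norm (net_point k) <= 1.
Proof.
move=> m0 kin; rewrite -ler_sqr ?nnegrE ?l2norm_ge0// sqr_l2norm_net_point//.
have m0R : 0 < m%:R :> R by rewrite ltr0n.
rewrite expr1n ler_pdivrMr; last by rewrite mulr_gt0.
by rewrite mul1r -natrM ler_nat.
Qed.

(** Coordinates are truncated towards zero, which keeps the point in the unit ball; an error of one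
    mesh per coordinate amounts to [1 / 4] in norm. *)
Lemma net_dense m (v : 'cV[R]_m) : (0 < m)%N -> l2norm v <= 1 ->
  exists2 k : net_index m, in_net k & l2norm (v - net_point k) <= 4^-1.
Proof.
move=> m0 v1; have c0 := net_scale_gt0 m0; have cc := sqr_net_scale m.
set c := 4 * Num.sqrt m%:R in c0 cc.
have m0R : 0 < m%:R :> R by rewrite ltr0n.
have cv0 j : 0 <= c * `|v j 0| by rewrite mulr_ge0// ltW.
have Nitv j := truncn_itv (cv0 j).
(* Magnitudes are at most [4 sqrt m <= 4 m], which explains the index range. *)
have cm : c <= (4 * m)%:R.
  rewrite -ler_sqr ?nnegrE ?(ltW c0)// cc -natrX -natrM ler_nat expnMn.
  by rewrite leq_mul// expnS expn1 leq_pmulr.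
have Nm j : (Num.truncn (c * `|v j 0|)%R < (4 * m).+1)%N.
  rewrite ltnS -(ler_nat R); have /andP[H _] := Nitv j.
  apply: le_trans H _; apply: le_trans cm.
  rewrite -[leRHS]mulr1 ler_wpM2l// ?(ltW c0)//.
  exact: le_trans (l2norm_entry _ _) v1.
exists [ffun j => (v j 0 < 0, Ordinal (Nm j))].
  rewrite /in_net -(ler_nat R) natrM -cc natr_sum.
  apply: (@le_trans _ _ (\sum_j (c ^+ 2 * v j 0 ^+ 2))).
    apply: ler_sum => j _; rewrite ffunE /= natrX.
    rewrite -(real_normK (num_real (v j 0))) -exprMn lerXn2r ?nnegrE//.
    by have /andP[] := Nitv j.
  rewrite -mulr_sumr -sqr_l2norm ler_piMr ?sqr_ge0//.
  by rewrite expr_le1 ?l2norm_ge0.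
rewrite l2norm_le ?invr_ge0//.
apply: (@le_trans _ _ (\sum_(j < m) (c ^- 2))).
  apply: ler_sum => j _; rewrite !mxE !ffunE /= -/c.
  have /andP[H1 H2] := Nitv j.
  have e : `|v j 0| = c * `|v j 0| / c by rewrite mulrAC divff ?mul1r// gt_eqF.
  rewrite {1}[v j 0]realEsign ?num_real//.
  rewrite -mulrBr exprMn sqrr_sign mul1r.
  have -> : c ^- 2 = c^-1 ^+ 2 by rewrite exprVn.
  rewrite {1}e -mulrBl.
  have h0 : 0 <= c * `|v j 0| - (Num.truncn (c * `|v j 0|))%:R by rewrite subr_ge0.
  rewrite lerXn2r ?nnegrE ?invr_ge0 ?(ltW c0)//.
    by rewrite mulr_ge0 ?invr_ge0 ?(ltW c0).
  rewrite ler_piMl ?invr_ge0 ?(ltW c0)//.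
  by move: H2; rewrite -natr1; move: (_%:R) => N; lra.
rewrite sumr_const card_ord -mulr_natr cc; apply: eq_lexx.
by field; rewrite gt_eqF.
Qed.

(** Each index gets the weight 2 to the power [16 m] minus the sum of its magnitudes. On the net
    this is at least 1, as the magnitudes sum to no more than their squares. The total weight
    factorizes over the coordinates, each giving at most 4 from two signs and a geometric series. *)
Lemma card_net m : #|@in_net m|%:R <= 2 ^+ (18 * m) :> R.
Proof.
have h2 : 0 <= 2^-1 :> R by rewrite invr_ge0.
rewrite -sum1_card natr_sum.
apply: (@le_trans _ _ (\sum_(k : net_index m)
    2 ^+ (16 * m) * \prod_j 2^-1 ^+ (k j).2)).
  rewrite [leRHS](bigID (fun k : net_index m => in_net k)) /=.
  rewrite -[leLHS]addr0; apply: lerD; last first.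
    by apply: sumr_ge0 => k _; rewrite mulr_ge0 ?exprn_ge0// prodr_ge0// => j _;
      rewrite exprn_ge0.
  apply: ler_sum => k; rewrite unfold_in => kin; rewrite prodrXr.
  have sk : (\sum_j (k j).2 <= 16 * m)%N.
    apply: leq_trans kin; apply: leq_sum => j _.
    by case: (nat_of_ord _) => // a; rewrite expnS expn1 leq_pmulr.
  by rewrite -(subnKC sk) exprD mulrAC exprVn mulfV ?expf_neq0// mul1r exprn_ege1// ler1n.
rewrite -mulr_sumr -(bigA_distr_bigA (fun (j : 'I_m) (x : bool * 'I_(4 * m).+1) => 2^-1 ^+ x.2 : R)).
have -> : (18 * m = 16 * m + 2 * m)%N by exact: (mulnDl 16 2 m).
rewrite exprD ler_wpM2l ?exprn_ge0// exprM.
rewrite prodr_const card_ord lerXn2r ?nnegrE ?exprn_ge0//.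
  by apply: sumr_ge0 => x _; rewrite exprn_ge0.
rewrite -(pair_bigA _ (fun (b : bool) (x : 'I_(4 * m).+1) => 2^-1 ^+ x : R)) /=.
rewrite sumr_const card_bool.
have -> : 2 ^+ 2 = 2 *+ 2 :> R by rewrite mulr2n; ring.
rewrite lerMn2r /=.
have : (1 - 2^-1) * (\sum_(i < (4 * m).+1) 2^-1 ^+ i) = 1 - 2^-1 ^+ (4 * m).+1 :> R.
  have := subrX1 (2^-1 : R) (4 * m).+1.
  by move: (\sum_(_ < _) _) (_ ^+ _) => A B; lra.
have : 0 <= 2^-1 ^+ (4 * m).+1 :> R by rewrite exprn_ge0.
by move: (\sum_(_ < _) _) (_ ^+ _) => A B; lra.
Qed.

Definition net_bounded m q (X : 'M[R]_(m, q)) (t : R) :=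
  [forall k : net_index m, forall l : net_index q,
    in_net k && in_net l ==>
      (`|dot (net_point k) (X *m net_point l)| <= t)].

(** Masking rows amounts to zeroing coordinates of the left net point, and the lattice net is closed
    under this. An arbitrary net of the ball would not be. *)
Lemma net_bounded_mask m q (X : 'M[R]_(m, q)) t S :
  net_bounded X t -> net_bounded (mask_rows S X) t.
Proof.
move=> /forallP H; apply/forallP => k; apply/forallP => l; apply/implyP.
move=> /andP[kin lin].
pose k' : net_index m := [ffun j => if S j then k j else (false, ord0)].
have -> : dot (net_point k) (mask_rows S X *m net_point l) =
          dot (net_point k') (X *m net_point l).
  rewrite -mask_mulmx mask_dot; congr (dot _ _).
  apply/colP => j; rewrite !mxE ffunE; case: ifP => //= _.
  by rewrite mul0r mulr0.
have /forallP/(_ l)/implyP := H k'; apply; rewrite lin andbT.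
apply: leq_trans kin; apply: leq_sum => j _; rewrite ffunE.
by case: ifP.
Qed.

Lemma net_bounded_opbound m q (X : 'M[R]_(m, q)) t :
  (0 < m)%N -> (0 < q)%N -> 0 <= t ->
  net_bounded X t -> opbound X (2 * t).
Proof.
move=> m0 q0 t0 /forallP H.
pose E : set R := [set r | exists u v,
  [/\ l2norm u <= 1, l2norm v <= 1 & r = dot u (X *m v)]].
have Eub : ubound E (\sum_i \sum_j `|X i j|).
  move=> _ [u [v [u1 v1 ->]]].
  apply: le_trans (ler_norm _) _; rewrite dotE.
  apply: le_trans (ler_norm_sum _ _ _) _; apply: ler_sum => i _.
  rewrite normrM mxE; apply: le_trans (_ : 1 * `|\sum_j X i j * v j 0| <= _).
    by rewrite ler_wpM2r// (le_trans (l2norm_entry _ _)).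
  rewrite mul1r; apply: le_trans (ler_norm_sum _ _ _) _.
  apply: ler_sum => j _; rewrite normrM ler_piMr//.
  exact: le_trans (l2norm_entry _ _) v1.
have E0 : E !=set0.
  by exists 0; exists 0, 0; rewrite !l2norm0 ler01 /dot mulmx0 mulmx0 mxE.
have supE : has_sup E by split => //; exists (\sum_i \sum_j `|X i j|).
have Es r : E r -> r <= sup E by move=> Er; exact: sup_upper_bound.
have scal m' (u : 'cV[R]_m') : l2norm u <= 4^-1 -> l2norm (4 *: u) <= 1.
  by rewrite l2normZ ger0_norm//; lra.
have st : sup E <= 2 * t.
  (* Moving [u] and [v] to net points at distance [1 / 4] costs a quarter of the supremum each. *)
  suff : sup E <= t + 2^-1 * sup E by lra.
  apply: ge_sup => // _ [u [v [u1 v1 ->]]].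
  have [k kin uk] := net_dense m0 u1.
  have [l lin vl] := net_dense q0 v1.
  have /forallP/(_ l)/implyP := H k; rewrite kin lin => /(_ erefl) kl.
  have h1 : 4 * dot (u - net_point k) (X *m v) <= sup E.
    apply: Es; exists (4 *: (u - net_point k)), v; split => //; first exact: scal.
    by rewrite [RHS]dotC dotZr dotC.
  have h2 : 4 * dot (net_point k) (X *m (v - net_point l)) <= sup E.
    apply: Es; exists (net_point k), (4 *: (v - net_point l)); split => //.
    - exact: l2norm_net_point.
    - exact: scal.
    - by rewrite -scalemxAr dotZr.
  have h3 := le_trans (ler_norm _) kl.
  have -> : dot u (X *m v) = dot (u - net_point k) (X *m v) +
    dot (net_point k) (X *m (v - net_point l)) +
    dot (net_point k) (X *m net_point l).
    rewrite mulmxBr dotBr [dot (u - _) _]dotC dotBr dotC [dot _ (net_point k)]dotC.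
    by ring.
  lra.
have key u v : l2norm u <= 1 -> l2norm v <= 1 -> `|dot u (X *m v)| <= 2 * t.
  move=> u1 v1; rewrite ler_norml; apply/andP; split.
    rewrite lerNl -dotNr -mulmxN; apply: le_trans st; apply: Es.
    by exists u, (- v); rewrite l2normN.
  by apply: le_trans st; apply: Es; exists u, v.
move=> u v.
have [u0|un0] := eqVneq (l2norm u) 0.
  by rewrite (l2norm0_eq0 u0) l2norm0 mulr0 mul0r /dot trmx0 mul0mx mxE normr0.
have [v0|vn0] := eqVneq (l2norm v) 0.
  by rewrite (l2norm0_eq0 v0) l2norm0 mulr0 /dot mulmx0 mulmx0 mxE normr0.
have up : 0 < l2norm u by rewrite lt_neqAle eq_sym un0 l2norm_ge0.
have vp : 0 < l2norm v by rewrite lt_neqAle eq_sym vn0 l2norm_ge0.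
have n1 m' (x : 'cV[R]_m') : l2norm x != 0 -> l2norm ((l2norm x)^-1 *: x) <= 1.
  by move=> x0; rewrite l2normZ ger0_norm ?invr_ge0 ?l2norm_ge0// mulVf.
have := key _ _ (n1 _ u un0) (n1 _ v vn0).
rewrite -scalemxAr dotZr dotC dotZr dotC.
rewrite mulrA normrM ger0_norm ?mulr_ge0 ?invr_ge0 ?l2norm_ge0//.
rewrite -invfM mulrC ler_pdivrMr ?mulr_gt0// => K; apply: le_trans K _.
by apply: eq_lexx; ring.
Qed.

End LatticeNet.

(** * The transport inequality and subgaussian marginals *)

Section Density.
Local Open Scope charge_scope.
Local Open Scope ereal_scope.
Context (R : realType) (d : measure_display) (T : measurableType d).
Variables (mu : probability T R) (h : T -> R).
Hypotheses (mh : measurable_fun setT h) (h0 : forall x, (0 <= h x)%R).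
Hypothesis h1 : \int[mu]_x (h x)%:E = 1.

Definition with_density (A : set T) : \bar R := \int[mu]_(x in A) (h x)%:E.

Let with_density0 : with_density set0 = 0.
Proof. exact: integral_set0. Qed.

Let with_density_ge0 A : 0 <= with_density A.
Proof. by apply: integral_ge0 => x _; rewrite lee_fin. Qed.

Let with_density_sigma_additive : semi_sigma_additive with_density.
Proof.
apply: semi_sigma_additive_nng_induced; first exact/measurable_EFinP.
by move=> x; rewrite lee_fin.
Qed.

HB.instance Definition _ := isMeasure.Build _ _ _ with_density
  with_density0 with_density_ge0 with_density_sigma_additive.

Let with_densityT : with_density setT = 1.
Proof. exact: h1. Qed.

HB.instance Definition _ := Measure_isProbability.Build _ _ _ with_density
  with_densityT.

Definition density_prob : probability T R := with_density.

Lemma density_prob_dom : density_prob `<< mu.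
Proof.
apply/null_content_dominatesP => A mA A0; apply: null_set_integral => //.
by apply/measurable_funTS; exact/measurable_EFinP.
Qed.

Lemma density_prob_RN :
  ae_eq mu setT ('d (charge_of_finite_measure density_prob) '/d mu)
    (EFin \o h).
Proof.
have dom := density_prob_dom.
apply: integral_ae_eq => //.
- exact: Radon_Nikodym_integrable.
- exact/measurable_EFinP.
- by move=> E _ mE; rewrite -Radon_Nikodym_integral.
Qed.

Lemma integral_density_prob (f : T -> R) : measurable_fun setT f ->
  density_prob.-integrable setT (EFin \o f) ->
  \int[density_prob]_x (f x)%:E = \int[mu]_x (f x * h x)%:E.
Proof.
move=> mf fi; rewrite -(Radon_Nikodym_change_of_variables density_prob_dom)//.
apply: ae_eq_integral => //.
- apply: emeasurable_funM; first exact/measurable_EFinP.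
  apply: (measurable_int mu).
  by apply: Radon_Nikodym_integrable; exact: density_prob_dom.
- by apply/measurable_EFinP; exact: measurable_funM.
- rewrite (_ : (fun x => (f x * h x)%:E) = (EFin \o f) \* (EFin \o h))//.
  by apply: ae_eqe_mul2l; exact: density_prob_RN.
Qed.

End Density.

Section KL.
Local Open Scope charge_scope.
Local Open Scope ereal_scope.
Context (R : realType).
Variables (mu : probability (measurableTypeR R) R) (h : R -> R).
Hypotheses (mh : measurable_fun setT (h : measurableTypeR R -> measurableTypeR R)).
Hypothesis h0 : forall x, (0 < h x)%R.

Lemma KL_divergenceE (nu : probability (measurableTypeR R) R) :
  nu `<< mu ->
  ae_eq mu setT ('d (charge_of_finite_measure nu) '/d mu) (EFin \o h) ->
  KL_divergence nu mu = \int[nu]_x (ln (h x))%:E.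
Proof.
move=> dom nuh; rewrite /KL_divergence; case: pselect => // H.
apply: ae_eq_integral => //.
- pose D x := ('d (charge_of_finite_measure nu) '/d mu) x.
  have mD : measurable_fun setT (fun x => fine (D x)).
    apply: (measurableT_comp (fine_measurable _)) => //.
    apply: (measurable_int mu); exact: Radon_Nikodym_integrable.
  (* The derivative is finite everywhere, so its logarithm is a case distinction between measurable
     functions. *)
  rewrite (_ : (fun x => _) = fun x => if (fine (D x) <= 0)%R then -oo
      else (ln (fine (D x)))%:E); last first.
    apply/funext => x; have := @Radon_Nikodym_fin_num _ _ _ (charge_of_finite_measure nu) mu x dom.
    by rewrite -/(D x); case: (D x).
  apply: measurable_fun_ifT => //.
  + by apply: measurable_fun_ler.
  + by apply/measurable_EFinP; apply: measurableT_comp mD; exact: measurable_ln.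
- apply/measurable_EFinP; apply: measurableT_comp mh; exact: measurable_ln.
- apply: (null_dominates_ae_eq measurableT dom).
  have [N [mN N0 NN]] := nuh.
  exists N; split => //; apply: subset_trans NN; apply: subsetC => x /= hx _.
  by rewrite hx//= leNgt h0.
Qed.

End KL.

(** * From the transport inequality to exponential moments *)

Section Transport.
Context (R : realType).

Lemma bounded_integrable (d : measure_display) (T : measurableType d)
    (P : probability T R) (F : T -> R) (C : R) :
  measurable_fun setT F -> (forall x, `|F x| <= C) ->
  P.-integrable setT (EFin \o F).
Proof.
move=> mF FC; apply/integrableP; split; first exact/measurable_EFinP.
apply: (@le_lt_trans _ _ C%:E); last exact: ltry.
rewrite -(mean_cst P C); apply: (@le_mean _ _ _ P (fun x => `|F x|)) => //; mfun.
Qed.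

(** The tangent to the square at [c]. Integrated with [c] the mean of [u], it is Jensen's inequality
    for the square. *)
Lemma le_var_sqr_dist (u v c : R) : `|u| <= `|v| -> 2 * c * u - c ^+ 2 <= v ^+ 2.
Proof.
move=> uv; have : u ^+ 2 <= v ^+ 2.
  by rewrite -[u ^+ 2]real_normK ?num_real// -[v ^+ 2]real_normK ?num_real//
    lerXn2r ?nnegrE.
by have := sqr_ge0 (u - c); rewrite sqrrB; lra.
Qed.

Variables (mu : probability (measurableTypeR R) R) (sigma : R).
Hypothesis muT2 : T2_inequality mu sigma.

Section Bounded.
Variables (g : measurableTypeR R -> measurableTypeR R) (M s : R).
Hypothesis mg : measurable_fun setT g.
Hypothesis gM : forall x, `|g x : R| <= M.
Hypothesis glip : forall x y : R, `|(g x : R) - g y| <= `|x - y|.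

Let Z : R := fine (mean mu (fun x => expR (s * g x))).

Let mexp : measurable_fun setT (fun x : measurableTypeR R => expR (s * g x) : R).
Proof. by apply: measurableT_comp; [exact: measurable_expR|mfun]. Qed.

Let sgM x : `|s * g x| <= `|s| * M.
Proof. by rewrite normrM ler_wpM2l. Qed.

Let exp_le x : expR (s * g x) <= expR (`|s| * M).
Proof. by rewrite ler_expR (le_trans (ler_norm _)). Qed.

Let le_exp x : expR (- (`|s| * M)) <= expR (s * g x).
Proof. by rewrite ler_expR; have := sgM x; rewrite ler_norml => /andP[]. Qed.

Let ZE : mean mu (fun x => expR (s * g x)) = Z%:E.
Proof.
rewrite fineK// ge0_fin_numE; last by apply: mean_ge0 => x; exact: expR_ge0.
apply: le_lt_trans (ltry (expR (`|s| * M))).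
by apply: mean_le_cst => // x; exact: expR_ge0.
Qed.

Let Z0 : 0 < Z.
Proof.
rewrite -lte_fin -ZE; apply: (@lt_le_trans _ _ (expR (- (`|s| * M)))%:E).
  by rewrite lte_fin expR_gt0.
by rewrite -(mean_cst mu); apply: le_mean => // x; exact: expR_ge0.
Qed.

Let h (x : measurableTypeR R) : R := expR (s * g x) * Z^-1.

Let mh : measurable_fun setT h. Proof. by rewrite /h; mfun. Qed.

Let h0 x : 0 < h x. Proof. by rewrite mulr_gt0 ?invr_gt0 ?expR_gt0. Qed.

Let h1 : (\int[mu]_x (h x)%:E = 1)%E.
Proof.
rewrite /h; under eq_integral do rewrite mulrC EFinM.
rewrite ge0_integralZl_EFin//.
- by rewrite -/(mean mu _) ZE -EFinM mulVf// gt_eqF.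
- exact/measurable_EFinP.
- by rewrite invr_ge0 ltW.
Qed.

Let nu := density_prob mh (fun x => ltW (h0 x)) h1.

Let ig (P : probability (measurableTypeR R) R) :
  P.-integrable setT (EFin \o (g : _ -> R)).
Proof. by apply: bounded_integrable gM. Qed.

Let a : R := fine (\int[nu]_x (g x : R)%:E).
Let b : R := fine (\int[mu]_x (g x : R)%:E).

Let aE : (\int[nu]_x (g x : R)%:E = a%:E)%E.
Proof. by rewrite fineK//; apply: integrable_fin_num => //; exact: ig. Qed.

Let bE : (\int[mu]_x (g x : R)%:E = b%:E)%E.
Proof. by rewrite fineK//; apply: integrable_fin_num => //; exact: ig. Qed.

Let kappa : R := s * a - ln Z.

Let lnh x : ln (h x) = s * g x - ln Z.
Proof.
by rewrite /h lnM ?posrE ?expR_gt0 ?invr_gt0// expRK lnV.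
Qed.

Let int_lnh : (\int[nu]_x (ln (h x))%:E = kappa%:E)%E.
Proof.
under eq_integral do rewrite lnh.
have i1 : nu.-integrable setT (EFin \o (fun x => s * (g x : R))).
  by apply: (@bounded_integrable _ _ _ _ (`|s| * M)) => //; mfun.
have i2 : nu.-integrable setT (EFin \o (fun=> - ln Z)).
  by apply: (@bounded_integrable _ _ _ _ `|ln Z|); [mfun|move=> x; rewrite normrN].
transitivity (\int[nu]_x (s * (g x : R))%:E + \int[nu]_x (- ln Z)%:E)%E.
  exact: (integralD_EFin measurableT i1 i2).
rewrite -/(mean nu (fun=> - ln Z)) mean_cst /kappa EFinD; congr (_ + _)%E.
rewrite EFinM -aE.
exact: (integralZl measurableT (ig nu) s).
Qed.

Let KLE : KL_divergence nu mu = kappa%:E.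
Proof.
rewrite (KL_divergenceE mh h0) ?int_lnh//; first exact: density_prob_dom.
exact: density_prob_RN.
Qed.

Let hV x : `|(h x)^-1| <= expR (`|s| * M) * Z.
Proof.
rewrite ger0_norm ?invr_ge0 ?(ltW (h0 x))// /h invfM invrK ler_wpM2r ?(ltW Z0)//.
by rewrite -expRN ler_expR; have := sgM x; rewrite ler_norml => /andP[H _]; rewrite lerNl.
Qed.

(** Gibbs' inequality: [1 - 1 / h <= ln h] pointwise, and the left side has integral zero under [nu]
    because [nu] has density [h]. *)
Let kappa_ge0 : 0 <= kappa.
Proof.
have mV : measurable_fun setT (fun x => (h x)^-1).
  rewrite (_ : (fun x => _) = fun x => Z * expR (- (s * g x))).
    by mfun; apply: measurableT_comp; [exact: measurable_expR|mfun].
  by apply/funext => x; rewrite /h invfM invrK expRN mulrC.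
have iV : nu.-integrable setT (EFin \o (fun x => (h x)^-1)).
  exact: bounded_integrable hV.
have iC : nu.-integrable setT (EFin \o (fun=> 1 : R)).
  by apply: (@bounded_integrable _ _ _ _ 1) => [|x]; [mfun|rewrite normr1].
have iN : nu.-integrable setT (EFin \o (fun x => - (h x)^-1)).
  by apply: bounded_integrable => [|x]; [mfun|rewrite normrN; exact: hV].
have e0 : (\int[nu]_x (1 - (h x)^-1)%:E = 0)%E.
  transitivity (\int[nu]_x 1%:E + \int[nu]_x (- (h x)^-1)%:E)%E.
    exact: (integralD_EFin measurableT iC iN).
  rewrite -/(mean nu (fun=> 1)) mean_cst integral_density_prob//; last by mfun.
  rewrite (_ : (fun x => _) = fun=> (- 1)%:E).
    by rewrite -/(mean mu (fun=> -1)) mean_cst -EFinD subrr.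
  by apply/funext => x; rewrite mulNr mulVf// gt_eqF.
rewrite -lee_fin -int_lnh; rewrite -[leLHS]e0.
apply: le_integral => //.
- apply: (@bounded_integrable _ _ _ _ (1 + expR (`|s| * M) * Z)); first by mfun.
  by move=> x; rewrite (le_trans (ler_normB _ _))// normr1 lerD2l.
- apply: (@bounded_integrable _ _ _ _ (`|s| * M + `|ln Z|)).
    by apply: measurableT_comp mh; exact: measurable_ln.
  by move=> x; rewrite /= lnh (le_trans (ler_normB _ _))// lerD2r.
- move=> x _; rewrite /= lee_fin.
  have hp : 0 < (h x)^-1 by rewrite invr_gt0.
  have := @le_ln1Dx _ ((h x)^-1 - 1); 
  rewrite (_ : 1 + ((h x)^-1 - 1) = (h x)^-1); last by ring.
  rewrite lnV ?posrE//.
  by move=> H; have : - ln (h x) <= (h x)^-1 - 1; [apply: H; lra|lra].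
Qed.

(** The mean of [g z.1 - g z.2] is fixed by the marginals; Jensen's inequality and the Lipschitz
    bound on [g] then compare its square with the transport cost. *)
Let coupling_ge pi : coupling mu nu pi ->
  (((b - a) ^+ 2)%:E <=
   \int[pi]_z (((z.1 : R) - (z.2 : R)) ^+ 2)%:E)%E.
Proof.
move=> cpl.
pose G1 (z : measurableTypeR R * measurableTypeR R) : R := g z.1.
pose G2 (z : measurableTypeR R * measurableTypeR R) : R := g z.2.
have mG1 : measurable_fun setT G1 by apply: measurableT_comp mg _.
have mG2 : measurable_fun setT G2 by apply: measurableT_comp mg _.
have i1 : pi.-integrable setT (EFin \o G1).
  by apply: (@bounded_integrable _ _ _ _ M) => // z; exact: gM.
have i2 : pi.-integrable setT (EFin \o G2).
  by apply: (@bounded_integrable _ _ _ _ M) => // z; exact: gM.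
have e1 : (\int[pi]_z (G1 z)%:E = b%:E)%E.
  rewrite -bE.
  transitivity (\int[pushforward pi fst]_x (g x : R)%:E)%E.
    apply/esym; apply: (integral_pushforward measurable_fst) => //.
    exact/measurable_EFinP.
  apply: eq_measure_integral => A mA _.
  transitivity (pi (A `*` setT)); last by have [] := cpl _ mA.
  congr (pi _).
  by apply/seteqP; split => -[x1 x2] //= [].
have e2 : (\int[pi]_z (G2 z)%:E = a%:E)%E.
  rewrite -aE.
  transitivity (\int[pushforward pi snd]_x (g x : R)%:E)%E.
    apply/esym; apply: (integral_pushforward measurable_snd) => //.
    exact/measurable_EFinP.
  apply: eq_measure_integral => A mA _.
  transitivity (pi (setT `*` A)); last by have [] := cpl _ mA.
  congr (pi _).
  by apply/seteqP; split => -[x1 x2] //= [].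
pose c := b - a.
pose F z := 2 * c * (G1 z - G2 z) - c ^+ 2.
have iD : pi.-integrable setT (EFin \o (fun z => 2 * c * (G1 z - G2 z))).
  apply: (@bounded_integrable _ _ _ _ (`|2 * c| * (M + M))); first by mfun.
  move=> z; rewrite normrM ler_wpM2l// (le_trans (ler_normB _ _))//.
  by rewrite lerD//; exact: gM.
have iC : pi.-integrable setT (EFin \o (fun=> - c ^+ 2)).
  by apply: (@bounded_integrable _ _ _ _ (c ^+ 2)) => [|z];
    [mfun|rewrite normrN ger0_norm ?sqr_ge0].
have FE : (\int[pi]_z (F z)%:E = (c ^+ 2)%:E)%E.
  transitivity (\int[pi]_z (2 * c * (G1 z - G2 z))%:E +
    \int[pi]_z (- c ^+ 2)%:E)%E; first exact: (integralD_EFin measurableT iD iC).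
  rewrite -/(mean pi (fun=> - c ^+ 2)) mean_cst.
  have iB : pi.-integrable setT (EFin \o (fun z => G1 z - G2 z)).
    apply: (@bounded_integrable _ _ _ _ (M + M)); first by mfun.
    by move=> z; rewrite (le_trans (ler_normB _ _))// lerD//; exact: gM.
  have -> : (\int[pi]_z (2 * c * (G1 z - G2 z))%:E = (2 * c)%:E * (b - a)%:E)%E.
    transitivity ((2 * c)%:E * \int[pi]_z (G1 z - G2 z)%:E)%E.
      exact: (integralZl measurableT iB).
    congr (_ * _)%E; rewrite EFinB -e1 -e2.
    exact: (integralB_EFin measurableT i1 i2).
  by rewrite -EFinM -EFinD; congr EFin; rewrite /c; ring.
rewrite -/c -FE.
have mS : measurable_fun setT (fun z => (G1 z - G2 z) ^+ 2) by mfun.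
apply: (@le_trans _ _ (mean pi (fun z => (G1 z - G2 z) ^+ 2))).
  apply: le_integral => //.
  - apply: (@bounded_integrable _ _ _ _ (`|2 * c| * (M + M) + c ^+ 2)).
      by rewrite /F; mfun.
    move=> z; rewrite (le_trans (ler_normB _ _))//.
    rewrite [`|c ^+ 2|]ger0_norm ?sqr_ge0// lerD2r normrM ler_wpM2l//.
    by rewrite (le_trans (ler_normB _ _))// lerD//; exact: gM.
  - apply: (@bounded_integrable _ _ _ _ ((M + M) ^+ 2)) => // z.
    rewrite normrX lerXn2r ?nnegrE ?addr_ge0 ?(le_trans _ (gM 0))//.
    by rewrite (le_trans (ler_normB _ _))// lerD//; exact: gM.
  - by move=> z _; rewrite /= lee_fin /F; apply: le_var_sqr_dist.
apply: le_mean => //.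
- by mfun.
- by move=> z; rewrite sqr_ge0.
- move=> z; rewrite -[leLHS]real_normK ?num_real// -[leRHS]real_normK ?num_real//.
  by rewrite lerXn2r ?nnegrE//; exact: glip.
Qed.

(* [T2] is applied to [mu] tilted by [expR (s * g)], whose divergence is
   [s * a - ln Z], while [W2] dominates [`|b - a|] because [g] is 1-Lipschitz;
   maximizing a quadratic in [b - a] then bounds [ln Z]. *)
Lemma T2_bounded_mgf :
  (mean mu (fun x => expR (s * g x)) <=
   (expR (s * b + s ^+ 2 * sigma ^+ 2 / 2))%:E)%E.
Proof.
have [sigma0 T2] := muT2.
have := T2 nu; rewrite KLE ltry => /(_ isT).
rewrite /W2 lee_sqrt; last first.
  by rewrite -EFinM lee_fin mulr_ge0// mulr_ge0// sqr_ge0.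
move=> W.
have : (((b - a) ^+ 2)%:E <= (2 * sigma ^+ 2)%:E * kappa%:E)%E.
  apply: le_trans W; apply: le_ereal_inf_tmp => _ [pi cpl <-].
  exact: coupling_ge.
rewrite -EFinM lee_fin => H.
rewrite ZE lee_fin -[leLHS](@lnK R) ?posrE// ler_expR.
have -> : ln Z = s * a - kappa by rewrite /kappa opprB addrC subrK.
move: H kappa_ge0; rewrite /kappa; move: (s * a - ln Z) => k H k0.
(* For [sigma = 0] the inequality forces [a = b]; the completed square used otherwise divides by
   [sigma ^ 2]. *)
have [s0|s0] := eqVneq sigma 0.
  move: H; rewrite s0 expr0n /= => H.
  have : (b - a) ^+ 2 <= 0 by apply: le_trans H _; rewrite !(mulr0, mul0r).
  move=> H2; have : (b - a) ^+ 2 = 0 by apply: le_anti; rewrite H2 sqr_ge0.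
  by move=> /eqP; rewrite sqrf_eq0 subr_eq0 => /eqP ->; rewrite mulr0 mul0r addr0 gerBl.
have sp : 0 < sigma ^+ 2 by rewrite exprn_even_gt0.
have : 0 <= (2 * sigma ^+ 2)^-1 * (s * sigma ^+ 2 - (a - b)) ^+ 2.
  by rewrite mulr_ge0 ?sqr_ge0// invr_ge0 mulr_ge0// ltW.
have -> : (2 * sigma ^+ 2)^-1 * (s * sigma ^+ 2 - (a - b)) ^+ 2 =
  s ^+ 2 * sigma ^+ 2 / 2 - s * (a - b) + (b - a) ^+ 2 / (2 * sigma ^+ 2).
  by field; exact: s0.
have : (b - a) ^+ 2 / (2 * sigma ^+ 2) <= k.
  by rewrite ler_pdivrMr; [rewrite mulrC|rewrite mulr_gt0].
by move: ((b - a) ^+ 2 / _) => q; lra.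
Qed.

End Bounded.

Hypothesis mean0 : ('E_mu[id] = 0)%E.
Hypothesis var1 : ('V_mu[id] = 1)%E.

Let int_id : (\int[mu]_x (x : R)%:E = 0)%E.
Proof. by move: mean0; rewrite unlock. Qed.

Let int_sqr : mean mu (fun x : measurableTypeR R => (x : R) ^+ 2) = 1%:E.
Proof.
move: var1; rewrite /variance unlock mean0 unlock => <-.
by apply: eq_integral => x _; rewrite -[RHS]/((((x : R) - 0) * ((x : R) - 0))%:E) subr0 expr2.
Qed.

Let mid : measurable_fun setT (id : measurableTypeR R -> measurableTypeR R).
Proof. exact: measurable_id. Qed.

(** Tilting by the identity would presuppose the finite exponential moments that are to be proved;
    bounded truncations can be tilted at once. *)
Let clip (M : R) (x : measurableTypeR R) : measurableTypeR R :=
  Num.max (- M) (Num.min (x : R) M).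

Let mclip M : measurable_fun setT (clip M).
Proof.
apply: measurable_maxr; first exact: measurable_cst.
by apply: measurable_minr => //; exact: measurable_cst.
Qed.

Let clip_le (M : R) x : 0 <= M -> `|clip M x : R| <= M.
Proof.
move=> M0; rewrite /clip ler_norml; apply/andP; split.
  by rewrite le_max lexx.
by rewrite ge_max ge_min lexx orbT andbT; lra.
Qed.

Let clip_lip (M x y : R) : 0 <= M -> `|(clip M x : R) - clip M y| <= `|x - y|.
Proof.
move=> _; apply: (@le_trans _ _ `|Num.min x M - Num.min y M|).
  rewrite /clip /Num.max; move: (Num.min x M) (Num.min y M) => u v.
  have := ler_norm (u - v); have := ler_norm (v - u); rewrite (distrC v).
  by move=> *; case: ltP => ?; case: ltP => ?; rewrite ler_norml; lra.
rewrite /Num.min; have := ler_norm (x - y); have := ler_norm (y - x).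
rewrite (distrC y).
by move=> *; case: ltP => ?; case: ltP => ?; rewrite ler_norml; lra.
Qed.

(** The part of [x] cut off is at most [|x| - M <= x ^ 2 / M]. With unit variance, the truncation
    has mean at most [1 / M] in absolute value. *)
Let clip_err (M x : R) : 0 < M -> `|(clip M x : R) - x| <= M^-1 * x ^+ 2.
Proof.
move=> M0; have h0 : 0 <= M^-1 * x ^+ 2 by rewrite mulr_ge0 ?sqr_ge0// invr_ge0 ltW.
have h1 : 2 * `|x| - M <= M^-1 * x ^+ 2.
  have : 0 <= M^-1 * (`|x| - M) ^+ 2 by rewrite mulr_ge0 ?sqr_ge0// invr_ge0 ltW.
  rewrite -(real_normK (num_real x)).
  have -> : M^-1 * (`|x| - M) ^+ 2 = M^-1 * `|x| ^+ 2 - (2 * `|x| - M).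
    by field; rewrite gt_eqF.
  lra.
have := ler_norm x; have := ler_norm (- x); rewrite normrN ler_norml => h2 h3.
rewrite /clip /Num.max /Num.min.
by case: (ltP x M) => k1; case: ltP => k2; lra.
Qed.

(** The bound for bounded functions is applied to truncations at levels above [N], whose means are
    small. Fatou's lemma removes the truncation at fixed [N], after which [N] tends to infinity and
    the error in the mean disappears. *)
Lemma T2_mgf (s : R) :
  mean_le mu (fun x : measurableTypeR R => expR (s * (x : R)))
    (expR (s ^+ 2 * sigma ^+ 2 / 2)).
Proof.
have ii : mu.-integrable setT (EFin \o (id : measurableTypeR R -> measurableTypeR R)).
  apply/integrableP; split; first exact/measurable_EFinP.
  apply: (@le_lt_trans _ _ (mean mu (fun x : measurableTypeR R => 1 + (x : R) ^+ 2))).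
    apply: (@le_mean _ _ _ mu (fun x : measurableTypeR R => `|x : R|)) => //; [by mfun|by mfun|move=> x].
    rewrite -(real_normK (num_real x)); move: `|_| (normr_ge0 x) => r r0.
    by have := sqr_ge0 (r - 2^-1); rewrite sqrrB; lra.
  rewrite meanD//; last by move=> x; rewrite sqr_ge0.
  by rewrite [X in (_ + X)%E]int_sqr mean_cst -EFinD ltry.
have bM (M : R) : 0 < M ->
    `|fine (\int[mu]_x (clip M x : R)%:E)%E| <= M^-1.
  move=> M0.
  have ic : mu.-integrable setT (EFin \o (clip M : _ -> R)).
    by apply: bounded_integrable (mclip M) _ => x; exact/clip_le/ltW.
  have : (\int[mu]_x (clip M x : R)%:E = \int[mu]_x ((clip M x : R) - x)%:E)%E.
    transitivity (\int[mu]_x (clip M x : R)%:E - \int[mu]_x (x : R)%:E)%E.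
      by rewrite int_id sube0.
    by apply/esym; exact: (integralB_EFin measurableT ic ii).
  have iB : mu.-integrable setT (EFin \o (fun x => (clip M x : R) - x)).
    exact: (integrableB measurableT ic ii).
  move=> e; rewrite e -lee_fin -[leRHS]mule1 -int_sqr.
  have fi : (\int[mu]_x ((clip M x : R) - x)%:E)%E \is a fin_num.
    exact: integrable_fin_num.
  rewrite -fine_abse// fineK ?abse_fin_num//.
  apply: le_trans (le_abse_integral mu measurableT _) _.
    by apply/measurable_EFinP; exact: (measurable_funB (mclip M) mid).
  have : mean_le mu (fun x => `|(clip M x : R) - x|) (M^-1 * 1).
    apply: (@mean_leZ _ _ _ _ _ (fun x : measurableTypeR R => (x : R) ^+ 2)) => //.
    - by apply: measurableT_comp (@normr_measurable _ _) _;
        exact: (measurable_funB (mclip M) mid).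
    - by rewrite invr_ge0 ltW.
    - by move=> x; rewrite sqr_ge0.
    - by rewrite /mean_le int_sqr.
    - by move=> x; exact: clip_err.
  by rewrite int_sqr /mean_le mulr1 mule1.
pose c0 : R := s ^+ 2 * sigma ^+ 2 / 2.
have key (N : nat) : mean_le mu (fun x : measurableTypeR R => expR (s * (x : R)))
    (expR (`|s| * N.+1%:R^-1 + c0)).
  pose f n (x : measurableTypeR R) : R := expR (s * clip (n + N).+1%:R x).
  have mf n : measurable_fun setT (f n).
    apply: measurableT_comp; first exact: measurable_expR.
    by apply: measurable_funM; [exact: measurable_cst|exact: mclip].
  have fle n : mean_le mu (f n) (expR (`|s| * N.+1%:R^-1 + c0)).
    have n0 : 0 < (n + N).+1%:R :> R by [].
    apply: le_trans (T2_bounded_mgf s (mclip (n + N).+1%:R)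
      (fun x => clip_le x (ltW n0)) (fun x y => clip_lip x y (ltW n0))) _.
    rewrite lee_fin ler_expR lerD2r; apply: le_trans (ler_norm _) _.
    rewrite normrM ler_wpM2l//; apply: le_trans (bM _ n0) _.
    by rewrite lef_pV2 ?posrE// ler_nat ltnS leq_addl.
  have flim x : (f ^~ x) @ \oo --> expR (s * (x : R)).
    apply: cvg_near_cst; near=> n; rewrite /f /clip.
    have xn : `|x : R| <= (n + N).+1%:R.
      have : `|x : R| < n%:R by near: n; exact: nbhs_infty_gtr.
      by move=> /ltW /le_trans; apply; rewrite ler_nat leqW// leq_addr.
    move: xn; rewrite ler_norml => /andP[x1 x2].
    by rewrite (min_idPl x2) (max_idPr x1).
  rewrite /mean_le /mean.
  rewrite (_ : (fun x => _) = fun x => limn_einf (fun n => (f n x)%:E)); last first.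
    apply/funext => x; apply/esym.
    have cf : (fun n => (f n x)%:E) @ \oo --> (expR (s * (x : R)))%:E.
      by apply: cvg_EFin; [exact: nearW|exact: flim].
    rewrite is_cvg_limn_einfE; last by apply/cvg_ex; exists (expR (s * (x : R)))%:E.
    exact/cvg_lim.
  apply: le_trans (@fatou _ _ _ mu _ measurableT
    (fun n x => (f n x)%:E) _ _) _.
  - by move=> n; exact/measurable_EFinP.
  - by move=> n x _; rewrite lee_fin expR_ge0.
  rewrite limn_einf_lim; apply: lime_le; first exact: is_cvg_einfs.
  apply: nearW => n; apply: le_trans (fle n); apply: ereal_inf_lbound.
  by exists n => /=.
have lim0 : (fun N : nat => (expR (`|s| * N.+1%:R^-1 + c0))%:E) @ \oo --> (expR c0)%:E.
  apply: cvg_EFin; first exact: nearW.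
  rewrite -[X in _ --> expR X]add0r -[X in _ --> expR (X + _)](mulr0 `|s|).
  apply: (continuous_cvg _ (@continuous_expR R _)).
  apply: cvgD; last exact: cvg_cst.
  by apply: cvgM; [exact: cvg_cst|exact: cvg_harmonic].
rewrite /mean_le -/c0 -(cvg_lim _ lim0)//.
apply: lime_ge; first by apply/cvg_ex; exists (expR c0)%:E.
by apply: nearW => N; exact: key.
Unshelve. all: end_near.
Qed.

End Transport.

(** * Averages over blocks *)

Section ProductMean.
Context (R : realType) (d d' : measure_display) (Omega : measurableType d).
Context (T : measurableType d') (P : probability Omega R) (n : nat).
Variable U : 'I_n -> {RV P >-> T}.
Hypothesis indepU : independent_family P U.

(** Independence enters by redrawing one sample at a time, which freezes all the other factors. *)
Lemma mean_le_prod (f : 'I_n -> T -> R) (c : 'I_n -> R) :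
  (forall i, measurable_fun setT (f i)) -> (forall i u, 0 <= f i u) ->
  (forall i, 0 <= c i) ->
  (forall i, mean_le P (fun w => f i (U i w)) (c i)) ->
  mean_le P (fun w => \prod_i f i (U i w)) (\prod_i c i).
Proof.
move=> mf f0 c0 fc.
have mft i : measurable_fun setT (fun t : n.-tuple T => f i (tnth t i)).
  by apply: measurableT_comp (mf i) _; exact: measurable_tnth.
suff H (A : seq 'I_n) : uniq A ->
    mean_le P (fun w => \prod_(i <- A) f i (tnth (sample U w) i)) (\prod_(i <- A) c i).
  have := H (index_enum _) (index_enum_uniq _).
  by under eq_fun do under eq_bigr do rewrite tnth_mktuple.
elim: A => [_|i A IH /=].
  under eq_fun do rewrite big_nil.
  by rewrite big_nil; apply: mean_le_cst => //; exact: measurable_cst.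
move=> /andP[iA uA].
have mP : measurable_fun setT (fun t : n.-tuple T => \prod_(j <- A) f j (tnth t j)).
  by apply: measurable_prod => j _; exact: mft.
have P0 t : 0 <= \prod_(j <- A) f j (tnth t j) by apply: prodr_ge0 => j _.
rewrite big_cons.
apply: (@mean_le_resample _ _ _ _ _ _ _ _ indepU i
  (fun t => \prod_(j <- i :: A) f j (tnth t j))
  (fun t => c i * \prod_(j <- A) f j (tnth t j))).
- by apply: measurable_prod => j _; exact: mft.
- by move=> t; apply: prodr_ge0 => j _.
- by mfun.
- by move=> t; rewrite mulr_ge0.
- move=> t.
  have -> : (fun w' => \prod_(j <- i :: A) f j (tnth (upd i (U i w') t) j)) =
    (fun w' => f i (U i w') * \prod_(j <- A) f j (tnth t j)).
    apply/funext => w'; rewrite big_cons tnth_upd eqxx; congr (_ * _).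
    rewrite big_seq [RHS]big_seq; apply: eq_bigr => j jA.
    by rewrite tnth_upd; case: eqVneq => // ji; rewrite -ji jA in iA.
  rewrite mulrC; apply: (@mean_leZ _ _ _ _ _ (fun w' => f i (U i w'))) => //.
  + by apply: measurable_funM => //; apply: measurableT_comp => //; exact: mf.
  + by apply: measurableT_comp => //; exact: mf.
  + by move=> w; rewrite mulr_ge0.
  + by move=> w; rewrite mulrC.
apply: (@mean_leZ _ _ _ _ _ (fun w => \prod_(j <- A) f j (tnth (sample U w) j))) => //.
- by apply: measurable_funM => //; exact: measurableT_comp mP (measurable_sample U).
- by exact: measurableT_comp mP (measurable_sample U).
- by move=> w; rewrite mulr_ge0.
- exact: IH.
Qed.

End ProductMean.

Section SameLaw.
Context (R : realType) (d d' : measure_display) (Omega : measurableType d).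
Context (T : measurableType d') (P : probability Omega R).
Variables U V : {RV P >-> T}.
Hypothesis UV : same_law P U V.

Lemma same_law_mean (F : T -> R) : measurable_fun setT F ->
  mean P (fun w => F (U w)) = mean P (fun w => F (V w)).
Proof.
move=> mF; rewrite /mean [LHS]integralE [RHS]integralE.
have pos (G : T -> \bar R) : measurable_fun setT G -> (forall u, (0 <= G u)%E) ->
  (\int[P]_w G (U w) = \int[P]_w G (V w))%E.
  move=> mG G0.
  rewrite -(ge0_integral_distribution U mG G0) -(ge0_integral_distribution V mG G0).
  by apply: eq_measure_integral => A mA _; exact: UV.
have mF' : measurable_fun setT (EFin \o F) by exact/measurable_EFinP.
congr (_ - _)%E.
- transitivity (\int[P]_w ((EFin \o F)^\+ (U w)))%E.
    by apply: eq_integral => w _; rewrite ?funeposE ?funenegE.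
  rewrite pos; last 2 first.
  + exact: measurable_funepos.
  + by move=> u; exact: funepos_ge0.
  by apply: eq_integral => w _; rewrite ?funeposE ?funenegE.
- transitivity (\int[P]_w ((EFin \o F)^\- (U w)))%E.
    by apply: eq_integral => w _; rewrite ?funeposE ?funenegE.
  rewrite pos; last 2 first.
  + exact: measurable_funeneg.
  + by move=> u; exact: funeneg_ge0.
  by apply: eq_integral => w _; rewrite ?funeposE ?funenegE.
Qed.

End SameLaw.

Section BlockAverage.
Context (R : realType) (d d' : measure_display) (Omega : measurableType d).
Context (T : measurableType d') (P : probability Omega R) (n : nat).
Variable U : 'I_n -> {RV P >-> T}.
Hypothesis indepU : independent_family P U.
Variable m : nat.
Hypotheses (m0 : (0 < m)%N) (mn : (m <= n)%N).

Definition same_block : rel 'I_n := fun i j => (i %/ m == j %/ m)%N.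

Lemma card_same_block i : (#|[pred j | same_block i j]| <= m)%N.
Proof.
have inj : {in [pred j | same_block i j] &, injective (fun j : 'I_n => inord (j %% m) : 'I_m.-1.+1)}.
  move=> j k; rewrite !inE /same_block => /eqP ij /eqP ik /(congr1 val) /=.
  rewrite !inordK ?prednK ?ltn_pmod// => e; apply/val_inj => /=.
  by rewrite (divn_eq j m) (divn_eq k m) -ij -ik e.
by rewrite -(card_in_imset inj) (leq_trans (max_card _))// card_ord prednK.
Qed.

(** The successor counts a last block that may be shorter than [m]; it is absorbed by [m <= n]. *)
Lemma nblocks_le : ((n %/ m).+1%:R / n%:R : R) <= 2 / m%:R.
Proof.
have m0R : 0 < m%:R :> R by rewrite ltr0n.
have n0R : 0 < n%:R :> R by rewrite ltr0n (leq_trans m0).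
rewrite ler_pdivrMr// mulrAC ler_pdivlMr// -!natrM ler_nat.
rewrite mulSn mul2n -addnn addnC leq_add//; exact: leq_divM.
Qed.

(* Within a block the summands form a centered sequence given everything outside
   the block, hence a gain of [m ^ 2]; different blocks are only averaged. *)
Lemma mean_block_average (M : R) (zeta : 'I_n -> n.-tuple T -> R) : 0 <= M ->
  (forall i, measurable_fun setT (zeta i)) ->
  (forall i j, same_block i j -> i != j ->
     forall u t, zeta j (upd i u t) = zeta j t) ->
  (forall i t, mean P (fun w' => zeta i (upd i (U i w') t)) = 0) ->
  (forall i t, mean_le P (fun w' => zeta i (upd i (U i w') t) ^+ 4) M) ->
  mean_le P (fun w => (n%:R^-1 * \sum_i zeta i (sample U w)) ^+ 4)
    (304 * expR 1 * M / m%:R ^+ 2).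
Proof.
move=> M0 mz indz z0 zM.
have m0R : 0 < m%:R :> R by rewrite ltr0n.
have n0R : 0 < n%:R :> R by rewrite ltr0n (leq_trans m0).
pose B := (n %/ m).+1.
pose blk (b : 'I_B) := [seq i : 'I_n <- enum 'I_n | (i %/ m == b)%N].
pose S b t := \sum_(i <- blk b) zeta i t.
have mzs i : measurable_fun setT (fun w => zeta i (sample U w)).
  exact: measurableT_comp (mz i) (measurable_sample U).
have mS b : measurable_fun setT (fun w => S b (sample U w)).
  by apply: measurable_sum => i; exact: mzs.
have SE t : \sum_i zeta i t = \sum_b S b t.
  rewrite (partition_big (fun i : 'I_n => inord (i %/ m) : 'I_B) xpredT)//=.
  apply: eq_bigr => b _; rewrite /S /blk big_filter big_enum_cond /=.
  apply: eq_bigl => i; rewrite -val_eqE /= inordK//.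
  by rewrite /B ltnS leq_div2r// ltnW.
have sS b : mean_le P (fun w => S b (sample U w) ^+ 4)
    (19 * expR 1 * m%:R ^+ 2 * M).
  have bb i j : i \in blk b -> j \in blk b -> same_block i j.
    rewrite !mem_filter /same_block => /andP[/eqP -> _] /andP[/eqP -> _]; exact: eqxx.
  apply: mean_sum_pow4 => //.
  - by rewrite filter_uniq// enum_uniq.
  - case: (posnP (size (blk b))) => [->//|s0].
    have [i ib] : exists i, i \in blk b.
      by case: (blk b) s0 => // i s _; exists i; exact: mem_head.
    apply: leq_trans (card_same_block i).
    rewrite -(card_uniqP _); last by rewrite filter_uniq// enum_uniq.
    by apply: subset_leq_card; apply/fintype.subsetP => j jb; rewrite inE; exact: bb.
  - by move=> i j ib jb ij u t; apply: indz => //; exact: bb.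
have nB : \sum_(b < B) n%:R^-1 = B%:R / n%:R :> R.
  by rewrite sumr_const card_ord mulr_natl.
have := @mean_le_lincomb _ _ _ P _ (index_enum 'I_B) xpredT
  (fun w => (n%:R^-1 * \sum_i zeta i (sample U w)) ^+ 4)
  (fun b w => S b (sample U w) ^+ 4) (fun=> (B%:R / n%:R) ^+ 3 * n%:R^-1) 0
  (fun=> 19 * expR 1 * m%:R ^+ 2 * M).
rewrite add0r => H.
apply: le_trans (H _ _ _ _ _ _ _ _) _ => //.
- by apply: measurable_funX; apply: measurable_funM => //; exact: measurable_sum.
- by move=> b; exact: measurable_funX.
- by move=> w; rewrite exprn_even_ge0.
- by move=> b w _; rewrite exprn_even_ge0.
- move=> w; rewrite add0r SE mulr_sumr.
  have := @weighted_pow4 R _ (index_enum 'I_B) xpredT (fun=> n%:R^-1)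
    (fun b => S b (sample U w)).
  rewrite nB => W; apply: le_trans (W _) _; first by move=> _ _; rewrite invr_ge0.
  by rewrite mulr_sumr; apply: eq_lexx; apply: eq_bigr => b _; rewrite mulrA.
rewrite lee_fin sumr_const card_ord -mulr_natl.
apply: (@le_trans _ _ ((B%:R / n%:R) ^+ 4 * (19 * expR 1 * m%:R ^+ 2 * M))).
  by apply: eq_lexx; rewrite exprSr; ring.
(* [304 = 2 ^ 4 * 19]: the 2 comes from the number of blocks, the 19 from the bound on one block. *)
apply: (@le_trans _ _ ((2 / m%:R) ^+ 4 * (19 * expR 1 * m%:R ^+ 2 * M))).
  rewrite ler_wpM2r//.
    by rewrite !mulr_ge0 ?expR_ge0 ?exprn_ge0 ?(ltW m0R).
  by rewrite lerXn2r ?nblocks_le// nnegrE divr_ge0// ltW.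
apply: eq_lexx; move: (expR 1) m0R => e; move: (m%:R : R) => r r0.
by field; rewrite gt_eqF.
Qed.

End BlockAverage.

(** * Measurability and moments of a single sample *)

Section MeasurableMatrices.
Context (R : realType) (d : measure_display) (D : measurableType d).

Definition measurable_mx m n (F : D -> 'M[R]_(m, n)) :=
  forall i j, measurable_fun setT (fun t => F t i j).

Lemma measurable_entry m n (i : 'I_m) (j : 'I_n) :
  measurable_fun setT (fun M : borel_mx R m n => (M : 'M[R]_(m, n)) i j).
Proof.
move=> _ B mB; rewrite setTI; apply: sub_sigma_algebra.
by exists i, j, B.
Qed.

Lemma measurable_borel_mx m n (F : D -> 'M[R]_(m, n)) :
  measurable_mx F -> measurable_fun setT (F : D -> borel_mx R m n).
Proof.
move=> mF; pose F' := F : D -> borel_mx R m n.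
apply: (@measurability _ _ D (borel_mx R m n) setT F' (@mx_cylinders R m n)) => //.
by move=> _ [_ [i [j [B [mB ->]]]] <-]; exact: mF.
Qed.

Lemma measurable_mx_cst m n (M : 'M[R]_(m, n)) : measurable_mx (fun=> M).
Proof. by move=> i j; exact: measurable_cst. Qed.

Lemma measurable_mxD m n (F G : D -> 'M[R]_(m, n)) :
  measurable_mx F -> measurable_mx G -> measurable_mx (fun t => F t + G t).
Proof.
move=> mF mG i j; under eq_fun do rewrite mxE.
by apply: measurable_funD; [exact: mF|exact: mG].
Qed.

Lemma measurable_mxB m n (F G : D -> 'M[R]_(m, n)) :
  measurable_mx F -> measurable_mx G -> measurable_mx (fun t => F t - G t).
Proof.
move=> mF mG i j; under eq_fun do rewrite !mxE.
by apply: measurable_funB; [exact: mF|exact: mG].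
Qed.

Lemma measurable_mxZ m n (a : R) (F : D -> 'M[R]_(m, n)) :
  measurable_mx F -> measurable_mx (fun t => a *: F t).
Proof.
move=> mF i j; under eq_fun do rewrite mxE.
by apply: measurable_funM; [exact: measurable_cst|exact: mF].
Qed.

Lemma measurable_mxM m n p (F : D -> 'M[R]_(m, n)) (G : D -> 'M[R]_(n, p)) :
  measurable_mx F -> measurable_mx G -> measurable_mx (fun t => F t *m G t).
Proof.
move=> mF mG i j; under eq_fun do rewrite mxE.
by apply: measurable_sum => k; apply: measurable_funM; [exact: mF|exact: mG].
Qed.

Lemma measurable_mx_tr m n (F : D -> 'M[R]_(m, n)) :
  measurable_mx F -> measurable_mx (fun t => (F t)^T).
Proof. by move=> mF i j; under eq_fun do rewrite mxE; exact: mF. Qed.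

Lemma measurable_mx_mask m n S (F : D -> 'M[R]_(m, n)) :
  measurable_mx F -> measurable_mx (fun t => mask_rows S (F t)).
Proof.
move=> mF i j; under eq_fun do rewrite mxE.
by case: (S i); [exact: mF|exact: measurable_cst].
Qed.

Lemma measurable_dot m (F G : D -> 'cV[R]_m) :
  measurable_mx F -> measurable_mx G -> measurable_fun setT (fun t => dot (F t) (G t)).
Proof.
by move=> mF mG; exact: (measurable_mxM (measurable_mx_tr mF) mG 0 0).
Qed.

Lemma measurable_l2norm m (F : D -> 'cV[R]_m) :
  measurable_mx F -> measurable_fun setT (fun t => l2norm (F t)).
Proof.
move=> mF; apply: (measurableT_comp (f := @Num.sqrt R)).
  by apply: continuous_measurable_fun; exact: sqrt_continuous.
by apply: measurable_sum => i; apply: measurable_funX; exact: mF.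
Qed.

Lemma measurable_mx_grad n q (X : D -> 'M[R]_(n, q)) (y : D -> 'cV[R]_n) b :
  measurable_mx X -> measurable_mx y -> measurable_mx b ->
  measurable_mx (fun t => grad (X t) (y t) (b t)).
Proof.
move=> mX my mb; apply: measurable_mxZ; apply: measurable_mxM.
  exact: measurable_mx_tr.
by apply: measurable_mxB => //; exact: measurable_mxM.
Qed.

Lemma measurable_mx_gd n q (X : D -> 'M[R]_(n, q)) (y : D -> 'cV[R]_n) delta b0 k :
  measurable_mx X -> measurable_mx y ->
  measurable_mx (fun t => gd n (X t) (y t) delta b0 k).
Proof.
move=> mX my; elim: k => [|k IH]; first exact: measurable_mx_cst.
have -> : (fun t => gd n (X t) (y t) delta b0 k.+1) = (fun t =>
    gd n (X t) (y t) delta b0 k +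
    delta k *: grad (X t) (y t) (gd n (X t) (y t) delta b0 k)).
  by apply/funext => t; rewrite gdS.
by apply: measurable_mxD => //; apply: measurable_mxZ; exact: measurable_mx_grad.
Qed.

Lemma measurable_net_bounded m q (X : D -> 'M[R]_(m, q)) (c : R) :
  measurable_mx X -> measurable_fun setT (fun t => net_bounded (X t) c).
Proof.
move=> mX; apply: (measurable_fun_bool true).
have -> : setT `&` (fun t => net_bounded (X t) c) @^-1` [set true] =
  \bigcap_(kl in [set kl : net_index m * net_index q | in_net kl.1 && in_net kl.2])
    [set t | `|dot (net_point R kl.1) (X t *m net_point R kl.2)| <= c].
  rewrite setTI; apply/seteqP; split => [t /= /forallP H [k l] /= kl|t H].
    by have /forallP/(_ l)/implyP := H k; exact.
  apply/forallP => k; apply/forallP => l; apply/implyP => kl.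
  exact: (H (k, l)).
apply: fin_bigcap_measurable => [|[k l] _]; first exact: finite_finset.
have mB : measurable_fun setT
    (fun t => `|dot (net_point R k) (X t *m net_point R l)| <= c).
  apply: measurable_fun_ler; last exact: measurable_cst.
  apply: measurableT_comp; first exact: normr_measurable.
  by apply: measurable_dot; [exact: measurable_mx_cst|
    apply: measurable_mxM => //; exact: measurable_mx_cst].
by rewrite -[X in measurable X]setTI; exact: mB measurableT [set true] _.
Qed.

End MeasurableMatrices.

(** * Moments of linear forms in the features *)

Section FeatureMoments.
Context (R : realType) (d : measure_display) (Omega : measurableType d).
Variables (P : probability Omega R) (q : nat).
Notation T := (borel_mx R q 1 * measurableTypeR R)%type.
Variables (U0 : {RV P >-> T}) (kap m8 : R).
Hypothesis kap0 : 0 <= kap.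
Hypothesis U0mgf : forall v, mean_le P (fun w => expR (dot (U0 w).1 v))
  (expR (kap * (l2norm v + l2norm v ^+ 2))).
Hypothesis U0y : mean_le P (fun w => (U0 w).2 ^+ 8) m8.

(** The leading 2 counts the two signs in [|x| ^ k <= k! (expR x + expR (- x))]. The exponent
    [2 * kap] is that of [U0mgf] at a unit vector, with one [kap] from the linear and one from the
    quadratic term. *)
Definition dot_const (k : nat) : R := 2 * k`!%:R * expR (2 * kap).

Lemma dot_const_ge0 k : 0 <= dot_const k.
Proof. by rewrite !mulr_ge0 ?expR_ge0. Qed.

Lemma measurable_mx_row : measurable_mx (fun u : T => u.1 : 'cV[R]_q).
Proof.
move=> i j; apply: (measurableT_comp (measurable_entry i j)).
exact: measurable_fst.
Qed.

Lemma measurable_row_dot v : measurable_fun setT (fun w => dot (U0 w).1 v).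
Proof.
apply: (@measurableT_comp _ _ _ _ _ _ (fun u : T => dot u.1 v)).
  by apply: measurable_dot; [exact: measurable_mx_row|exact: measurable_mx_cst].
exact: measurable_funPT.
Qed.

Lemma normX_le_exp (x : R) k : `|x| ^+ k <= k`!%:R * (expR x + expR (- x)).
Proof.
have e0 : 1 <= expR `|x| by rewrite -expR0 ler_expR.
have ex : expR `|x| <= expR x + expR (- x).
  have := expR_ge0 x; have := expR_ge0 (- x).
  by case: (ger0P x) => _; lra.
apply: le_trans (_ : k`!%:R * expR `|x| <= _); last by rewrite ler_wpM2l.
case: k => [|k]; first by rewrite expr0 fact0 mul1r.
rewrite -ler_pdivrMl ?ltr0n ?fact_gt0// mulrC.
by have := expR_ge1Dxn k (normr_ge0 x); lra.
Qed.

(** The exponential bound is not homogeneous in [v]. It is used at unit vectors only, and the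
    moments are then rescaled. *)
Lemma dot_moment k v :
  mean_le P (fun w => `|dot (U0 w).1 v| ^+ k) (dot_const k * l2norm v ^+ k).
Proof.
have unit (u : 'cV[R]_q) : l2norm u = 1 ->
    mean_le P (fun w => `|dot (U0 w).1 u| ^+ k) (dot_const k).
  move=> u1.
  have mexp v' : measurable_fun setT (fun w => expR (dot (U0 w).1 v')).
    by apply: measurableT_comp; [exact: measurable_expR|exact: measurable_row_dot].
  pose sg (c : bool) : 'cV[R]_q := if c then u else - u.
  have := @mean_le_lincomb _ _ _ P _ [:: true; false] xpredT
    (fun w => `|dot (U0 w).1 u| ^+ k) (fun c w => expR (dot (U0 w).1 (sg c)))
    (fun=> k`!%:R) 0 (fun=> expR (2 * kap)).
  have -> : 0 + \sum_(c <- [:: true; false]) k`!%:R * expR (2 * kap) = dot_const k.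
    by rewrite /dot_const !big_cons big_nil; ring.
  apply => //.
  - apply: measurable_funX; apply: measurableT_comp (measurable_row_dot u).
    exact: normr_measurable.
  - move=> c _; have := U0mgf (sg c).
    have -> : l2norm (sg c) = 1 by rewrite /sg; case: c; rewrite ?l2normN.
    by have -> : kap * (1 + 1 ^+ 2) = 2 * kap by ring.
  - move=> w; apply: le_trans (normX_le_exp _ k) _; apply: eq_lexx.
    by rewrite !big_cons big_nil /sg dotNr; ring.
have [v0|vn0] := eqVneq (l2norm v) 0.
  have -> : v = 0 by exact: l2norm0_eq0.
  have -> : (fun w => `|dot (U0 w).1 0| ^+ k) = (fun=> 0 ^+ k).
    by apply/funext => w; rewrite /dot mulmx0 mxE normr0.
  rewrite l2norm0; apply: mean_le_cst; first exact: measurable_cst.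
    by move=> _; rewrite exprn_ge0.
  move=> _; have [k0|k0] := posnP k; last first.
    by rewrite !expr0n (gtn_eqF k0) mulr0.
  rewrite k0 !expr0 mulr1 /dot_const fact0 mulr1.
  have : 1 <= expR (2 * kap) by rewrite -expR0 ler_expR mulr_ge0.
  by lra.
have v0 : 0 < l2norm v by rewrite lt_neqAle eq_sym vn0 l2norm_ge0.
pose u := (l2norm v)^-1 *: v.
have u1 : l2norm u = 1 by rewrite l2normZ ger0_norm ?invr_ge0 ?l2norm_ge0// mulVf.
rewrite mulrC; apply: (@mean_leZ _ _ _ _ _ (fun w => `|dot (U0 w).1 u| ^+ k)).
- apply: measurable_funX; apply: measurableT_comp (measurable_row_dot v).
  exact: normr_measurable.
- apply: measurable_funX; apply: measurableT_comp (measurable_row_dot u).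
  exact: normr_measurable.
- by move=> w; rewrite exprn_ge0.
- by rewrite exprn_ge0// ltW.
- by move=> w; rewrite exprn_ge0.
- exact: unit.
- move=> w; rewrite /u dotZr normrM exprMn ger0_norm ?invr_ge0 ?l2norm_ge0//.
  by rewrite mulrA -exprMn divff// expr1n mul1r.
Qed.

End FeatureMoments.

Ltac mean_side := try solve [by mfun | by move=> w; rewrite exprn_even_ge0].

(** * Elementary power inequalities and centering *)

Section PowerSums.
Context (R : realType).
Implicit Types a b c : R.

Lemma pow8D_le a b : (a + b) ^+ 8 <= 128 * a ^+ 8 + 128 * b ^+ 8.
Proof.
have := @weighted_pow8 R bool [:: true; false] xpredT (fun=> 1)
  (fun i : bool => if i then a else b) (fun _ _ => ler01).
rewrite !big_cons !big_nil !mul1r !addr0 => /le_trans; apply.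
by apply: eq_lexx; ring.
Qed.

Lemma pow4D_le a b : (a + b) ^+ 4 <= 8 * a ^+ 4 + 8 * b ^+ 4.
Proof.
have := @weighted_pow4 R bool [:: true; false] xpredT (fun=> 1)
  (fun i : bool => if i then a else b) (fun _ _ => ler01).
rewrite !big_cons !big_nil !mul1r !addr0 => /le_trans; apply.
by apply: eq_lexx; ring.
Qed.

Lemma norm_even_pow a k : ~~ odd k -> `|a| ^+ k = a ^+ k.
Proof. by move=> ek; rewrite -normrX ger0_norm// exprn_even_ge0. Qed.

Lemma pow4_le_pow8 a b : (a * b) ^+ 4 <= 2^-1 * a ^+ 8 + 2^-1 * b ^+ 8.
Proof.
rewrite exprMn (exprM a 4 2) (exprM b 4 2).
move: (a ^+ 4) (b ^+ 4) => x y; have := sqr_ge0 (x - y); rewrite sqrrB.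
by rewrite -mulr_natl; lra.
Qed.

Lemma norm_le_pow4 a : `|a| <= 1 + 1 * a ^+ 4.
Proof.
rewrite -(norm_even_pow a (k := 4))// mul1r.
move: `|a| (normr_ge0 a) => r r0.
by have := sqr_ge0 (r ^+ 2 - 2^-1); have := sqr_ge0 (r - 2^-1); lra.
Qed.

Lemma norm_mul_le_pow8 a b : `|a * b| <= 1 + (1 * a ^+ 8 + 1 * b ^+ 8).
Proof.
apply: le_trans (norm_le_pow4 _) _; rewrite lerD2l !mul1r.
apply: le_trans (pow4_le_pow8 a b) _.
have := @exprn_even_ge0 R 8 a isT; have := @exprn_even_ge0 R 8 b isT.
move: (a ^+ 8) (b ^+ 8) => x y; lra.
Qed.

Context (d : measure_display) (Omega : measurableType d).
Variable P : probability Omega R.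

Lemma mean_le_lin2 (F G1 G2 : Omega -> R) (c0 c1 c2 M1 M2 : R) :
  measurable_fun setT F -> measurable_fun setT G1 -> measurable_fun setT G2 ->
  0 <= c0 -> 0 <= c1 -> 0 <= c2 ->
  (forall w, 0 <= F w) -> (forall w, 0 <= G1 w) -> (forall w, 0 <= G2 w) ->
  mean_le P G1 M1 -> mean_le P G2 M2 ->
  (forall w, F w <= c0 + (c1 * G1 w + c2 * G2 w)) ->
  mean_le P F (c0 + (c1 * M1 + c2 * M2)).
Proof.
move=> mF m1 m2 c00 c10 c20 F0 G10 G20 GM1 GM2 FG.
have := @mean_le_lincomb _ _ _ P _ [:: true; false] xpredT F
  (fun i : bool => if i then G1 else G2) (fun i : bool => if i then c1 else c2) c0
  (fun i : bool => if i then M1 else M2).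
rewrite !big_cons big_nil addr0; apply => //; try by case.
by move=> w; rewrite !big_cons big_nil addr0.
Qed.

(** From [(F - c) ^ 4 <= 8 F ^ 4 + 8 c ^ 4], where the mean [c] satisfies [|c| <= 1 + M]. *)
Definition centered_bound (M : R) : R := 8 * (1 + M) ^+ 4 + 8 * M.

Lemma centered_bound_ge0 M : 0 <= M -> 0 <= centered_bound M.
Proof.
by move=> M0; apply: addr_ge0; apply: mulr_ge0 => //; apply: exprn_ge0; exact: addr_ge0.
Qed.

Lemma fine_mean_le (F : Omega -> R) M : measurable_fun setT F ->
  P.-integrable setT (EFin \o F) -> mean_le P (fun w => `|F w|) M ->
  `|fine (mean P F)| <= M.
Proof.
move=> mF iF FM; rewrite -lee_fin; apply: le_trans FM.
have fF : mean P F \is a fin_num by exact: integrable_fin_num.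
rewrite -fine_abse// fineK ?abse_fin_num//.
by apply: le_trans (le_abse_integral P measurableT _) _; first exact/measurable_EFinP.
Qed.

Section Centered.
Variables (F : Omega -> R) (M : R).
Hypothesis mF : measurable_fun setT F.
Hypothesis FM : mean_le P (fun w => F w ^+ 4) M.

Let iF : P.-integrable setT (EFin \o F).
Proof. exact: integrable_le_pow4 mF FM. Qed.

Lemma mean_fineE : mean P F = (fine (mean P F))%:E.
Proof. by rewrite fineK//; exact: integrable_fin_num. Qed.

Lemma fine_mean_pow4_le : `|fine (mean P F)| <= 1 + M.
Proof.
apply: fine_mean_le => //.
have := @mean_le_lin2 (fun w => `|F w|) (fun w => F w ^+ 4) (fun=> 0) 1 1 0 M 0.
rewrite !mul0r addr0 mul1r; apply => //; mean_side.
- by rewrite /mean_le mean_cst.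
- by move=> w; rewrite addr0; exact: norm_le_pow4.
Qed.

Lemma mean_centered_pow4 :
  mean_le P (fun w => (F w - fine (mean P F)) ^+ 4) (centered_bound M).
Proof.
have := @mean_le_lin2 (fun w => (F w - fine (mean P F)) ^+ 4)
  (fun w => F w ^+ 4) (fun=> 0) (8 * (1 + M) ^+ 4) 8 0 M 0.
rewrite !mul0r addr0; apply => //; mean_side.
- by rewrite mulr_ge0// exprn_even_ge0.
- by rewrite /mean_le mean_cst.
- move=> w; rewrite addr0; apply: le_trans (pow4D_le _ _) _.
  rewrite addrC lerD2r (exprNn _ 4) -signr_odd expr0 mul1r ler_wpM2l//.
  rewrite -(norm_even_pow (fine (mean P F)) (k := 4))// lerXn2r ?nnegrE//.
    by rewrite (le_trans (normr_ge0 _) fine_mean_pow4_le).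
  exact: fine_mean_pow4_le.
Qed.

Lemma mean_centered0 : mean P (fun w => F w - fine (mean P F)) = 0.
Proof.
set c := fine _.
have ic : P.-integrable setT (EFin \o (fun=> c)).
  by apply: (@bounded_integrable _ _ _ _ _ `|c|) => //; mfun.
transitivity (mean P F - mean P (fun=> c))%E.
  exact: (integralB_EFin measurableT iF ic).
by rewrite mean_fineE mean_cst -EFinD subrr.
Qed.

End Centered.

End PowerSums.

(** The bound [<= 1] instead of an equality admits [v = 0] without a case distinction for the
    user. *)
Lemma l2norm_normalize (R : realType) q (v : 'cV[R]_q) :
  exists2 u, v = l2norm v *: u & l2norm u <= 1.
Proof.
have [v0|vn0] := eqVneq (l2norm v) 0.
  by exists 0; rewrite ?l2norm0// scaler0 (l2norm0_eq0 v0).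
exists ((l2norm v)^-1 *: v).
  by rewrite scalerA divff// scale1r.
by rewrite l2normZ ger0_norm ?invr_ge0 ?l2norm_ge0// mulVf.
Qed.

(** * The squared loss of a single sample and its increments *)

Section RowLoss.
Context (R : realType) (d : measure_display) (Omega : measurableType d).
Variables (P : probability Omega R) (q : nat).
Notation T := (borel_mx R q 1 * measurableTypeR R)%type.
Variables (U0 : {RV P >-> T}) (kap m8 : R).
Hypothesis kap0 : 0 <= kap.
Hypothesis U0mgf : forall v, mean_le P (fun w => expR (dot (U0 w).1 v))
  (expR (kap * (l2norm v + l2norm v ^+ 2))).
Hypothesis U0y : mean_le P (fun w => (U0 w).2 ^+ 8) m8.

Let mdot v : measurable_fun setT (fun w => dot (U0 w).1 v).
Proof. exact: measurable_row_dot. Qed.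

Let my : measurable_fun setT (fun w => (U0 w).2 : R).
Proof. exact: (measurableT_comp measurable_snd (measurable_funPT U0)). Qed.

Let K8 : R := dot_const kap 8.

Let K80 : 0 <= K8. Proof. exact: dot_const_ge0. Qed.

Lemma dot8 v :
  mean_le P (fun w => dot (U0 w).1 v ^+ 8) (dot_const kap 8 * l2norm v ^+ 8).
Proof.
rewrite (_ : (fun w => _) = fun w => `|dot (U0 w).1 v| ^+ 8).
  exact: (dot_moment kap0 U0mgf 8 v).
by apply/funext => w; rewrite norm_even_pow.
Qed.

Lemma m8_ge0 : 0 <= m8.
Proof.
rewrite -lee_fin; apply: le_trans U0y; apply: mean_ge0 => w.
by rewrite exprn_even_ge0.
Qed.

(* Up to the factor [delta], the increment of the squared loss along a gradient
   step [b -> b + delta g], where [s = b + (b + delta g)]. *)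
Definition loss_incr (u : T) (g s : 'cV[R]_q) : R :=
  dot u.1 g * (dot u.1 s - 2 * u.2).

Lemma sq_loss_incr (u : T) (b g : 'cV[R]_q) a :
  sq_loss u.1 u.2 (b + a *: g) =
  sq_loss u.1 u.2 b + a * loss_incr u g (b + (b + a *: g)).
Proof.
rewrite /sq_loss -!/(dot _ _) /loss_incr !dotDr dotZr.
by move: (dot _ _) (dot _ _) => u1 u2; ring.
Qed.

Definition resid8_bound (B : R) : R := 128 * m8 + 128 * (K8 * B ^+ 8).

Lemma resid8 b B : l2norm b <= B ->
  mean_le P (fun w => ((U0 w).2 - dot (U0 w).1 b) ^+ 8) (resid8_bound B).
Proof.
move=> bB; have B0 := le_trans (l2norm_ge0 b) bB.
have := @mean_le_lin2 _ _ _ P (fun w => ((U0 w).2 - dot (U0 w).1 b) ^+ 8)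
  (fun w => (U0 w).2 ^+ 8) (fun w => dot (U0 w).1 b ^+ 8) 0 128 128 m8
  (K8 * B ^+ 8).
rewrite add0r; apply => //; mean_side.
- apply: le_trans (dot8 b) _; rewrite lee_fin ler_wpM2l//.
  by rewrite lerXn2r ?nnegrE ?l2norm_ge0.
- move=> w; rewrite add0r; apply: le_trans (pow8D_le _ _) _.
  by rewrite (exprNn _ 8) -signr_odd expr0 mul1r.
Qed.

Lemma dot_sub8 s S : l2norm s <= S ->
  mean_le P (fun w => (dot (U0 w).1 s - 2 * (U0 w).2) ^+ 8)
    (128 * (K8 * S ^+ 8) + 128 * 256 * m8).
Proof.
move=> sS; have S0 := le_trans (l2norm_ge0 s) sS.
have := @mean_le_lin2 _ _ _ P (fun w => (dot (U0 w).1 s - 2 * (U0 w).2) ^+ 8)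
  (fun w => dot (U0 w).1 s ^+ 8) (fun w => (U0 w).2 ^+ 8) 0 128 (128 * 256)
  (K8 * S ^+ 8) m8.
rewrite add0r; apply => //; mean_side.
- apply: le_trans (dot8 s) _; rewrite lee_fin ler_wpM2l//.
  by rewrite lerXn2r ?nnegrE ?l2norm_ge0.
- move=> w; rewrite add0r; apply: le_trans (pow8D_le _ _) _.
  by rewrite lerD2l; apply: eq_lexx; ring.
Qed.

Definition incr4_bound (G S : R) : R :=
  2^-1 * (K8 * G ^+ 8) + 2^-1 * (128 * (K8 * S ^+ 8) + 128 * 256 * m8).

Lemma measurable_loss_incr g s : measurable_fun setT (fun w => loss_incr (U0 w) g s).
Proof. by rewrite /loss_incr; mfun. Qed.

Lemma incr4 g s G S : l2norm g <= G -> l2norm s <= S ->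
  mean_le P (fun w => loss_incr (U0 w) g s ^+ 4) (incr4_bound G S).
Proof.
move=> gG sS.
have := @mean_le_lin2 _ _ _ P (fun w => loss_incr (U0 w) g s ^+ 4)
  (fun w => dot (U0 w).1 g ^+ 8) (fun w => (dot (U0 w).1 s - 2 * (U0 w).2) ^+ 8)
  0 2^-1 2^-1 (K8 * G ^+ 8) (128 * (K8 * S ^+ 8) + 128 * 256 * m8).
rewrite add0r; apply => //.
- by apply: measurable_funX; exact: measurable_loss_incr.
- by mfun.
- by mfun.
- by move=> w; rewrite exprn_even_ge0.
- by move=> w; rewrite exprn_even_ge0.
- by move=> w; rewrite exprn_even_ge0.
- apply: le_trans (dot8 g) _; rewrite lee_fin ler_wpM2l//.
  by rewrite lerXn2r ?nnegrE ?l2norm_ge0// (le_trans (l2norm_ge0 g)).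
- exact: dot_sub8.
- by move=> w; rewrite add0r; exact: pow4_le_pow8.
Qed.

Lemma incr4_bound_ge0 G S : 0 <= G -> 0 <= S -> 0 <= incr4_bound G S.
Proof.
move=> G0 S0; have := m8_ge0 => m80.
have h1 : 0 <= K8 * G ^+ 8 by rewrite mulr_ge0// exprn_ge0.
have h2 : 0 <= K8 * S ^+ 8 by rewrite mulr_ge0// exprn_ge0.
by rewrite /incr4_bound; lra.
Qed.

Lemma integrable_incr g s : P.-integrable setT (fun w => (loss_incr (U0 w) g s)%:E).
Proof.
apply: (integrable_le_pow4 (measurable_loss_incr g s) (M := incr4_bound (l2norm g) (l2norm s))).
exact: incr4.
Qed.

Definition mean_incr g s : R := fine (mean P (fun w => loss_incr (U0 w) g s)).

Lemma mean_incrE g s : mean P (fun w => loss_incr (U0 w) g s) = (mean_incr g s)%:E.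
Proof. exact: mean_fineE (measurable_loss_incr g s) (incr4 (lexx _) (lexx _)). Qed.

Definition centered4_bound (G S : R) : R := centered_bound (incr4_bound G S).

Lemma centered4 g s G S : l2norm g <= G -> l2norm s <= S ->
  mean_le P (fun w => (loss_incr (U0 w) g s - mean_incr g s) ^+ 4)
    (centered4_bound G S).
Proof.
by move=> gG sS; apply: mean_centered_pow4 (measurable_loss_incr g s) (incr4 gG sS).
Qed.

Lemma mean_centered g s :
  mean P (fun w => loss_incr (U0 w) g s - mean_incr g s) = 0.
Proof.
exact: mean_centered0 (measurable_loss_incr g s) (incr4 (lexx _) (lexx _)).
Qed.

(** The first summand is for a change of [g], the second for a change of [s]; both come from
    [|a b| <= 1 + a ^ 8 + b ^ 8]. *)
Definition lip_const (G S : R) : R :=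
  (1 + (K8 + (128 * (K8 * S ^+ 8) + 128 * 256 * m8))) + (1 + (K8 * G ^+ 8 + K8)).

(** The differences of the vectors are normalized first. Crude moment bounds at vectors of norm at
    most 1 then become bounds linear in the distances. *)
Lemma mean_incr_lip g s g' s' G S : l2norm g <= G -> l2norm s <= S ->
  l2norm g' <= G -> l2norm s' <= S ->
  `|mean_incr g s - mean_incr g' s'| <=
  lip_const G S * (l2norm (g - g') + l2norm (s - s')).
Proof.
move=> gG sS gG' sS'; have G0 := le_trans (l2norm_ge0 _) gG.
have S0 := le_trans (l2norm_ge0 _) sS.
have [ug ugE ug1] := l2norm_normalize (g - g').
have [us usE us1] := l2norm_normalize (s - s').
set eg := l2norm (g - g') in ugE *; set es := l2norm (s - s') in usE *.
have eg0 : 0 <= eg by exact: l2norm_ge0.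
have es0 : 0 <= es by exact: l2norm_ge0.
have mp a b : measurable_fun setT (fun w => `|dot (U0 w).1 a * (dot (U0 w).1 b - 2 * (U0 w).2)|).
  by apply: measurableT_comp; [exact: normr_measurable|mfun].
have mp' a b : measurable_fun setT (fun w => `|dot (U0 w).1 a * dot (U0 w).1 b|).
  by apply: measurableT_comp; [exact: normr_measurable|mfun].
have m1 : mean_le P (fun w => `|dot (U0 w).1 ug * (dot (U0 w).1 s - 2 * (U0 w).2)|)
   (1 + (K8 + (128 * (K8 * S ^+ 8) + 128 * 256 * m8))).
  have := @mean_le_lin2 _ _ _ P
    (fun w => `|dot (U0 w).1 ug * (dot (U0 w).1 s - 2 * (U0 w).2)|)
    (fun w => dot (U0 w).1 ug ^+ 8) (fun w => (dot (U0 w).1 s - 2 * (U0 w).2) ^+ 8)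
    1 1 1 K8 (128 * (K8 * S ^+ 8) + 128 * 256 * m8).
  rewrite !mul1r; apply => //; mean_side.
  - apply: le_trans (dot8 _) _; rewrite lee_fin ler_piMr//.
    by rewrite exprn_ile1// l2norm_ge0.
  - exact: dot_sub8.
  - by move=> w; exact: norm_mul_le_pow8.
have m2 : mean_le P (fun w => `|dot (U0 w).1 g' * dot (U0 w).1 us|)
   (1 + (K8 * G ^+ 8 + K8)).
  have := @mean_le_lin2 _ _ _ P (fun w => `|dot (U0 w).1 g' * dot (U0 w).1 us|)
    (fun w => dot (U0 w).1 g' ^+ 8) (fun w => dot (U0 w).1 us ^+ 8)
    1 1 1 (K8 * G ^+ 8) K8.
  rewrite !mul1r; apply => //; mean_side.
  - apply: le_trans (dot8 _) _; rewrite lee_fin ler_wpM2l//.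
    by rewrite lerXn2r ?nnegrE ?l2norm_ge0.
  - apply: le_trans (dot8 _) _; rewrite lee_fin ler_piMr//.
    by rewrite exprn_ile1// l2norm_ge0.
  - by move=> w; exact: norm_mul_le_pow8.
set M1 := 1 + (K8 + _) in m1; set M2 := 1 + (_ + K8) in m2.
have M10 : 0 <= M1.
  by rewrite -lee_fin; apply: le_trans m1; exact: mean_ge0.
have M20 : 0 <= M2.
  by rewrite -lee_fin; apply: le_trans m2; exact: mean_ge0.
have iD : P.-integrable setT
    (EFin \o (fun w => loss_incr (U0 w) g s - loss_incr (U0 w) g' s')).
  exact: (integrableB measurableT (integrable_incr g s) (integrable_incr g' s')).
have mD : measurable_fun setT (fun w => loss_incr (U0 w) g s - loss_incr (U0 w) g' s').
  by apply: measurable_funB; exact: measurable_loss_incr.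
have -> : mean_incr g s - mean_incr g' s' =
    fine (mean P (fun w => loss_incr (U0 w) g s - loss_incr (U0 w) g' s')).
  rewrite (_ : mean P _ = (mean_incr g s - mean_incr g' s')%:E)//.
  rewrite EFinB -!mean_incrE.
  exact: (integralB_EFin measurableT (integrable_incr g s) (integrable_incr g' s')).
have lipE : eg * M1 + es * M2 <= lip_const G S * (eg + es).
  rewrite /lip_const -/M1 -/M2; have := mulr_ge0 eg0 M20; have := mulr_ge0 es0 M10.
  lra.
apply: le_trans lipE; apply: fine_mean_le => //.
have := @mean_le_lin2 _ _ _ P
  (fun w => `|loss_incr (U0 w) g s - loss_incr (U0 w) g' s'|)
  (fun w => `|dot (U0 w).1 ug * (dot (U0 w).1 s - 2 * (U0 w).2)|)
  (fun w => `|dot (U0 w).1 g' * dot (U0 w).1 us|) 0 eg es M1 M2.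
rewrite add0r; apply => //.
  by apply: measurableT_comp mD; exact: normr_measurable.
move=> w; rewrite add0r.
(* One argument changes at a time; in the change of [s] the response cancels. *)
have -> : loss_incr (U0 w) g s - loss_incr (U0 w) g' s' =
  eg * (dot (U0 w).1 ug * (dot (U0 w).1 s - 2 * (U0 w).2)) +
  es * (dot (U0 w).1 g' * dot (U0 w).1 us).
  have e1 : eg * dot (U0 w).1 ug = dot (U0 w).1 g - dot (U0 w).1 g'.
    by rewrite -dotZr -ugE dotBr.
  have e2 : es * dot (U0 w).1 us = dot (U0 w).1 s - dot (U0 w).1 s'.
    by rewrite -dotZr -usE dotBr.
  by rewrite mulrA e1 mulrCA e2 /loss_incr; ring.
by apply: le_trans (ler_normD _ _) _; rewrite !(normrM eg) !(normrM es) !(ger0_norm eg0) !(ger0_norm es0).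
Qed.

(** Both vectors are normalized before the arithmetic-geometric inequality. Applied directly, it
    would bound the product by a sum of powers of the norms and lose the smallness of a single
    factor. *)
Lemma dot_prod8 a b :
  mean_le P (fun w => (dot (U0 w).1 a * dot (U0 w).1 b) ^+ 8)
    (dot_const kap 16 * (l2norm a * l2norm b) ^+ 8).
Proof.
have dot16 v : mean_le P (fun w => dot (U0 w).1 v ^+ 16)
    (dot_const kap 16 * l2norm v ^+ 16).
  rewrite (_ : (fun w => _) = fun w => `|dot (U0 w).1 v| ^+ 16).
    exact: (dot_moment kap0 U0mgf 16 v).
  by apply/funext => w; rewrite norm_even_pow.
have [ua aE ua1] := l2norm_normalize a.
have [ub bE ub1] := l2norm_normalize b.
have K0 : 0 <= dot_const kap 16 by exact: dot_const_ge0.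
have u16 v : l2norm v <= 1 -> mean_le P (fun w => dot (U0 w).1 v ^+ 16) (dot_const kap 16).
  move=> v1; apply: le_trans (dot16 v) _; rewrite lee_fin ler_piMr//.
  by rewrite exprn_ile1// l2norm_ge0.
have uab : mean_le P (fun w => (dot (U0 w).1 ua * dot (U0 w).1 ub) ^+ 8)
    (dot_const kap 16).
  have := @mean_le_lin2 _ _ _ P (fun w => (dot (U0 w).1 ua * dot (U0 w).1 ub) ^+ 8)
    (fun w => dot (U0 w).1 ua ^+ 16) (fun w => dot (U0 w).1 ub ^+ 16) 0 2^-1 2^-1
    (dot_const kap 16) (dot_const kap 16).
  have -> : 0 + (2^-1 * dot_const kap 16 + 2^-1 * dot_const kap 16) = dot_const kap 16.
    by field.
  apply => //; mean_side.
  - exact: u16.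
  - exact: u16.
  - move=> w; rewrite add0r exprMn (exprM _ 8 2) (exprM (dot _ ub) 8 2).
    move: (_ ^+ 8) (_ ^+ 8) => x y; have := sqr_ge0 (x - y); rewrite sqrrB.
    by rewrite -mulr_natl; lra.
rewrite mulrC; apply: mean_leZ uab _.
- by mfun.
- by mfun.
- by move=> w; rewrite exprn_even_ge0.
- by rewrite exprn_even_ge0.
- by move=> w; rewrite exprn_even_ge0.
- move=> w; rewrite {1}aE {1}bE !dotZr; apply: eq_lexx.
  by move: (dot _ _) (dot _ _) => u1 u2; ring.
Qed.

Definition pop_risk b : R := fine (mean P (fun w => sq_loss (U0 w).1 (U0 w).2 b)).

Lemma sq_lossE (u : T) b : sq_loss u.1 u.2 b = (u.2 - dot u.1 b) ^+ 2.
Proof. by []. Qed.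

Lemma measurable_sq_loss b :
  measurable_fun setT (fun w => sq_loss (U0 w).1 (U0 w).2 b).
Proof. by apply: measurable_funX; apply: measurable_funB => //; exact: mdot. Qed.

Lemma sq_loss_pow4 b B : l2norm b <= B ->
  mean_le P (fun w => sq_loss (U0 w).1 (U0 w).2 b ^+ 4) (resid8_bound B).
Proof.
by move=> bB; under eq_fun do rewrite sq_lossE -exprM; exact: resid8.
Qed.

Lemma integrable_sq_loss b :
  P.-integrable setT (fun w => (sq_loss (U0 w).1 (U0 w).2 b)%:E).
Proof.
apply: (integrable_le_pow4 (measurable_sq_loss b) (M := resid8_bound (l2norm b))).
exact: sq_loss_pow4.
Qed.

Lemma pop_riskE b :
  mean P (fun w => sq_loss (U0 w).1 (U0 w).2 b) = (pop_risk b)%:E.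
Proof. exact: mean_fineE (measurable_sq_loss b) (sq_loss_pow4 (lexx _)). Qed.

Lemma pop_risk_le b B : l2norm b <= B -> `|pop_risk b| <= 1 + resid8_bound B.
Proof.
by move=> bB; apply: fine_mean_pow4_le (measurable_sq_loss b) (sq_loss_pow4 bB).
Qed.

Definition centered_loss4_bound (B : R) : R := centered_bound (resid8_bound B).

Lemma centered_loss4 b B : l2norm b <= B ->
  mean_le P (fun w => (sq_loss (U0 w).1 (U0 w).2 b - pop_risk b) ^+ 4)
    (centered_loss4_bound B).
Proof.
by move=> bB; apply: mean_centered_pow4 (measurable_sq_loss b) (sq_loss_pow4 bB).
Qed.

Lemma mean_centered_loss b :
  mean P (fun w => sq_loss (U0 w).1 (U0 w).2 b - pop_risk b) = 0.
Proof. exact: mean_centered0 (measurable_sq_loss b) (sq_loss_pow4 (lexx _)). Qed.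

Lemma pop_risk_incr b g a :
  pop_risk (b + a *: g) = pop_risk b + a * mean_incr g (b + (b + a *: g)).
Proof.
apply: EFin_inj; rewrite -pop_riskE EFinD EFinM -pop_riskE -mean_incrE.
under eq_fun do rewrite sq_loss_incr.
set s := b + _.
pose Z := mean P (fun w => a * loss_incr (U0 w) g s).
transitivity (mean P (fun w => sq_loss (U0 w).1 (U0 w).2 b) + Z)%E.
  apply: (integralD_EFin measurableT (integrable_sq_loss b)).
  exact: (integrableZl measurableT a (integrable_incr g s)).
congr (_ + _)%E; exact: (integralZl measurableT (integrable_incr g s) a).
Qed.

End RowLoss.

(** * Iterates as functions of the sample *)

Section SampleIterates.
Context (R : realType) (n q : nat).
Notation T := (borel_mx R q 1 * measurableTypeR R)%type.
Variables (delta : nat -> R) (b0 : 'cV[R]_q) (t0 L Y : R).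
Implicit Types (S : pred 'I_n) (t : n.-tuple T).

Definition features t : 'M[R]_(n, q) := design_mx (fun i => (tnth t i).1 : 'cV[R]_q).
Definition responses t : 'cV[R]_n := response_vec (fun i => (tnth t i).2 : R).

(** Here [S] is the set of retained samples, whereas in [stab] the set is the removed one. *)
Definition masked_gd S t k : 'cV[R]_q :=
  gd n (mask_rows S (features t)) (mask_rows S (responses t)) delta b0 k.

Definition masked_grad S t k : 'cV[R]_q :=
  grad (mask_rows S (features t)) (mask_rows S (responses t)) (masked_gd S t k).

Definition twice_mid S t k : 'cV[R]_q := masked_gd S t k + masked_gd S t k.+1.

(* A bound over a finite net is measurable for free, unlike one on the operator
   norm. *)
Definition good_sample S t : bool :=
  net_bounded (mask_rows S (features t)) (t0 * Num.sqrt n%:R) &&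
  (l2norm (mask_rows S (responses t)) <= Y * Num.sqrt n%:R).

Lemma masked_gdS S t k : masked_gd S t k.+1 = masked_gd S t k + delta k *: masked_grad S t k.
Proof. by rewrite /masked_gd gdS. Qed.

Lemma mask_features_upd S i u t : ~~ S i ->
  mask_rows S (features (upd i u t)) = mask_rows S (features t).
Proof.
move=> Si; apply/matrixP => j k; rewrite !mxE tnth_upd.
by case: (eqVneq j i) => [->|//]; rewrite (negbTE Si).
Qed.

Lemma mask_responses_upd S i u t : ~~ S i ->
  mask_rows S (responses (upd i u t)) = mask_rows S (responses t).
Proof.
move=> Si; apply/matrixP => j k; rewrite !mxE tnth_upd.
by case: (eqVneq j i) => [->|//]; rewrite (negbTE Si).
Qed.

Lemma masked_gd_upd S i u t k : ~~ S i -> masked_gd S (upd i u t) k = masked_gd S t k.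
Proof. by move=> Si; rewrite /masked_gd mask_features_upd// mask_responses_upd. Qed.

Lemma masked_grad_upd S i u t k : ~~ S i -> masked_grad S (upd i u t) k = masked_grad S t k.
Proof.
by move=> Si; rewrite /masked_grad masked_gd_upd// mask_features_upd// mask_responses_upd.
Qed.

Lemma twice_mid_upd S i u t k : ~~ S i ->
  twice_mid S (upd i u t) k = twice_mid S t k.
Proof. by move=> Si; rewrite /twice_mid !masked_gd_upd. Qed.

Lemma good_sample_upd S i u t : ~~ S i -> good_sample S (upd i u t) = good_sample S t.
Proof. by move=> Si; rewrite /good_sample mask_features_upd// mask_responses_upd. Qed.

(** Goodness passes to fewer retained rows, so that one event of the full sample implies all the
    truncating events. *)
Lemma good_sample_sub S S' t : predI S S' =1 S -> good_sample S' t -> good_sample S t.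
Proof.
move=> SS /andP[H1 H2]; rewrite /good_sample.
rewrite -!(eq_mask_rows _ SS) -!mask_mask; apply/andP; split.
  exact: net_bounded_mask.
exact: le_trans (l2norm_mask _ _) H2.
Qed.

Lemma measurable_features : measurable_mx features.
Proof.
move=> i j; under eq_fun do rewrite mxE.
apply: (measurableT_comp (measurable_entry j 0)).
by apply: measurableT_comp; [exact: measurable_fst|exact: measurable_tnth].
Qed.

Lemma measurable_responses : measurable_mx responses.
Proof.
move=> i j; under eq_fun do rewrite mxE.
by apply: measurableT_comp; [exact: measurable_snd|exact: measurable_tnth].
Qed.

Lemma measurable_masked_gd S k : measurable_mx (fun t => masked_gd S t k).
Proof.
by apply: measurable_mx_gd; apply: measurable_mx_mask;
  [exact: measurable_features|exact: measurable_responses].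
Qed.

Lemma measurable_masked_grad S k : measurable_mx (fun t => masked_grad S t k).
Proof.
apply: measurable_mx_grad; last exact: measurable_masked_gd.
  by apply: measurable_mx_mask; exact: measurable_features.
by apply: measurable_mx_mask; exact: measurable_responses.
Qed.

Lemma measurable_twice_mid S k : measurable_mx (fun t => twice_mid S t k).
Proof. by apply: measurable_mxD; exact: measurable_masked_gd. Qed.

Lemma measurable_good_sample S : measurable_fun setT (good_sample S).
Proof.
apply: measurable_and.
  apply: measurable_net_bounded; apply: measurable_mx_mask.
  exact: measurable_features.
apply: measurable_fun_ler; last exact: measurable_cst.
apply: measurable_l2norm; apply: measurable_mx_mask; exact: measurable_responses.
Qed.

Variables (D B0 : R).
Hypotheses (n0 : (0 < n)%N) (q0 : (0 < q)%N).
Hypothesis t00 : 0 <= t0.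
Hypothesis LE : L = 2 * t0.
Hypothesis Y0 : 0 <= Y.
Hypothesis delta0 : forall l, 0 <= delta l.
Hypothesis deltaD : forall k, \sum_(l < k) delta l <= D.
Hypothesis b0B0 : l2norm b0 <= B0.

Let Bb := gd_bound L Y D B0.
Let Gam := grad_bound L Y D B0.

Lemma L_ge0 : 0 <= L. Proof. by rewrite LE mulr_ge0. Qed.

Lemma good_opbound S t : good_sample S t ->
  opbound (mask_rows S (features t)) (L * Num.sqrt n%:R).
Proof.
move=> /andP[H _]; rewrite LE -mulrA; apply: net_bounded_opbound => //.
by rewrite mulr_ge0// sqrtr_ge0.
Qed.

Lemma masked_gd_le S t k : good_sample S t -> l2norm (masked_gd S t k) <= Bb.
Proof.
move=> G; apply: gd_le => //; first exact: L_ge0.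
- exact: good_opbound.
- by case/andP: G.
Qed.

Lemma masked_grad_le S t k : good_sample S t -> l2norm (masked_grad S t k) <= Gam.
Proof.
move=> G; apply: grad_le => //; first exact: L_ge0.
- exact: good_opbound.
- by case/andP: G.
Qed.

Lemma twice_mid_le S t k : good_sample S t -> l2norm (twice_mid S t k) <= 2 * Bb.
Proof.
move=> G; apply: le_trans (l2normD _ _) _.
by have := masked_gd_le k G; have := masked_gd_le k.+1 G; lra.
Qed.

Variable m : nat.

(* The iterates run without the whole block of [i] replace, simultaneously for all
   [j] in that block, those run without [j]. *)
Definition outside i : pred 'I_n := predC (same_block m i).

Lemma outside_self i : ~~ outside i i.
Proof. by rewrite /outside /= /same_block eqxx. Qed.

Definition block_resid i t k : R := (Num.sqrt n%:R)^-1 *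
  l2norm (mask_rows (same_block m i) (responses t - features t *m masked_gd (outside i) t k)).

(** The first term is the missing contribution to the current gradient, the sum the accumulated
    distance of the iterates. It includes step [l] because [twice_mid] involves iterate [l + 1]. *)
Definition block_dist i t l : R :=
  block_resid i t l + \sum_(j < l.+1) delta j * block_resid i t j.

(** With the Gronwall factor [E = expR (L ^ 2 * D) * L]: the two iterates in [twice_mid] give [2 E],
    the propagated distance in the gradient [L ^ 2 E], the missing residuals [L]. *)
Definition dist_const : R := L + (L ^+ 2 + 2) * (expR (L ^+ 2 * D) * L).

Lemma block_resid_ge0 i t k : 0 <= block_resid i t k.
Proof. by rewrite mulr_ge0 ?l2norm_ge0// invr_ge0 sqrtr_ge0. Qed.

Lemma dist_const_ge0 : 0 <= dist_const.
Proof.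
have L0 := L_ge0.
by rewrite addr_ge0// mulr_ge0 ?addr_ge0 ?sqr_ge0// mulr_ge0 ?expR_ge0.
Qed.

(** * Distance to the iterates run without a block *)

Section Comparison.
Variables (S : pred 'I_n) (i : 'I_n) (t : n.-tuple T).
Hypothesis SO : predI (outside i) S =1 outside i.
Hypothesis gS : good_sample S t.

Lemma good_outside : good_sample (outside i) t.
Proof. exact: good_sample_sub gS. Qed.

Let X' := mask_rows S (features t).
Let y' := mask_rows S (responses t).

Let iterE k : gd n (mask_rows (predC (same_block m i)) X')
  (mask_rows (predC (same_block m i)) y') delta b0 k = masked_gd (outside i) t k.
Proof. by rewrite /X' /y' !mask_mask !(eq_mask_rows _ SO). Qed.

Let resid_le k : (Num.sqrt n%:R)^-1 *
    l2norm (mask_rows (same_block m i) (y' - X' *m masked_gd (outside i) t k)) <=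
  block_resid i t k.
Proof.
rewrite ler_wpM2l ?invr_ge0 ?sqrtr_ge0// /y' /X' -mask_mulmx -mask_sub mask_mask.
rewrite (eq_mask_rows (S' := predI S (same_block m i))); last first.
  by move=> j /=; rewrite andbC.
by rewrite -mask_mask; exact: l2norm_mask.
Qed.

Let E := expR (L ^+ 2 * D) * L.

Let E0 : 0 <= E. Proof. by rewrite mulr_ge0 ?expR_ge0 ?L_ge0. Qed.

Let stab_le k l : (k <= l.+1)%N ->
  stab delta b0 L D X' y' (same_block m i) k <=
  E * \sum_(j < l.+1) delta j * block_resid i t j.
Proof.
move=> kl; rewrite /stab /E -mulrA ler_wpM2l ?expR_ge0// mulr_sumr.
apply: (@le_trans _ _ (\sum_(j < k) L * (delta j * block_resid i t j))).
  apply: ler_sum => j _; rewrite mulrCA ler_wpM2l ?L_ge0// ler_wpM2l//.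
  by rewrite iterE resid_le.
rewrite (big_ord_widen _ (fun j : nat => L * (delta j * block_resid i t j)) kl).
rewrite big_mkcond /=; apply: ler_sum => j _; case: ifP => // _.
by apply: mulr_ge0; [exact: L_ge0|apply: mulr_ge0 => //; exact: block_resid_ge0].
Qed.

Let iter_dist k l : (k <= l.+1)%N ->
  l2norm (masked_gd S t k - masked_gd (outside i) t k) <=
  E * \sum_(j < l.+1) delta j * block_resid i t j.
Proof.
move=> kl; apply: le_trans (stab_le kl); rewrite -iterE.
by apply: stab_gd => //; [exact: L_ge0|exact: good_opbound].
Qed.

Let sum_ge0 l : 0 <= \sum_(j < l.+1) delta j * block_resid i t j.
Proof. by apply: sumr_ge0 => j _; rewrite mulr_ge0 ?block_resid_ge0. Qed.

(** Stated for any [S] that contains the outside of the block: it serves for the leave-one-out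
    iterates, where [S] omits [i] alone, and for the full iterates. *)
Lemma twice_mid_dist l :
  l2norm (twice_mid S t l - twice_mid (outside i) t l) <=
  dist_const * block_dist i t l.
Proof.
have -> : twice_mid S t l - twice_mid (outside i) t l =
  (masked_gd S t l - masked_gd (outside i) t l) + (masked_gd S t l.+1 - masked_gd (outside i) t l.+1).
  by rewrite /twice_mid opprD addrACA.
apply: le_trans (l2normD _ _) _.
have h1 := iter_dist (leqW (leqnn l)); have h2 := iter_dist (leqnn l.+1).
have h3 := block_resid_ge0 i t l; have h4 := sum_ge0 l.
apply: le_trans (lerD h1 h2) _; rewrite /dist_const /block_dist -/E.
move: (\sum_(_ < _) _) (block_resid _ _ _) h3 h4 => x y y0 x0.
have := mulr_ge0 L_ge0 x0; have := mulr_ge0 L_ge0 y0; have := mulr_ge0 E0 y0.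
have := mulr_ge0 (mulr_ge0 (sqr_ge0 L) E0) (addr_ge0 y0 x0).
by have := mulr_ge0 E0 x0; lra.
Qed.

Lemma masked_grad_dist l :
  l2norm (masked_grad S t l - masked_grad (outside i) t l) <= dist_const * block_dist i t l.
Proof.
have stepE : masked_grad (outside i) t l =
  grad (mask_rows (predC (same_block m i)) X')
    (mask_rows (predC (same_block m i)) y') (masked_gd (outside i) t l).
  by rewrite /masked_grad /X' /y' !mask_mask !(eq_mask_rows _ SO).
have := @stab_grad R n q delta b0 L D n0 L_ge0 delta0 deltaD X' y' (same_block m i) l
  (good_opbound gS).
rewrite iterE -stepE => H; apply: le_trans H _.
have h1 := stab_le (leqW (leqnn l)); have h3 := block_resid_ge0 i t l.
have h4 := sum_ge0 l.
have h2 := ler_wpM2l L_ge0 (resid_le l).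
have h5 := ler_wpM2l (sqr_ge0 L) h1.
apply: le_trans (lerD h5 h2) _; rewrite /dist_const /block_dist -/E.
move: (\sum_(_ < _) _) (block_resid _ _ _) h3 h4 => x y y0 x0.
have := mulr_ge0 L_ge0 x0; have := mulr_ge0 E0 y0; have := mulr_ge0 E0 x0.
by have := mulr_ge0 (mulr_ge0 (sqr_ge0 L) E0) y0; lra.
Qed.

End Comparison.

End SampleIterates.

(** * Leave-one-out iterates *)

Section MeasurableMean.
Context (R : realType) (d d' : measure_display) (Omega : measurableType d).
Context (D : measurableType d') (P : probability Omega R).

Lemma measurable_mean_param (F : Omega * D -> R) : measurable_fun setT F ->
  measurable_fun setT (fun t => fine (mean P (fun w => F (w, t)))).
Proof.
move=> mF; apply: (measurableT_comp (fine_measurable _)) => //.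
have mF' : measurable_fun setT (EFin \o F) by exact/measurable_EFinP.
rewrite (_ : (fun t => _) = fun t =>
   (fubini_G P ((EFin \o F)^\+)%E t - fubini_G P ((EFin \o F)^\-)%E t)%E); last first.
  apply/funext => t; rewrite /mean integralE /fubini_G; congr (_ - _)%E.
    by apply: eq_integral => w _; rewrite !funeposE.
  by apply: eq_integral => w _; rewrite !funenegE.
apply: emeasurable_funB.
  apply: measurable_fun_fubini_tonelli_G; first exact: measurable_funepos.
  by move=> z; exact: funepos_ge0.
apply: measurable_fun_fubini_tonelli_G; first exact: measurable_funeneg.
by move=> z; exact: funeneg_ge0.
Qed.

End MeasurableMean.

Lemma measurable_bigsum (R : realType) (d : measure_display) (T : measurableType d)
    (I : Type) (r : seq I) (pr : pred I) (F : I -> T -> R) :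
  (forall i, measurable_fun setT (F i)) ->
  measurable_fun setT (fun t => \sum_(i <- r | pr i) F i t).
Proof.
move=> mF; under eq_fun do rewrite big_mkcond.
by apply: measurable_sum => i; case: (pr i).
Qed.

Section WeightedMoments.
Context (R : realType) (d : measure_display) (Omega : measurableType d).
Variables (P : probability Omega R) (I : Type) (r : seq I) (pr : pred I).
Variables (wt : I -> R) (W M : R) (F : I -> Omega -> R).
Hypothesis wt0 : forall i, pr i -> 0 <= wt i.
Hypothesis wtW : \sum_(i <- r | pr i) wt i <= W.
Hypothesis M0 : 0 <= M.
Hypothesis mF : forall i, measurable_fun setT (F i).

Let W0 : 0 <= \sum_(i <- r | pr i) wt i. Proof. exact: sumr_ge0. Qed.

Lemma mean_wsum4 :
  (forall i, pr i -> mean_le P (fun w => F i w ^+ 4) M) ->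
  mean_le P (fun w => (\sum_(i <- r | pr i) wt i * F i w) ^+ 4) (W ^+ 4 * M).
Proof.
move=> FM; have H := @mean_le_lincomb _ _ _ P _ r pr
  (fun w => (\sum_(i <- r | pr i) wt i * F i w) ^+ 4) (fun i w => F i w ^+ 4)
  (fun i => (\sum_(i <- r | pr i) wt i) ^+ 3 * wt i) 0 (fun=> M).
apply: le_trans (H _ _ _ _ _ _ _ _) _ => //.
- apply: measurable_funX; apply: measurable_bigsum => i.
  by apply: measurable_funM => //; exact: measurable_cst.
- by move=> i; exact: measurable_funX.
- by move=> w; rewrite exprn_even_ge0.
- by move=> i pi; apply: mulr_ge0; [exact: exprn_ge0|exact: wt0].
- by move=> i w _; rewrite exprn_even_ge0.
- move=> w; rewrite add0r; apply: le_trans (weighted_pow4 _ _ wt0) _.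
  by rewrite mulr_sumr; apply: ler_sum => i _; rewrite mulrA.
rewrite lee_fin add0r -mulr_suml -mulr_sumr -exprSr ler_wpM2r//.
by rewrite lerXn2r// nnegrE// (le_trans W0).
Qed.

Lemma mean_wsum8 :
  (forall i, pr i -> mean_le P (fun w => F i w ^+ 8) M) ->
  mean_le P (fun w => (\sum_(i <- r | pr i) wt i * F i w) ^+ 8) (W ^+ 8 * M).
Proof.
move=> FM; have H := @mean_le_lincomb _ _ _ P _ r pr
  (fun w => (\sum_(i <- r | pr i) wt i * F i w) ^+ 8) (fun i w => F i w ^+ 8)
  (fun i => (\sum_(i <- r | pr i) wt i) ^+ 7 * wt i) 0 (fun=> M).
apply: le_trans (H _ _ _ _ _ _ _ _) _ => //.
- apply: measurable_funX; apply: measurable_bigsum => i.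
  by apply: measurable_funM => //; exact: measurable_cst.
- by move=> i; exact: measurable_funX.
- by move=> w; rewrite exprn_even_ge0.
- by move=> i pi; apply: mulr_ge0; [exact: exprn_ge0|exact: wt0].
- by move=> i w _; rewrite exprn_even_ge0.
- move=> w; rewrite add0r; apply: le_trans (weighted_pow8 _ _ wt0) _.
  by rewrite mulr_sumr; apply: ler_sum => i _; rewrite mulrA.
rewrite lee_fin add0r -mulr_suml -mulr_sumr -exprSr ler_wpM2r//.
by rewrite lerXn2r// nnegrE// (le_trans W0).
Qed.

End WeightedMoments.

Lemma mean_sqr_pow4 (R : realType) (d : measure_display) (Omega : measurableType d)
    (P : probability Omega R) (F : Omega -> R) (M : R) :
  mean_le P (fun w => F w ^+ 8) M -> mean_le P (fun w => (F w ^+ 2) ^+ 4) M.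
Proof. by congr mean_le; apply/funext => w; rewrite -exprM. Qed.

Lemma mean_pow8D (R : realType) (d : measure_display) (Omega : measurableType d)
    (P : probability Omega R) (F G : Omega -> R) (M N : R) :
  measurable_fun setT F -> measurable_fun setT G ->
  mean_le P (fun w => F w ^+ 8) M -> mean_le P (fun w => G w ^+ 8) N ->
  mean_le P (fun w => (F w + G w) ^+ 8) (128 * M + 128 * N).
Proof.
move=> mF mG FM GN; rewrite -[_ + _]add0r.
apply: (mean_le_lin2 (G1 := fun w => F w ^+ 8) (G2 := fun w => G w ^+ 8)) => //.
- by apply: measurable_funX; exact: measurable_funD.
- exact: measurable_funX.
- exact: measurable_funX.
- by move=> w; rewrite exprn_even_ge0.
- by move=> w; rewrite exprn_even_ge0.
- by move=> w; rewrite exprn_even_ge0.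
- by move=> w; rewrite add0r pow8D_le.
Qed.

Lemma avg_split (R : realType) n (a y mu b : 'I_n -> R) (c : R) : (0 < n)%N ->
  n%:R^-1 * (\sum_i (a i - 2 * y i + (mu i + b i))) - c =
  n%:R^-1 * (\sum_i a i) - 2 * (n%:R^-1 * \sum_i y i) +
  n%:R^-1 * (\sum_i (mu i - c)) + n%:R^-1 * \sum_i b i.
Proof.
move=> n0; have n0R : n%:R != 0 :> R by rewrite pnatr_eq0 -lt0n.
rewrite !big_split /= !sumrN sumr_const card_ord -!mulr_sumr -[c *+ n]mulr_natr.
move: (\sum_i a i) (\sum_i y i) (\sum_i mu i) (\sum_i b i) (n%:R : R) n0R
  => A Y M B N N0.
by field.
Qed.

Definition others n (i : 'I_n) : pred 'I_n := predC1 i.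

(** A zero row drops out of every sum in the gradient, and the normalization [n] is independent of
    the number of rows. *)
Lemma gd_row' (R : realType) n q (i : 'I_n) (X : 'M[R]_(n, q)) (y : 'cV[R]_n)
    (delta : nat -> R) (b0 : 'cV[R]_q) k :
  gd n (row' i X) (row' i y) delta b0 k =
  gd n (mask_rows (others i) X) (mask_rows (others i) y) delta b0 k.
Proof.
elim: k => //= k ->; congr (_ + _ *: _); set b := gd _ _ _ _ _ _.
apply/matrixP => j j'; rewrite !mxE [RHS](@bigD1_ord _ _ _ _ i xpredT _ isT) /= !mxE /others /= eqxx mul0r add0r.
apply: eq_bigr => l _; rewrite !mxE /= eq_sym neq_lift; congr (_ * (_ - _)).
by apply: eq_bigr => j'' _; rewrite !mxE /= eq_sym neq_lift.
Qed.

(** * The gap between leave-one-out and population risk along the path *)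

Section LeaveOneOut.
Context (R : realType) (d : measure_display) (Omega : measurableType d).
Variables (P : probability Omega R) (n q : nat).
Notation T := (borel_mx R q 1 * measurableTypeR R)%type.
Variables (U : 'I_n -> {RV P >-> T}) (U0 : {RV P >-> T}) (kap m8 : R).
Hypothesis indepU : independent_family P U.
Hypothesis sameU : forall i, same_law P (U i) U0.
Hypothesis kap0 : 0 <= kap.
Hypothesis U0mgf : forall v, mean_le P (fun w => expR (dot (U0 w).1 v))
  (expR (kap * (l2norm v + l2norm v ^+ 2))).
Hypothesis U0y : mean_le P (fun w => (U0 w).2 ^+ 8) m8.
Variables (delta : nat -> R) (b0 : 'cV[R]_q) (t0 Y D B0 : R).
Hypotheses (n0 : (0 < n)%N) (q0 : (0 < q)%N).
Hypothesis t00 : 0 <= t0.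
Hypothesis Y0 : 0 <= Y.
Hypothesis delta0 : forall l, 0 <= delta l.
Hypothesis deltaD : forall k, \sum_(l < k) delta l <= D.
Hypothesis b0B0 : l2norm b0 <= B0.
Variable m : nat.
Hypotheses (m0 : (0 < m)%N) (mn : (m <= n)%N).

Implicit Types (S : pred 'I_n) (t : n.-tuple T).

Notation L := (2 * t0).
Let Bb : R := gd_bound L Y D B0.
Let Gam : R := grad_bound L Y D B0.
Let Sb : R := 2 * Bb.

Notation iter := (masked_gd delta b0).
Notation step := (masked_grad delta b0).
Notation mid := (twice_mid delta b0).
Notation good := (good_sample t0 Y).
Notation outside := (outside m).

Let iterB S t k : good S t -> l2norm (iter S t k) <= Bb.
Proof. exact: masked_gd_le. Qed.

Let stepB S t k : good S t -> l2norm (step S t k) <= Gam.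
Proof. exact: masked_grad_le. Qed.

Let midB S t k : good S t -> l2norm (mid S t k) <= Sb.
Proof. exact: twice_mid_le. Qed.

Let mean_same i (F : T -> R) : measurable_fun setT F ->
  mean P (fun w => F (U i w)) = mean P (fun w => F (U0 w)).
Proof. by move=> mF; exact: same_law_mean. Qed.

Let mrow : measurable_mx (fun u : T => u.1 : 'cV[R]_q).
Proof. exact: measurable_mx_row. Qed.

Let mdotT v : measurable_fun setT (fun u : T => dot u.1 v).
Proof. by apply: measurable_dot => //; exact: measurable_mx_cst. Qed.

Let msnd : measurable_fun setT (fun u : T => u.2 : R).
Proof. exact: measurable_snd. Qed.

Let mrow_tnth i : measurable_mx (fun t : n.-tuple T => (tnth t i).1 : 'cV[R]_q).
Proof.
move=> j k; apply: (measurableT_comp (mrow j k)); exact: measurable_tnth.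
Qed.

Let mresp_tnth i : measurable_fun setT (fun t : n.-tuple T => (tnth t i).2 : R).
Proof. by apply: measurableT_comp msnd _; exact: measurable_tnth. Qed.

Let mstep S l : measurable_mx (fun t : n.-tuple T => step S t l).
Proof. exact: measurable_masked_grad. Qed.

Let mmid S l : measurable_mx (fun t : n.-tuple T => mid S t l).
Proof. exact: measurable_twice_mid. Qed.

Let miter S l : measurable_mx (fun t : n.-tuple T => iter S t l).
Proof. exact: measurable_masked_gd. Qed.

Let mgood S : measurable_fun setT (fun t : n.-tuple T => good S t).
Proof. exact: measurable_good_sample. Qed.

(** The truncating event depends only on rows outside the block. It bounds the iterates, hence the
    moments, and leaves the summand centered given those rows. *)
Definition block_noise l i (t : n.-tuple T) : R :=
  if good (outside i) t then
    loss_incr (tnth t i) (step (outside i) t l) (mid (outside i) t l) -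
    mean_incr U0 (step (outside i) t l) (mid (outside i) t l)
  else 0.

Lemma measurable_block_noise l i : measurable_fun setT (block_noise l i).
Proof.
apply: measurable_fun_ifT => //; apply: measurable_funB.
  apply: measurable_funM; first exact: measurable_dot.
  apply: measurable_funB; first exact: measurable_dot.
  by apply: measurable_funM => //; exact: measurable_cst.
pose F (z : Omega * n.-tuple T) : R :=
  loss_incr (U0 z.1) (step (outside i) z.2 l) (mid (outside i) z.2 l).
apply: (@measurable_mean_param _ _ _ _ _ P F).
have mU0 : measurable_fun setT (fun z : Omega * n.-tuple T => U0 z.1).
  exact: (measurableT_comp (measurable_funPT U0) measurable_fst).
have m1 : measurable_mx (fun z : Omega * n.-tuple T => (U0 z.1).1 : 'cV[R]_q).
  by move=> j k; exact: (measurableT_comp (mrow j k) mU0).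
have m2 (G : n.-tuple T -> 'cV[R]_q) : measurable_mx G ->
    measurable_mx (fun z : Omega * n.-tuple T => G z.2).
  by move=> mG j k; exact: (measurableT_comp (mG j k) measurable_snd).
apply: measurable_funM.
  by apply: measurable_dot => //; exact: (m2 (fun t => step (outside i) t l)).
apply: measurable_funB.
  by apply: measurable_dot => //; exact: (m2 (fun t => mid (outside i) t l)).
apply: measurable_funM; first exact: measurable_cst.
exact: (measurableT_comp msnd mU0).
Qed.

Lemma outside_same (i j : 'I_n) : same_block m i j -> outside j = outside i.
Proof.
rewrite /outside /same_block => /eqP ij; congr predC.
by apply/funext => k; rewrite /same_block ij.
Qed.

Let block_state_upd l i u t :
  [/\ good (outside i) (upd i u t) = good (outside i) t,
      step (outside i) (upd i u t) l = step (outside i) t l &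
      mid (outside i) (upd i u t) l = mid (outside i) t l].
Proof.
have Oi := outside_self m i.
split; [exact: good_sample_upd|exact: masked_grad_upd|exact: twice_mid_upd].
Qed.

Lemma block_noise_upd l i j u t : same_block m i j -> i != j ->
  block_noise l j (upd i u t) = block_noise l j t.
Proof.
move=> ij ineqj; rewrite /block_noise (outside_same ij).
have [g1 s1 t1] := block_state_upd l i u t.
by rewrite g1 s1 t1 tnth_upd eq_sym (negbTE ineqj).
Qed.

Lemma block_noise_self l i u t : block_noise l i (upd i u t) =
  if good (outside i) t then
    loss_incr u (step (outside i) t l) (mid (outside i) t l) -
    mean_incr U0 (step (outside i) t l) (mid (outside i) t l)
  else 0.
Proof.
have [g1 s1 t1] := block_state_upd l i u t.
by rewrite /block_noise g1 s1 t1 tnth_upd eqxx.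
Qed.

Let mincr g s : measurable_fun setT (fun u : T => loss_incr u g s).
Proof. by rewrite /loss_incr; mfun. Qed.

Lemma Bb_ge0 : 0 <= Bb.
Proof.
apply: (@gd_bound_ge0 _ _ delta b0) => //; by rewrite mulr_ge0.
Qed.

Lemma Gam_ge0 : 0 <= Gam.
Proof. by apply: (@grad_bound_ge0 _ _ delta b0) => //; rewrite mulr_ge0. Qed.

Lemma mean_noise_avg l :
  mean_le P (fun w => (n%:R^-1 * \sum_i block_noise l i (sample U w)) ^+ 4)
    (304 * expR 1 * centered4_bound kap m8 Gam Sb / m%:R ^+ 2).
Proof.
have C0 : 0 <= centered4_bound kap m8 Gam Sb.
  by apply: centered_bound_ge0; apply: (incr4_bound_ge0 kap U0y Gam_ge0); rewrite mulr_ge0// Bb_ge0.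
apply: (mean_block_average indepU m0 mn (zeta := block_noise l) C0).
- by move=> i; exact: measurable_block_noise.
- by move=> i j ij ineqj u t; exact: block_noise_upd.
- move=> i t; under eq_fun do rewrite block_noise_self.
  case: (boolP (good (outside i) t)) => G; last by rewrite mean_cst.
  generalize (step (outside i) t l) (mid (outside i) t l) => g s.
  have mF : measurable_fun setT (fun u : T => loss_incr u g s - mean_incr U0 g s).
    by apply: measurable_funB; [exact: mincr|exact: measurable_cst].
  rewrite (mean_same i mF); exact: mean_centered kap0 U0mgf U0y _ _.
- move=> i t; under eq_fun do rewrite block_noise_self.
  case: (boolP (good (outside i) t)) => G; last first.
    by apply: mean_le_cst => [|w|w]; rewrite ?expr0n//; exact: measurable_cst.
  have := stepB l G; have := midB l G; generalize (step (outside i) t l) (mid (outside i) t l) => g s sS gG.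
  have mF : measurable_fun setT
      (fun u : T => (loss_incr u g s - mean_incr U0 g s) ^+ 4).
    apply: measurable_funX.
    by apply: measurable_funB; [exact: mincr|exact: measurable_cst].
  rewrite /mean_le (mean_same i mF); exact: centered4.
Qed.

Lemma mean_loss_avg b B : l2norm b <= B ->
  mean_le P (fun w => (n%:R^-1 * \sum_i
      (sq_loss (tnth (sample U w) i).1 (tnth (sample U w) i).2 b - pop_risk U0 b)) ^+ 4)
    (304 * expR 1 * centered_loss4_bound kap m8 B / m%:R ^+ 2).
Proof.
move=> bB; have B0' := le_trans (l2norm_ge0 b) bB.
have mloss : measurable_fun setT (fun u : T => sq_loss u.1 u.2 b).
  by apply: measurable_funX; apply: measurable_funB => //; exact: mdotT.
apply: (mean_block_average indepU m0 mn
  (zeta := fun i t => sq_loss (tnth t i).1 (tnth t i).2 b - pop_risk U0 b)).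
- apply: centered_bound_ge0; rewrite -lee_fin.
  apply: le_trans (resid8 kap0 U0mgf U0y bB).
  by apply: mean_ge0 => w; rewrite exprn_even_ge0.
- move=> i; apply: measurable_funB; last exact: measurable_cst.
  by apply: measurableT_comp mloss _; exact: measurable_tnth.
- by move=> i j _ ij u t; rewrite tnth_upd eq_sym (negbTE ij).
- move=> i t; under eq_fun do rewrite tnth_upd eqxx.
  have mF : measurable_fun setT (fun u : T => sq_loss u.1 u.2 b - pop_risk U0 b).
    by apply: measurable_funB; [exact: mloss|exact: measurable_cst].
  rewrite (mean_same i mF); exact: mean_centered_loss kap0 U0mgf U0y _.
- move=> i t; under eq_fun do rewrite tnth_upd eqxx.
  have mF : measurable_fun setT
      (fun u : T => (sq_loss u.1 u.2 b - pop_risk U0 b) ^+ 4).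
    apply: measurable_funX.
    by apply: measurable_funB; [exact: mloss|exact: measurable_cst].
  rewrite /mean_le (mean_same i mF); exact: centered_loss4.
Qed.

Variable Q : R.
Hypothesis qQ : q%:R <= Q * n%:R.
Hypothesis t0E : 18 * (1 + Q) + 2 * kap + 1 <= t0.
Hypothesis YE : 2 + resid8_bound kap m8 0 <= Y ^+ 2.

Let sn : R := Num.sqrt n%:R.
Let snn : sn ^+ 2 = n%:R. Proof. by rewrite sqr_sqrtr. Qed.
Let sn0 : 0 < sn. Proof. by rewrite sqrtr_gt0 ltr0n. Qed.

(** The rows are independent, so the exponential moment factorizes, row [i] being taken at
    [c sqrt n (u i) v]. The linear parts of the exponents sum to at most [n] by Cauchy-Schwarz, and
    so do the quadratic parts. *)
Lemma bilinear_mgf (c : R) (u : 'cV[R]_n) (v : 'cV[R]_q) :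
  `|c| = 1 -> l2norm u <= 1 -> l2norm v <= 1 ->
  mean_le P (fun w => expR (c * sn * dot u (features (sample U w) *m v)))
    (expR (2 * kap * n%:R)).
Proof.
move=> c1 u1 v1.
pose a i := c * sn * u i 0.
have -> : (fun w => expR (c * sn * dot u (features (sample U w) *m v))) =
    (fun w => \prod_i expR (dot (U i w).1 (a i *: v))).
  apply/funext => w; rewrite -expR_sum; congr expR.
  rewrite dotE mulr_sumr; apply: eq_bigr => i _.
  rewrite dotZr /a mulrA; congr (_ * _).
  rewrite mxE dotE; apply: eq_bigr => j _.
  by rewrite mxE tnth_mktuple.
have H := @mean_le_prod _ _ _ _ _ P n U indepU
  (fun i u => expR (dot u.1 (a i *: v)))
  (fun i => expR (kap * (l2norm (a i *: v) + l2norm (a i *: v) ^+ 2))).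
apply: le_trans (H _ _ _ _) _.
- by move=> i; apply: measurableT_comp; [exact: measurable_expR|exact: mdotT].
- by move=> i z; exact: expR_ge0.
- by move=> i; exact: expR_ge0.
- move=> i.
  have mF : measurable_fun setT (fun z : T => expR (dot z.1 (a i *: v))).
    by apply: measurableT_comp; [exact: measurable_expR|exact: mdotT].
  rewrite /mean_le (same_law_mean (sameU i) mF); exact: U0mgf.
rewrite lee_fin -expR_sum ler_expR -mulr_sumr.
rewrite [2 * kap]mulrC -mulrA ler_wpM2l// big_split /=.
have aE i : `|a i| = sn * `|u i 0|.
  by rewrite /a !normrM c1 mul1r (ger0_norm (ltW sn0)).
have n00 : 0 <= n%:R :> R by [].
have h2 : \sum_i l2norm (a i *: v) ^+ 2 <= n%:R.
  apply: (@le_trans _ _ (\sum_i n%:R * u i 0 ^+ 2)).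
    apply: ler_sum => i _; rewrite l2normZ exprMn aE exprMn snn.
    rewrite -mulrA ler_wpM2l// real_normK ?num_real// ler_piMr ?sqr_ge0//.
    by rewrite exprn_ile1// l2norm_ge0.
  rewrite -mulr_sumr -sqr_l2norm ler_piMr//.
  by rewrite exprn_ile1// l2norm_ge0.
have h1 : \sum_i l2norm (a i *: v) <= n%:R.
  apply: (@le_trans _ _ (\sum_i sn * `|u i 0|)).
    apply: ler_sum => i _; rewrite l2normZ aE ler_piMr// mulr_ge0//; exact: ltW.
  rewrite -mulr_sumr -snn expr2 ler_wpM2l ?(ltW sn0)//.
  rewrite -ler_sqr ?nnegrE ?(ltW sn0) ?sumr_ge0// snn.
  have := @sum_cauchy R _ (index_enum 'I_n) xpredT (fun=> 1) (fun i => `|u i 0|).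
  under eq_bigr do rewrite mul1r.
  under [X in _ <= X * _ -> _]eq_bigr do rewrite expr1n.
  rewrite sumr_const card_ord => /le_trans; apply.
  rewrite ler_piMr//; under eq_bigr do rewrite real_normK ?num_real//.
  by rewrite -sqr_l2norm exprn_ile1// l2norm_ge0.
by rewrite [2 * _]mulr_natl mulr2n lerD.
Qed.

(** Chernoff's bound with a union over both nets and both signs. The lower bound on [t0] makes
    [t0 n] exceed the entropy [18 n + 18 q] plus the exponent [2 kap n] by [n]. *)
Lemma net_fail_prob :
  let A := [set w | ~~ net_bounded (features (sample U w)) (t0 * sn)] in
  (P A <= (2 * expR (- n%:R))%:E)%E.
Proof.
rewrite /=.
pose sg (c : bool) : R := if c then 1 else -1.
pose J := (bool * (net_index n * net_index q))%type.
pose G (p : J) w : R := expR (sg p.1 * sn *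
  dot (net_point R p.2.1) (features (sample U w) *m net_point R p.2.2)).
pose pr (p : J) := p \in [predX predT & [predX @in_net n & @in_net q]].
pose W w : R := \sum_(p | pr p) G p w.
have mG p : measurable_fun setT (G p).
  apply: measurableT_comp; first exact: measurable_expR.
  apply: measurable_funM; first exact: measurable_cst.
  apply: measurable_dot; first exact: measurable_mx_cst.
  apply: measurable_mxM; last exact: measurable_mx_cst.
  by move=> i j; apply: measurableT_comp (measurable_features i j) (measurable_sample U).
have G0 p w : 0 <= G p w by exact: expR_ge0.
have mW : measurable_fun setT W.
  rewrite /W; under eq_fun do rewrite big_mkcond /=.
  apply: measurable_sum => p; case: (pr p) => //; exact: measurable_cst.
have W0 w : 0 <= W w by apply: sumr_ge0 => p _; exact: G0.
have WM : mean_le P (fun w => `|W w| ^+ 1) (2 * 2 ^+ (18 * n) * 2 ^+ (18 * q) * expR (2 * kap * n%:R)).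
  have H := @mean_le_lincomb _ _ _ P _ (index_enum J) pr (fun w => `|W w| ^+ 1)
    G (fun=> 1) 0 (fun=> expR (2 * kap * n%:R)).
  apply: le_trans (H _ mG _ _ _ _ _ _) _ => //.
  - by apply: measurable_funX; apply: measurableT_comp mW; exact: normr_measurable.
  - move=> [c [k l]]; rewrite /pr !inE /= => /andP[kin lin].
    apply: bilinear_mgf; [|exact: l2norm_net_point|exact: l2norm_net_point].
    by case: c; rewrite /sg ?normrN normr1.
  - by move=> w; rewrite expr1 add0r ger0_norm// /W; under eq_bigr do rewrite -[G _ _]mul1r.
  rewrite lee_fin add0r mul1r sumr_const.
  rewrite (@eq_card _ _ ([predX predT & [predX @in_net n & @in_net q]])) //.
  rewrite cardX cardX card_bool.
  rewrite -[leLHS]mulr_natl !natrM mulrA ler_wpM2r ?expR_ge0// -mulrA.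
  by rewrite -mulrA ler_wpM2l// ler_pM// card_net.
have eW w : ~~ net_bounded (features (sample U w)) (t0 * sn) ->
    expR (t0 * n%:R) <= `|W w|.
  rewrite ger0_norm// => /forallPn[k /forallPn[l]]; rewrite negb_imply.
  rewrite -ltNge => /andP[kl big].
  set x := dot _ _ in big.
  have [c xc] : exists c, sg c * x = `|x|.
    case: (ger0P x) => x0; [exists true|exists false]; by rewrite /sg ?mul1r ?mulN1r.
  rewrite /W (bigD1 (c, (k, l))) /=; last by rewrite /pr !inE.
  apply: (@le_trans _ _ (G (c, (k, l)) w)).
    rewrite /G /= -/x ler_expR mulrAC xc -snn expr2 mulrA ler_wpM2r ?(ltW sn0)//.
    exact: ltW.
  by rewrite lerDl sumr_ge0.
have et : 0 < expR (t0 * n%:R) :> R by exact: expR_gt0.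
have mA : measurable [set w | ~~ net_bounded (features (sample U w)) (t0 * sn)].
  have mB : measurable_fun setT (fun w => ~~ net_bounded (features (sample U w)) (t0 * sn)).
    apply: measurable_neg; apply: measurable_net_bounded.
    by move=> i j; apply: measurableT_comp (measurable_features i j) (measurable_sample U).
  by rewrite -[X in measurable X]setTI; exact: mB measurableT [set true] _.
apply: (@le_trans _ _ (P [set w | expR (t0 * n%:R) <= `|W w| ])).
  apply: le_measure; rewrite ?inE//.
  rewrite -[X in measurable X]setTI.
  exact: (measurable_fun_ler (measurable_cst _) (measurableT_comp (@normr_measurable _ setT) mW)) _ _.
apply: le_trans (markov_pow mW et WM) _; rewrite lee_fin expr1.
have e2 k : 2 ^+ k <= expR k%:R :> R.
  rewrite -[k%:R]mulr1 expRM_natl lerXn2r ?nnegrE ?expR_ge0//.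
  by have := expR_ge1Dx (1 : R).
rewrite ler_pdivrMr// -[leRHS]mulrA -expRD.
apply: (@le_trans _ _ (2 * expR (18 * n)%:R * expR (18 * q)%:R * expR (2 * kap * n%:R))).
  rewrite ler_wpM2r ?expR_ge0// -!mulrA ler_wpM2l// ler_pM ?exprn_ge0//.
rewrite -!mulrA ler_wpM2l// -!expRD ler_expR !natrM.
have n1 : 0 <= n%:R :> R by [].
have := ler_wpM2r n1 t0E; move: qQ; move: (n%:R : R) (q%:R : R) => N M; lra.
Qed.

(** The squared response is the loss at the zero vector, so a large norm of the responses is a
    deviation of an average loss. The threshold [Y ^ 2] exceeds the bound on the mean by 1, and
    Markov's inequality is applied at level 1. *)
Lemma good_fail_prob :
  let A := [set w | ~~ good_sample t0 Y predT (sample U w)] in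
  (P A <= (2 * expR (- n%:R) +
    304 * expR 1 * centered_loss4_bound kap m8 0 / m%:R ^+ 2)%:E)%E.
Proof.
rewrite /=.
set C := 304 * _ * _ / _.
pose V w : R := n%:R^-1 * \sum_i
  (sq_loss (tnth (sample U w) i).1 (tnth (sample U w) i).2 0 - pop_risk U0 0).
have VM : mean_le P (fun w => `|V w| ^+ 4) C.
  rewrite (_ : (fun w => _) = fun w => V w ^+ 4); last first.
    by apply/funext => w; rewrite norm_even_pow.
  by apply: mean_loss_avg; rewrite l2norm0.
have mloss : measurable_fun setT (fun u : T => sq_loss u.1 u.2 0).
  apply: measurable_funX; apply: measurable_funB; first exact: measurable_snd.
  exact: mdotT.
have mV : measurable_fun setT V.
  apply: measurable_funM; first exact: measurable_cst.
  apply: measurable_sum => i; apply: measurable_funB; last exact: measurable_cst.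
  apply: measurableT_comp mloss _.
  by apply: (measurableT_comp (measurable_tnth i)); exact: measurable_sample.
have mA1 : measurable [set w | ~~ net_bounded (features (sample U w)) (t0 * sn)].
  have mB : measurable_fun setT (fun w => ~~ net_bounded (features (sample U w)) (t0 * sn)).
    apply: measurable_neg; apply: measurable_net_bounded.
    by move=> i j; apply: measurableT_comp (measurable_features i j) (measurable_sample U).
  by rewrite -[X in measurable X]setTI; exact: mB measurableT [set true] _.
have mA2 : measurable [set w | 1 <= `|V w| ].
  rewrite -[X in measurable X]setTI.
  exact: (measurable_fun_ler (measurable_cst _) (measurableT_comp (@normr_measurable _ setT) mV)) _ _.
have mA : measurable [set w | ~~ good_sample t0 Y predT (sample U w)].
  have mB : measurable_fun setT (fun w => ~~ good_sample t0 Y predT (sample U w)).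
    apply: measurable_neg.
    by apply: measurableT_comp (measurable_good_sample _ _ _) (measurable_sample U).
  by rewrite -[X in measurable X]setTI; exact: mB measurableT [set true] _.
apply: (@le_trans _ _
  (P ([set w | ~~ net_bounded (features (sample U w)) (t0 * sn)] `|`
    [set w | 1 <= `|V w| ]))).
  apply: le_measure; rewrite ?inE//; first exact: measurableU.
  move=> w /=; rewrite /good_sample !mask_rowsT negb_and => /orP[H|H]; first by left.
  right; rewrite -ltNge in H.
  have n0R : 0 < n%:R :> R by rewrite ltr0n.
  have := H; rewrite -ltr_sqr ?nnegrE ?l2norm_ge0 ?mulr_ge0 ?(ltW sn0)// => {}H.
  move: H; rewrite exprMn snn sqr_l2norm => H.
  have -> : V w = n%:R^-1 * (\sum_i responses (sample U w) i 0 ^+ 2) - pop_risk U0 0.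
    rewrite /V sumrB sumr_const card_ord -(mulr_natl (pop_risk _ _)) mulrBr.
    rewrite mulKf ?gt_eqF//; congr (_ * _ - _).
    apply: eq_bigr => i _; rewrite mxE /sq_loss.
    by rewrite mulmx0 mxE subr0.
  apply: le_trans (ler_norm _).
  have h : 2 + resid8_bound kap m8 0 <= n%:R^-1 * (\sum_i responses (sample U w) i 0 ^+ 2).
    rewrite mulrC ler_pdivlMr//; apply: le_trans (ltW H).
    by rewrite ler_wpM2r// ltW.
  have := pop_risk_le kap0 U0mgf U0y (b := 0) (B := 0).
  rewrite l2norm0 => /(_ (lexx _)) /(le_trans (ler_norm _)); lra.
apply: le_trans (measureU2 _ mA1 mA2) _; rewrite EFinD.
apply: leeD; first exact: net_fail_prob.
by apply: le_trans (markov_pow mV ltr01 VM) _; rewrite expr1n divr1.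
Qed.

Let mresid i k : measurable_fun setT
  (fun t : n.-tuple T => block_resid delta b0 m i t k).
Proof.
apply: measurable_funM; first exact: measurable_cst.
apply: measurable_l2norm; apply: measurable_mx_mask; apply: measurable_mxB.
  exact: measurable_responses.
by apply: measurable_mxM; [exact: measurable_features|exact: miter].
Qed.

Let ratio : R := m%:R / n%:R.

Let ratio0 : 0 <= ratio. Proof. by rewrite divr_ge0. Qed.

Let ms (F : n.-tuple T -> R) : measurable_fun setT F ->
  measurable_fun setT (fun w => F (sample U w)).
Proof. by move=> mF; exact: measurableT_comp mF (measurable_sample U). Qed.

(* The moment is computed by integrating the [j]-th row first, [G] bounding the
   result given the other rows. *)
Let mean_cond8 (j : 'I_n) (b : n.-tuple T -> bool) (phi : n.-tuple T -> T -> R)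
    (G : n.-tuple T -> R) M :
  let F t := if b t then phi t (tnth t j) else 0 in
  measurable_fun setT F -> measurable_fun setT G -> (forall t, 0 <= G t) ->
  (forall u t, b (upd j u t) = b t) ->
  (forall u t, phi (upd j u t) = phi t) ->
  (forall t, b t -> measurable_fun setT (phi t) /\
     mean_le P (fun w => phi t (U0 w) ^+ 8) (G t)) ->
  mean_le P (fun w => G (sample U w)) M ->
  mean_le P (fun w => F (sample U w) ^+ 8) M.
Proof.
move=> F mF mG G0 bE phiE H; apply: (@mean_le_resample _ _ _ _ _ _ _ _ indepU j (fun t => F t ^+ 8) G) => //.
- exact: measurable_funX.
- by move=> t; rewrite exprn_even_ge0.
move=> t; rewrite /F; under [X in mean_le _ X]eq_fun do
  rewrite bE phiE tnth_upd eqxx.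
case: (boolP (b t)) => [bt|_]; last by apply: mean_le_cst => // w; rewrite expr0n.
have [mphi phiG] := H t bt.
by rewrite /mean_le (mean_same j (measurable_funX 8 mphi)).
Qed.

Let row_resid i j k t : R :=
  if good (outside i) t then (tnth t j).2 - dot (tnth t j).1 (iter (outside i) t k)
  else 0.

Let mrow_resid i j k : measurable_fun setT (row_resid i j k).
Proof.
apply: measurable_fun_ifT => //; apply: measurable_funB => //.
exact: measurable_dot.
Qed.

Let row_resid8 i j k : same_block m i j ->
  mean_le P (fun w => row_resid i j k (sample U w) ^+ 8) (resid8_bound kap m8 Bb).
Proof.
move=> ij; have Oj : ~~ outside i j by rewrite /outside /= ij.
have r0 : 0 <= resid8_bound kap m8 Bb.
  apply: le_trans (_ : resid8_bound kap m8 0 <= _).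
    rewrite -lee_fin; apply: le_trans (resid8 kap0 U0mgf U0y (b := 0) _).
      by apply: mean_ge0 => w; rewrite exprn_even_ge0.
    by rewrite l2norm0.
  rewrite /resid8_bound lerD2l ler_wpM2l// ler_wpM2l ?dot_const_ge0//.
  by rewrite expr0n /= exprn_even_ge0.
apply: (mean_cond8 (b := good (outside i)) (G := fun=> resid8_bound kap m8 Bb)
  (phi := fun t u => u.2 - dot u.1 (iter (outside i) t k))) => //.
- exact: mrow_resid.
- by move=> u t; exact: good_sample_upd.
- move=> u t; have -> // : iter (outside i) (upd j u t) k = iter (outside i) t k.
  exact: masked_gd_upd.
- move=> t G; have := iterB k G; generalize (iter (outside i) t k) => b bB.
  by split; [apply: measurable_funB => //; exact: mdotT|exact: resid8].
- by rewrite /mean_le mean_cst.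
Qed.

Let masked_resid i k t : R :=
  if good (outside i) t then block_resid delta b0 m i t k else 0.

Let mmasked_resid i k : measurable_fun setT (masked_resid i k).
Proof. by apply: measurable_fun_ifT => //; exact: measurable_cst. Qed.

Let sqr_masked_resid i k t : masked_resid i k t ^+ 2 =
  \sum_(j | same_block m i j) n%:R^-1 * row_resid i j k t ^+ 2.
Proof.
rewrite /masked_resid /row_resid; case: ifPn => _; last first.
  by rewrite expr0n big1 //= => j _; rewrite mulr0.
rewrite /block_resid exprMn exprVn sqr_sqrtr// sqr_l2norm mulr_sumr.
rewrite [RHS]big_mkcond; apply: eq_bigr => j _; rewrite mxE.
case: ifP => _; last by rewrite expr0n mulr0.
congr (_ * _ ^+ 2); rewrite !mxE dotE; congr (_ - _).
by apply: eq_bigr => l _; rewrite mxE.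
Qed.

(** The squared residual is a sum over at most [m] rows with weights [1 / n], hence of total mass at
    most [m / n]; the eighth moment is the fourth moment of this sum. *)
Let masked_resid8 i k :
  mean_le P (fun w => masked_resid i k (sample U w) ^+ 8)
    (resid8_bound kap m8 Bb * ratio ^+ 4).
Proof.
have n0R : 0 < n%:R :> R by rewrite ltr0n.
have nV0 : 0 <= n%:R^-1 :> R by rewrite invr_ge0.
have r0 : 0 <= resid8_bound kap m8 Bb.
  rewrite -lee_fin; apply: le_trans (row_resid8 k (_ : same_block m i i)).
    by apply: mean_ge0 => w; rewrite exprn_even_ge0.
  by rewrite /same_block.
have sr : \sum_(j | same_block m i j) n%:R^-1 <= ratio.
  rewrite sumr_const -[leLHS]mulr_natl ler_wpM2r// ler_nat.
  exact: card_same_block.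
have H := @mean_wsum4 _ _ _ P _ (index_enum 'I_n) (same_block m i) (fun=> n%:R^-1)
  ratio (resid8_bound kap m8 Bb) (fun j w => row_resid i j k (sample U w) ^+ 2) (fun _ _ => nV0)
  sr r0 (fun j => measurable_funX 2 (ms (mrow_resid i j k)))
  (fun j ij => mean_sqr_pow4 (@row_resid8 i j k ij)).
rewrite mulrC; move: H; congr mean_le; apply/funext => w.
by rewrite -sqr_masked_resid -exprM.
Qed.

Let Rb := resid8_bound kap m8 Bb.

Let Rb0 : 0 <= Rb.
Proof.
rewrite -lee_fin.
apply: le_trans (resid8 kap0 U0mgf U0y (b := 0) (_ : l2norm 0 <= Bb)).
  by apply: mean_ge0 => w; rewrite exprn_even_ge0.
by rewrite l2norm0; exact: Bb_ge0.
Qed.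

Let D0 : 0 <= D. Proof. by have := deltaD 0; rewrite big_ord0. Qed.

Let C1 := dist_const L D.

Let C10 : 0 <= C1.
Proof. exact: (dist_const_ge0 D t00 (erefl L)). Qed.

Let bdist l i t : R := if good (outside i) t then block_dist delta b0 m i t l else 0.

Let bdistE l i t : bdist l i t =
  masked_resid i l t + \sum_(j < l.+1) delta j * masked_resid i j t.
Proof.
rewrite /bdist /masked_resid; case: ifPn => // _.
by rewrite big1 ?addr0// => j _; rewrite mulr0.
Qed.

Let mbdist l i : measurable_fun setT (bdist l i).
Proof.
rewrite (funext (bdistE l i)); apply: measurable_funD => //.
apply: measurable_bigsum => j; apply: measurable_funM => //; exact: measurable_cst.
Qed.

Definition bdist8_bound : R := 128 * (1 + D ^+ 8) * Rb.

Let CT0 : 0 <= bdist8_bound.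
Proof. by apply: mulr_ge0 => //; apply: mulr_ge0 => //; apply: addr_ge0 => //; exact: exprn_ge0. Qed.

Let bdist8 l i : mean_le P (fun w => bdist l i (sample U w) ^+ 8)
  (bdist8_bound * ratio ^+ 4).
Proof.
have M0 : 0 <= Rb * ratio ^+ 4 by apply: mulr_ge0 => //; exact: exprn_ge0.
have mr j := ms (@mmasked_resid i j).
have H1 := @mean_wsum8 _ _ _ P _ (index_enum 'I_l.+1) xpredT (fun j => delta j) D
  _ (fun j w => masked_resid i j (sample U w)) (fun j _ => delta0 j) (deltaD l.+1) M0
  (fun j => mr j) (fun j _ => masked_resid8 i j).
have H := mean_pow8D (mr l) _ (masked_resid8 i l) H1.
have -> : bdist8_bound * ratio ^+ 4 =
    128 * (Rb * ratio ^+ 4) + 128 * (D ^+ 8 * (Rb * ratio ^+ 4)).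
  by rewrite /bdist8_bound; ring.
under [X in mean_le _ X]eq_fun do rewrite bdistE.
apply: H; apply: measurable_bigsum => j; apply: measurable_funM => //.
Qed.

Let bdist8_scale l i c : 0 <= c ->
  mean_le P (fun w => c * bdist l i (sample U w) ^+ 8) (c * (bdist8_bound * ratio ^+ 4)).
Proof.
move=> c0; apply: (mean_leZ _ _ _ c0 _ (bdist8 l i)) => //.
- apply: measurable_funM; first exact: measurable_cst.
  exact: measurable_funX (ms (mbdist l i)).
- exact: measurable_funX (ms (mbdist l i)).
- by move=> w; apply: mulr_ge0 => //; rewrite exprn_even_ge0.
- by move=> w; rewrite exprn_even_ge0.
Qed.

Let othersO (i : 'I_n) : predI (outside i) (others i) =1 outside i.
Proof.
move=> j; rewrite /others /=; case: eqVneq => [->|_]; last by rewrite andbT.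
by rewrite andbF; apply/esym/negbTE; exact: outside_self.
Qed.

Let others_self (i : 'I_n) : ~~ others i i. Proof. by rewrite /others /= eqxx. Qed.

Let step_diff l i t := step (others i) t l - step (outside i) t l.
Let mid_diff l i t := mid (others i) t l - mid (outside i) t l.

Let diff_le l i t : good (others i) t ->
  [/\ l2norm (step_diff l i t) <= C1 * bdist l i t,
      l2norm (mid_diff l i t) <= C1 * bdist l i t &
      good (outside i) t].
Proof.
move=> G; have GO := good_outside (othersO i) G.
rewrite /bdist GO; split => //.
  exact: (masked_grad_dist b0 n0 q0 t00 (erefl L) delta0 deltaD (othersO i) G).
exact: (twice_mid_dist b0 n0 q0 t00 (erefl L) delta0 deltaD (othersO i) G).
Qed.

Let mstep_diff l i : measurable_mx (step_diff l i).
Proof. exact: measurable_mxB. Qed.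

Let mmid_diff l i : measurable_mx (mid_diff l i).
Proof. exact: measurable_mxB. Qed.

Let others_upd l i u t :
  [/\ good (others i) (upd i u t) = good (others i) t,
      step_diff l i (upd i u t) = step_diff l i t,
      mid_diff l i (upd i u t) = mid_diff l i t,
      step (outside i) (upd i u t) l = step (outside i) t l &
      mid (others i) (upd i u t) l = mid (others i) t l].
Proof.
have h1 := others_self i; have h2 := outside_self m i.
have e1 : step (others i) (upd i u t) l = step (others i) t l.
  exact: masked_grad_upd.
have e2 : step (outside i) (upd i u t) l = step (outside i) t l.
  exact: masked_grad_upd.
have e3 : mid (others i) (upd i u t) l = mid (others i) t l.
  exact: twice_mid_upd.
have e4 : mid (outside i) (upd i u t) l = mid (outside i) t l.
  exact: twice_mid_upd.
split; first exact: good_sample_upd.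
- by rewrite /step_diff e1 e2.
- by rewrite /mid_diff e3 e4.
- exact: e2.
- exact: e3.
Qed.

(** When the iterates are replaced, the increment changes by products of two linear forms, dominated
    by [mid_dev], and by the response times this linear form. *)
Definition grad_dev l i t : R :=
  if good (others i) t then dot (tnth t i).1 (step_diff l i t) else 0.

Definition mid_dev l i t : R :=
  if good (others i) t then
    `|dot (tnth t i).1 (step_diff l i t) * dot (tnth t i).1 (mid (others i) t l)| +
    `|dot (tnth t i).1 (step (outside i) t l) * dot (tnth t i).1 (mid_diff l i t)|
  else 0.

Let mgrad_dev l i : measurable_fun setT (grad_dev l i).
Proof.
by apply: measurable_fun_ifT => //; exact: measurable_dot.
Qed.

Let mmid_dev l i : measurable_fun setT (mid_dev l i).
Proof.
apply: measurable_fun_ifT => //; apply: measurable_funD;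
  (apply: measurableT_comp => //; apply: measurable_funM; exact: measurable_dot).
Qed.

(** Neither [step_diff] nor the truncation involves sample [i], so given the other samples this is a
    moment of a linear form in a fixed vector. *)
Let grad_dev8 l i : mean_le P (fun w => grad_dev l i (sample U w) ^+ 8)
  (dot_const kap 8 * C1 ^+ 8 * (bdist8_bound * ratio ^+ 4)).
Proof.
have c0 : 0 <= dot_const kap 8 * C1 ^+ 8.
  by apply: mulr_ge0; [exact: dot_const_ge0|exact: exprn_ge0].
apply: (mean_cond8 (b := good (others i)) (phi := fun t u => dot u.1 (step_diff l i t))
  (G := fun t => dot_const kap 8 * C1 ^+ 8 * bdist l i t ^+ 8) _ _ _ _ _ _ (bdist8_scale l i c0)).
- exact: mgrad_dev.
- by apply: measurable_funM; [exact: measurable_cst|exact: measurable_funX].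
- by move=> t; apply: mulr_ge0 => //; rewrite exprn_even_ge0.
- by move=> u t; have [] := others_upd l i u t.
- by move=> u t; have [_ -> _ _ _] := others_upd l i u t.
- move=> t G; have [sC _ _] := diff_le l G.
  move: (step_diff l i t) sC => v vC; split; first exact: mdotT.
  apply: le_trans (dot8 kap0 U0mgf v) _.
  rewrite lee_fin -mulrA ler_wpM2l ?dot_const_ge0//.
  by rewrite -exprMn lerXn2r// nnegrE ?l2norm_ge0// (le_trans (l2norm_ge0 v)).
Qed.

Definition mid_dev8_const : R :=
  128 * (dot_const kap 16 * C1 ^+ 8 * (Sb ^+ 8 + Gam ^+ 8)).

Let Sb0 : 0 <= Sb.
Proof. by apply: mulr_ge0 => //; exact: Bb_ge0. Qed.

Let Gam0 : 0 <= Gam.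
Proof. exact: Gam_ge0. Qed.

Let mid_dev8_const0 : 0 <= mid_dev8_const.
Proof.
apply: mulr_ge0 => //; apply: mulr_ge0.
  by apply: mulr_ge0; [exact: dot_const_ge0|exact: exprn_ge0].
by apply: addr_ge0; exact: exprn_ge0.
Qed.

Let dot_prod8_le a b A B : l2norm a <= A -> l2norm b <= B ->
  mean_le P (fun w => `|dot (U0 w).1 a * dot (U0 w).1 b| ^+ 8)
    (dot_const kap 16 * (A * B) ^+ 8).
Proof.
move=> aA bB; have [a0 b0'] := (l2norm_ge0 a, l2norm_ge0 b).
have A0 := le_trans a0 aA; have B0' := le_trans b0' bB.
under [X in mean_le _ X]eq_fun do rewrite (norm_even_pow _ (k := 8))//.
apply: le_trans (dot_prod8 kap0 U0mgf a b) _.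
rewrite lee_fin ler_wpM2l ?dot_const_ge0// lerXn2r ?nnegrE ?ler_pM//;
  exact: mulr_ge0.
Qed.

Let mid_dev8 l i : mean_le P (fun w => mid_dev l i (sample U w) ^+ 8)
  (mid_dev8_const * (bdist8_bound * ratio ^+ 4)).
Proof.
have c0 := mid_dev8_const0.
apply: (mean_cond8 (b := good (others i)) (phi := fun t u =>
  `|dot u.1 (step_diff l i t) * dot u.1 (mid (others i) t l)| +
  `|dot u.1 (step (outside i) t l) * dot u.1 (mid_diff l i t)|)
  (G := fun t => mid_dev8_const * bdist l i t ^+ 8) _ _ _ _ _ _ (bdist8_scale l i c0)).
- exact: mmid_dev.
- by apply: measurable_funM; [exact: measurable_cst|exact: measurable_funX].
- by move=> t; apply: mulr_ge0 => //; rewrite exprn_even_ge0.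
- by move=> u t; have [] := others_upd l i u t.
- by move=> u t; have [_ -> -> -> ->] := others_upd l i u t.
- move=> t G; have [sC mC GO] := diff_le l G; have sG := stepB l GO; have mS := midB l G.
  move: (step_diff l i t) (mid_diff l i t) (step _ t l) (mid _ t l) sC mC sG mS
    => v1 v2 v3 v4 v1C v2C v3G v4S.
  have mT v v' : measurable_fun setT (fun u : T => `|dot u.1 v * dot u.1 v'|).
    by apply: measurableT_comp => //; apply: measurable_funM; exact: mdotT.
  split; first exact: measurable_funD.
  have mN v v' := measurableT_comp (mT v v') (measurable_funPT U0).
  apply: le_trans (mean_pow8D (mN v1 v4) (mN v3 v2) (dot_prod8_le v1C v4S)
    (dot_prod8_le v3G v2C)) _.
  by rewrite lee_fin /mid_dev8_const !exprMn; apply: eq_lexx; ring.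
Qed.

(** All errors of the replacement: products of linear forms, response terms after Cauchy-Schwarz,
    and the change of the mean increment. The factor 2 in the last arises because both of its
    arguments move. *)
Definition loo_dev l t : R :=
  n%:R^-1 * (\sum_i mid_dev l i t) +
  (2 * Y * Num.sqrt (n%:R^-1 * \sum_i grad_dev l i t ^+ 2) +
   lip_const kap m8 Gam Sb * (2 * C1) * (n%:R^-1 * \sum_i bdist l i t)).

Definition loo_dev8_const : R :=
  (128 * mid_dev8_const + 128 * (128 * ((2 * Y) ^+ 8 * (dot_const kap 8 * C1 ^+ 8)) +
    128 * ((lip_const kap m8 Gam Sb * (2 * C1)) ^+ 8))) * bdist8_bound.

Lemma loo_dev8_const_ge0 : 0 <= loo_dev8_const.
Proof.
have h : 0 <= dot_const kap 8 * C1 ^+ 8.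
  by apply: mulr_ge0; [exact: dot_const_ge0|exact: exprn_ge0].
have e8 (x : R) : 0 <= x ^+ 8 by rewrite exprn_even_ge0.
by apply: mulr_ge0 => //; apply: addr_ge0; apply: mulr_ge0 => //;
  apply: addr_ge0; apply: mulr_ge0 => //; exact: mulr_ge0.
Qed.

Let msqrt : measurable_fun setT (@Num.sqrt R).
Proof. by apply: continuous_measurable_fun; exact: sqrt_continuous. Qed.

Lemma measurable_loo_dev l : measurable_fun setT (loo_dev l).
Proof.
apply: measurable_funD.
  apply: measurable_funM; first exact: measurable_cst.
  exact: measurable_bigsum.
apply: measurable_funD.
  apply: measurable_funM; first exact: measurable_cst.
  apply: (measurableT_comp msqrt).
  apply: measurable_funM; first exact: measurable_cst.
  by apply: measurable_bigsum => i; exact: measurable_funX.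
apply: measurable_funM; first exact: measurable_cst.
apply: measurable_funM; first exact: measurable_cst.
exact: measurable_bigsum.
Qed.

Lemma loo_dev8 l : mean_le P (fun w => loo_dev l (sample U w) ^+ 8)
  (loo_dev8_const * ratio ^+ 4).
Proof.
have n0R : 0 < n%:R :> R by rewrite ltr0n.
have nV0 (i : 'I_n) : true -> 0 <= n%:R^-1 :> R by rewrite invr_ge0.
have s1 : \sum_(i < n) n%:R^-1 <= 1 :> R.
  by rewrite sumr_const card_ord -[leLHS]mulr_natl divff// gt_eqF.
pose MT := bdist8_bound * ratio ^+ 4.
have MT0 : 0 <= MT by apply: mulr_ge0 => //; exact: exprn_ge0.
have avg8 (F : 'I_n -> n.-tuple T -> R) M : 0 <= M ->
    (forall i, measurable_fun setT (F i)) ->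
    (forall i, mean_le P (fun w => F i (sample U w) ^+ 8) M) ->
    mean_le P (fun w => (n%:R^-1 * \sum_i F i (sample U w)) ^+ 8) M.
  move=> M0 mF FM; under [X in mean_le _ X]eq_fun do rewrite mulr_sumr.
  have := @mean_wsum8 _ _ _ P _ (index_enum 'I_n) xpredT (fun=> n%:R^-1) 1 M
    (fun i w => F i (sample U w)) nV0 s1 M0 (fun i => ms (mF i)) (fun i _ => FM i).
  by rewrite expr1n mul1r.
have CG0 : 0 <= dot_const kap 8 * C1 ^+ 8.
  by apply: mulr_ge0; [exact: dot_const_ge0|exact: exprn_ge0].
have H1 := avg8 _ _ (mulr_ge0 mid_dev8_const0 MT0) (mmid_dev l) (mid_dev8 l).
have H3 := avg8 _ _ MT0 (mbdist l) (bdist8 l).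
have H2 := @mean_wsum4 _ _ _ P _ (index_enum 'I_n) xpredT (fun=> n%:R^-1) 1 _
    (fun i w => grad_dev l i (sample U w) ^+ 2) nV0 s1 (mulr_ge0 CG0 MT0)
    (fun i => measurable_funX 2 (ms (mgrad_dev l i)))
    (fun i _ => mean_sqr_pow4 (grad_dev8 l i)).
have mavg (F : 'I_n -> n.-tuple T -> R) : (forall i, measurable_fun setT (F i)) ->
    measurable_fun setT (fun w => n%:R^-1 * \sum_i F i (sample U w)).
  move=> mF; apply: measurable_funM; first exact: measurable_cst.
  by apply: measurable_bigsum => i; exact: ms.
have mA2 := mavg _ (fun i => measurable_funX 2 (mgrad_dev l i)).
have mA3 := mavg _ (mbdist l).
have scale (c : R) (F : Omega -> R) M : measurable_fun setT F ->
    mean_le P (fun w => F w ^+ 8) M ->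
    mean_le P (fun w => (c * F w) ^+ 8) (c ^+ 8 * M).
  move=> mF FM; apply: (mean_leZ _ _ _ _ _ FM).
  - by apply: measurable_funX; apply: measurable_funM => //; exact: measurable_cst.
  - exact: measurable_funX.
  - by move=> w; rewrite exprn_even_ge0.
  - by rewrite exprn_even_ge0.
  - by move=> w; rewrite exprn_even_ge0.
  - by move=> w; rewrite exprMn.
have H2' : mean_le P (fun w => Num.sqrt
    (n%:R^-1 * \sum_i grad_dev l i (sample U w) ^+ 2) ^+ 8)
    (dot_const kap 8 * C1 ^+ 8 * MT).
  move: H2; rewrite expr1n mul1r; congr mean_le; apply/funext => w.
  rewrite -mulr_sumr (exprM _ 2 4) sqr_sqrtr//.
  apply: mulr_ge0; first by rewrite invr_ge0 ltW.
  by apply: sumr_ge0 => i _; exact: sqr_ge0.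
have mS2 := measurableT_comp msqrt mA2.
apply: le_trans (mean_pow8D (mavg _ (mmid_dev l)) _ H1
  (mean_pow8D _ _ (scale (2 * Y) _ _ mS2 H2')
    (scale (lip_const kap m8 Gam Sb * (2 * C1)) _ _ mA3 H3))) _.
- apply: measurable_funD; apply: measurable_funM => //; exact: measurable_cst.
- apply: measurable_funM => //; exact: measurable_cst.
- apply: measurable_funM => //; exact: measurable_cst.
by rewrite lee_fin /loo_dev8_const /MT; apply: eq_lexx; ring.
Qed.

Let good_sub S S' t : predI S S' =1 S -> good S' t -> good S t.
Proof. exact: good_sample_sub. Qed.

Let good_others i t : good predT t -> good (others i) t.
Proof. by apply: good_sub => j /=; rewrite andbT. Qed.

Let mean_dev_le l i t : good predT t ->
  `|mean_incr U0 (step (outside i) t l) (mid (outside i) t l) -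
    mean_incr U0 (step predT t l) (mid predT t l)| <=
  lip_const kap m8 Gam Sb * (2 * C1) * bdist l i t.
Proof.
move=> G; have OT : predI (outside i) predT =1 outside i by move=> j /=; rewrite andbT.
have GO : good (outside i) t := good_sub OT G.
have d1 := masked_grad_dist b0 n0 q0 t00 (erefl L) delta0 deltaD OT G l.
have d2 := twice_mid_dist b0 n0 q0 t00 (erefl L) delta0 deltaD OT G l.
have s1 := stepB l G; have s2 := stepB l GO; have s3 := midB l G; have s4 := midB l GO.
have -> : bdist l i t = block_dist delta b0 m i t l by rewrite /bdist GO.
have lip0 : 0 <= lip_const kap m8 Gam Sb.
  have := mean_incr_lip kap0 U0mgf U0y s1 s3 s1 s3.
  have K0 (k : nat) : 0 <= dot_const kap k by exact: dot_const_ge0.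
  move=> _; rewrite /lip_const; have := m8_ge0 U0y => m80.
  have h : 0 <= Sb ^+ 8 by exact: exprn_ge0.
  have h' : 0 <= Gam ^+ 8 by exact: exprn_ge0.
  have a1 := mulr_ge0 (K0 8) h; have a2 := mulr_ge0 (K0 8) h'.
  by move: (K0 8) m80 a1 a2; move: (dot_const kap 8) (_ * _ ^+ 8) (_ * _ ^+ 8) => ? ? ?; lra.
move: (step predT t l) (mid predT t l) (step (outside i) t l) (mid (outside i) t l)
  s1 s2 s3 s4 d1 d2 => g s g' s' gG gG' sS sS' d1 d2.
rewrite distrC; apply: le_trans (mean_incr_lip kap0 U0mgf U0y gG sS gG' sS') _.
by rewrite -!mulrA ler_wpM2l// mulr2n mulrDl mul1r lerD.
Qed.

(* The responses have eight moments only, so Cauchy-Schwarz separates them from the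
   deviations of the gradients before moments are taken. *)
Let resp_avg t (g : 'I_n -> R) : good predT t ->
  `|n%:R^-1 * \sum_i (tnth t i).2 * g i| <=
  Y * Num.sqrt (n%:R^-1 * \sum_i g i ^+ 2).
Proof.
move=> /andP[_ rY]; have n0R : 0 < n%:R :> R by rewrite ltr0n.
have nV0 (i : 'I_n) : true -> 0 <= n%:R^-1 :> R by rewrite invr_ge0.
have g0 : 0 <= n%:R^-1 * \sum_i g i ^+ 2.
  by rewrite mulr_ge0 ?invr_ge0// sumr_ge0// => i _; exact: sqr_ge0.
rewrite -ler_sqr ?nnegrE ?normr_ge0//; last by rewrite mulr_ge0 ?sqrtr_ge0.
rewrite exprMn sqr_sqrtr// real_normK ?num_real// [in leLHS]mulr_sumr.
apply: le_trans (weighted_cauchy (index_enum 'I_n) _ _ nV0) _.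
rewrite -!mulr_sumr ler_wpM2r//.
rewrite -ler_pdivlMl ?invr_gt0// invrK mulrC.
have := rY; rewrite -ler_sqr ?nnegrE ?l2norm_ge0//; last first.
  by rewrite mulr_ge0 ?sqrtr_ge0.
rewrite sqr_l2norm exprMn sqr_sqrtr ?ler0n//; apply: le_trans.
by apply: ler_sum => i _; rewrite !mxE.
Qed.

(** Each summand is split at the iterates without its block into replacement errors, noise and a
    conditional mean; the latter is compared with the mean increment at the full iterates. *)
Lemma loo_dev_bracket l t : good predT t ->
  `|n%:R^-1 * (\sum_i loss_incr (tnth t i) (step (others i) t l) (mid (others i) t l)) -
    mean_incr U0 (step predT t l) (mid predT t l)| <=
  loo_dev l t + `|n%:R^-1 * \sum_i block_noise l i t|.
Proof.
move=> G; have n0R : 0 < n%:R :> R by rewrite ltr0n.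
have nV0 : 0 <= n%:R^-1 :> R by rewrite invr_ge0.
pose muT := mean_incr U0 (step predT t l) (mid predT t l).
pose muO i := mean_incr U0 (step (outside i) t l) (mid (outside i) t l).
pose prods i := dot (tnth t i).1 (step_diff l i t) * dot (tnth t i).1 (mid (others i) t l) +
  dot (tnth t i).1 (step (outside i) t l) * dot (tnth t i).1 (mid_diff l i t).
have dec i : loss_incr (tnth t i) (step (others i) t l) (mid (others i) t l) =
    prods i - 2 * ((tnth t i).2 * grad_dev l i t) +
    (muO i + block_noise l i t).
  have GN := good_others i G; have [_ _ GO] := diff_le l GN.
  rewrite /block_noise /grad_dev GN GO -/(muO i) [X in _ = _ + X]addrC subrK /prods.
  rewrite /step_diff /mid_diff /loss_incr.
  move: (step (others i) t l) (mid (others i) t l) (step (outside i) t l)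
    (mid (outside i) t l) => g s g' s'; rewrite !dotBr.
  move: (dot _ g) (dot _ s) (dot _ g') (dot _ s') (tnth t i).2 => ? ? ? ? y; ring.
have sumE : n%:R^-1 * (\sum_i loss_incr (tnth t i) (step (others i) t l) (mid (others i) t l))
    - muT = n%:R^-1 * (\sum_i prods i) -
    2 * (n%:R^-1 * \sum_i (tnth t i).2 * grad_dev l i t) +
    n%:R^-1 * (\sum_i (muO i - muT)) +
    n%:R^-1 * \sum_i block_noise l i t.
  by under eq_bigr do rewrite dec; exact: avg_split.
rewrite sumE; apply: le_trans (ler_normD _ _) _; rewrite lerD2r.
apply: le_trans (ler_normD _ _) _; rewrite /loo_dev addrA; apply: lerD; last first.
  rewrite normrM (ger0_norm nV0) mulrCA ler_wpM2l//.
  apply: le_trans (ler_norm_sum _ _ _) _; rewrite mulr_sumr.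
  by apply: ler_sum => i _; exact: mean_dev_le.
apply: le_trans (ler_normB _ _) _; apply: lerD.
  rewrite normrM (ger0_norm nV0) ler_wpM2l//.
  apply: le_trans (ler_norm_sum _ _ _) _.
  apply: ler_sum => i _; rewrite /mid_dev (good_others i G); exact: ler_normD.
by rewrite normrM ger0_norm// -mulrA ler_wpM2l// resp_avg.
Qed.

Definition loo_gap k t : R :=
  n%:R^-1 * (\sum_i sq_loss (tnth t i).1 (tnth t i).2 (iter (others i) t k)) -
  pop_risk U0 (iter predT t k).

Let bracket k t : R :=
  n%:R^-1 * (\sum_i loss_incr (tnth t i) (step (others i) t k) (mid (others i) t k)) -
  mean_incr U0 (step predT t k) (mid predT t k).

Let midE S t k : mid S t k = iter S t k + (iter S t k + delta k *: step S t k).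
Proof. by rewrite /twice_mid masked_gdS. Qed.

Let loo_gapS k t : loo_gap k.+1 t = loo_gap k t + delta k * bracket k t.
Proof.
rewrite /loo_gap /bracket masked_gdS (pop_risk_incr kap0 U0mgf U0y) -midE.
under eq_bigr do rewrite masked_gdS sq_loss_incr -midE.
rewrite big_split /= -mulr_sumr; ring.
Qed.

Let noise l t : R := n%:R^-1 * \sum_i block_noise l i t.
Let dev l t : R := loo_dev l t.

Let loo_gap_le k t : good predT t ->
  `|loo_gap k t| <= `|loo_gap 0 t| + (\sum_(l < k) delta l * `|dev l t| +
    \sum_(l < k) delta l * `|noise l t|).
Proof.
move=> G; elim: k => [|k IH]; first by rewrite !big_ord0 !addr0.
rewrite loo_gapS; apply: le_trans (ler_normD _ _) _.
rewrite normrM (ger0_norm (delta0 k)) !big_ord_recr /= addrACA [leRHS]addrA.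
apply: lerD; first exact: IH.
rewrite -mulrDr ler_wpM2l//.
apply: le_trans (loo_dev_bracket k G) _.
by rewrite lerD2r ler_norm.
Qed.

Let gap0 t : R := n%:R^-1 * \sum_i
  (sq_loss (tnth t i).1 (tnth t i).2 b0 - pop_risk U0 b0).

Let gap0E t : loo_gap 0 t = gap0 t.
Proof.
have n0R : n%:R != 0 :> R by rewrite pnatr_eq0 -lt0n.
rewrite /loo_gap /gap0 /masked_gd /= sumrB sumr_const card_ord.
by rewrite -(mulr_natl (pop_risk _ _)) mulrBr mulKf.
Qed.

Let dev_sum (K : nat) t : R := \sum_(l < K) delta l * `|dev l t|.
Let noise_sum (K : nat) t : R := \sum_(l < K) delta l * `|noise l t|.

Let mloss (v : 'cV[R]_q) : measurable_fun setT (fun u : T => sq_loss u.1 u.2 v).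
Proof. by apply: measurable_funX; apply: measurable_funB => //; exact: mdotT. Qed.

Let mgap0 : measurable_fun setT gap0.
Proof.
apply: measurable_funM; first exact: measurable_cst.
apply: measurable_bigsum => i; apply: measurable_funB; last exact: measurable_cst.
by apply: measurableT_comp (mloss b0) _; exact: measurable_tnth.
Qed.

Let mdev l : measurable_fun setT (dev l).
Proof. exact: measurable_loo_dev. Qed.

Let mnoise l : measurable_fun setT (noise l).
Proof.
apply: measurable_funM; first exact: measurable_cst.
by apply: measurable_bigsum => i; exact: measurable_block_noise.
Qed.

Let mwsum (F : nat -> n.-tuple T -> R) K : (forall l, measurable_fun setT (F l)) ->
  measurable_fun setT (fun t => \sum_(l < K) delta l * `|F l t|).
Proof.
move=> mF; apply: measurable_bigsum => l; apply: measurable_funM.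
  exact: measurable_cst.
exact: measurableT_comp (mF l).
Qed.

Let dev_sum8 K : mean_le P (fun w => `|dev_sum K (sample U w)| ^+ 8)
  (D ^+ 8 * (loo_dev8_const * ratio ^+ 4)).
Proof.
have H l : mean_le P (fun w => `|dev l (sample U w)| ^+ 8)
    (loo_dev8_const * ratio ^+ 4).
  under [X in mean_le _ X]eq_fun do rewrite (norm_even_pow _ (k := 8))//.
  exact: loo_dev8.
have M0 : 0 <= loo_dev8_const * ratio ^+ 4.
  by rewrite -lee_fin; apply: le_trans (H 0%N); apply: mean_ge0 => w; rewrite exprn_ge0.
under [X in mean_le _ X]eq_fun do rewrite (norm_even_pow _ (k := 8))//.
apply: (@mean_wsum8 _ _ _ P _ (index_enum 'I_K) xpredT (fun l => delta l) D _
  (fun l w => `|dev l (sample U w)|)) => //.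
- exact: (deltaD K).
- move=> l; exact: measurableT_comp (ms (mdev l)).
Qed.

Let noise_const := 304 * expR 1 * centered4_bound kap m8 Gam Sb / m%:R ^+ 2.

Let noise_sum4 K : mean_le P (fun w => `|noise_sum K (sample U w)| ^+ 4)
  (D ^+ 4 * noise_const).
Proof.
have H l : mean_le P (fun w => `|noise l (sample U w)| ^+ 4) noise_const.
  under [X in mean_le _ X]eq_fun do rewrite (norm_even_pow _ (k := 4))//.
  exact: mean_noise_avg.
have M0 : 0 <= noise_const.
  by rewrite -lee_fin; apply: le_trans (H 0%N); apply: mean_ge0 => w; rewrite exprn_ge0.
under [X in mean_le _ X]eq_fun do rewrite (norm_even_pow _ (k := 4))//.
apply: (@mean_wsum4 _ _ _ P _ (index_enum 'I_K) xpredT (fun l => delta l) D _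
  (fun l w => `|noise l (sample U w)|)) => //.
- exact: (deltaD K).
- move=> l; exact: measurableT_comp (ms (mnoise l)).
Qed.

Let gap04 : mean_le P (fun w => `|gap0 (sample U w)| ^+ 4)
  (304 * expR 1 * centered_loss4_bound kap m8 B0 / m%:R ^+ 2).
Proof.
under [X in mean_le _ X]eq_fun do rewrite (norm_even_pow _ (k := 4))//.
exact: mean_loss_avg.
Qed.

(** In order: failure of the good event, initial gap, replacement errors, noise. The last three are
    Markov bounds at level [e]; the 8 comes from [2 expR (- n) <= 8 / m ^ 2]. *)
Definition loo_gap_const (e : R) : R :=
  (8 + 304 * expR 1 * centered_loss4_bound kap m8 0) +
  (304 * expR 1 * centered_loss4_bound kap m8 B0 / e ^+ 4 +
   (D ^+ 8 * loo_dev8_const / e ^+ 8 +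
    D ^+ 4 * (304 * expR 1 * centered4_bound kap m8 Gam Sb) / e ^+ 4)).

(** Squaring [n / 2 <= expR (n / 2)] gives [n ^ 2 / 4 <= expR n], and [m <= n]. *)
Let expRN_le : expR (- n%:R) <= 4 * m%:R^-2 :> R.
Proof.
have m0R : 0 < m%:R :> R by rewrite ltr0n.
have n0R : 0 < n%:R :> R by rewrite ltr0n.
rewrite expRN -[4 * _]invrK lef_pV2 ?posrE ?expR_gt0 ?invr_gt0 ?mulr_gt0 ?invr_gt0 ?exprn_gt0//.
rewrite invfM invrK.
have -> : expR n%:R = expR (n%:R / 2) ^+ 2 :> R.
  by rewrite -expRM_natl; congr expR; rewrite mulrC divfK.
have h : n%:R / 2 <= expR (n%:R / 2) :> R.
  by apply: le_trans (expR_ge1Dx _); rewrite lerDr.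
have mnR : m%:R <= n%:R :> R by rewrite ler_nat.
apply: (@le_trans _ _ ((n%:R / 2) ^+ 2)); last first.
  by rewrite lerXn2r ?nnegrE ?expR_ge0// divr_ge0.
rewrite exprMn mulrC; apply: ler_pM => //; rewrite ?exprn_ge0 ?invr_ge0//.
  by rewrite lerXn2r// nnegrE.
by lra.
Qed.

Let le_const (c0 c2 c3 c4 d4 d8 i4 i8 x r E : R) : 0 <= c0 -> 0 <= c2 * i4 ->
  0 <= d8 * c3 * i8 -> 0 <= d4 * c4 * i4 -> 0 <= x -> 0 <= r -> E <= 4 * x ->
  2 * E + c0 * x + (c2 * x * i4 + (d8 * (c3 * r) * i8 + d4 * (c4 * x) * i4)) <=
  (8 + c0 + (c2 * i4 + (d8 * c3 * i8 + d4 * c4 * i4))) * (x + r).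
Proof.
move=> h1 h2 h3 h4 x0 r0 Ex.
have := mulr_ge0 h1 r0; have := mulr_ge0 h2 r0; have := mulr_ge0 h3 x0.
by have := mulr_ge0 h4 r0; lra.
Qed.

(** The weighted sums have nonnegative terms, so those up to [k] are dominated by those up to [K]
    and one exceptional set serves all [k]. The three [e] are for the initial gap, the replacement
    errors and the noise. *)
Lemma loo_gap_prob K e : 0 < e -> exists2 B : set Omega,
  measurable B /\ (P B <= (loo_gap_const e * (m%:R^-2 + ratio ^+ 4))%:E)%E &
  forall w, ~ B w -> forall k, (k <= K)%N -> `|loo_gap k (sample U w)| < 3 * e.
Proof.
move=> e0.
pose B1 := [set w | ~~ good predT (sample U w)].
pose B2 := [set w | e <= `|gap0 (sample U w)|].
pose B3 := [set w | e <= `|dev_sum K (sample U w)|].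
pose B4 := [set w | e <= `|noise_sum K (sample U w)|].
have mB (F : n.-tuple T -> R) : measurable_fun setT F -> measurable [set w | e <= `|F (sample U w)|].
  move=> mF; rewrite -[X in measurable X]setTI.
  exact: (measurable_fun_ler (measurable_cst e)
    (measurableT_comp (@normr_measurable _ setT) (ms mF))) _ _.
have mB1 : measurable B1.
  have mG : measurable_fun setT (fun w => ~~ good predT (sample U w)).
    by apply: measurable_neg; exact: measurableT_comp (mgood _) (measurable_sample U).
  by rewrite -[X in measurable X]setTI; exact: mG measurableT [set true] _.
have mB2 : measurable B2 by exact: mB.
have mB3 : measurable B3 by apply: mB; exact: mwsum.
have mB4 : measurable B4 by apply: mB; exact: mwsum.
exists (B1 `|` (B2 `|` (B3 `|` B4))).
  split; first by do 3 ?apply: measurableU.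
  have P1 := good_fail_prob.
  have P2 := markov_pow (ms mgap0) e0 gap04.
  have P3 := markov_pow (ms (mwsum K mdev)) e0 (dev_sum8 K).
  have P4 := markov_pow (ms (mwsum K mnoise)) e0 (noise_sum4 K).
  apply: le_trans (measureU2 _ mB1 (measurableU _ _ mB2 (measurableU _ _ mB3 mB4))) _.
  apply: le_trans (leeD P1 (le_trans (measureU2 _ mB2 (measurableU _ _ mB3 mB4))
    (leeD P2 (le_trans (measureU2 _ mB3 mB4) (leeD P3 P4))))) _.
  rewrite -!EFinD lee_fin; rewrite /noise_const /loo_gap_const; set a1 := 304 * expR 1 * centered_loss4_bound kap m8 0.
  have e4 : 0 <= e ^+ 4 by rewrite exprn_ge0// ltW.
  have e8 : 0 <= e ^+ 8 by rewrite exprn_ge0// ltW.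
  have x0 : 0 <= m%:R^-2 :> R by rewrite invr_ge0 exprn_ge0.
  have r0 : 0 <= ratio ^+ 4 by exact: exprn_ge0.
  have E0 : 0 <= expR 1 :> R := expR_ge0 1.
  have M0 := m8_ge0 U0y.
  have B00 : 0 <= B0 := le_trans (l2norm_ge0 b0) b0B0.
  have cl0 B : 0 <= B -> 0 <= centered_loss4_bound kap m8 B.
    move=> hB; have r8 : 0 <= resid8_bound kap m8 B.
      apply: addr_ge0; apply: mulr_ge0 => //; apply: mulr_ge0; last exact: exprn_ge0.
      exact: dot_const_ge0.
    exact: centered_bound_ge0.
  have K304 c : 0 <= c -> 0 <= 304 * expR 1 * c :> R.
    by move=> c0; apply: mulr_ge0 => //; apply: mulr_ge0.
  have h1 : 0 <= a1 by apply: K304; exact: cl0.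
  have h2 : 0 <= 304 * expR 1 * centered_loss4_bound kap m8 B0 / e ^+ 4.
    by apply: divr_ge0 => //; apply: K304; exact: cl0.
  have h3 : 0 <= D ^+ 8 * loo_dev8_const / e ^+ 8.
    apply: divr_ge0 => //; apply: mulr_ge0; first exact: exprn_ge0.
    exact: loo_dev8_const_ge0.
  have h4 : 0 <= D ^+ 4 * (304 * expR 1 * centered4_bound kap m8 Gam Sb) / e ^+ 4.
    apply: divr_ge0 => //; apply: mulr_ge0; first exact: exprn_ge0.
    apply: K304.
    have g0 := Gam_ge0.
    have s0 : 0 <= Sb by apply: mulr_ge0 => //; exact: Bb_ge0.
    exact/centered_bound_ge0/(incr4_bound_ge0 kap U0y g0 s0).
  exact: le_const h1 h2 h3 h4 x0 r0 expRN_le.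
move=> w nB k kK.
have G : good predT (sample U w) by apply/negPn/negP => H; apply: nB; left.
have H2 : `|gap0 (sample U w)| < e.
  by rewrite ltNge; apply/negP => H; apply: nB; right; left.
have H3 : `|dev_sum K (sample U w)| < e.
  by rewrite ltNge; apply/negP => H; apply: nB; right; right; left.
have H4 : `|noise_sum K (sample U w)| < e.
  by rewrite ltNge; apply/negP => H; apply: nB; right; right; right.
have mono (F : nat -> R) : \sum_(l < k) delta l * `|F l| <= \sum_(l < K) delta l * `|F l|.
  rewrite (big_ord_widen _ (fun l : nat => delta l * `|F l|) kK) big_mkcond /=.
  by apply: ler_sum => l _; case: ifP => // _; rewrite mulr_ge0.
have h3 := mono (dev^~ (sample U w)); have h4 := mono (noise^~ (sample U w)).
have := loo_gap_le k G; rewrite gap0E.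
have := le_lt_trans (ler_norm _) H3; have := le_lt_trans (ler_norm _) H4.
move: h3 h4 H2; rewrite -/(dev_sum K _) -/(noise_sum K _).
move: (dev_sum _ _) (noise_sum _ _) (gap0 _) (loo_gap _ _) (\sum_(l < k) _) (\sum_(l < k) _) => *.
lra.
Qed.

End LeaveOneOut.

(** * Conditional risk *)

Section ConditionalExpectation.
Context (R : realType) (d d1 d2 : measure_display) (Omega : measurableType d).
Context (T1 : measurableType d1) (T2 : measurableType d2).
Variables (P : probability Omega R) (V : {RV P >-> T1}) (D : {RV P >-> T2}).

Lemma ae_eq_le_integral (A : set Omega) (f g : Omega -> R) : measurable A ->
  P.-integrable setT (EFin \o f) -> P.-integrable setT (EFin \o g) ->
  (\int[P]_(w in A) (f w)%:E = \int[P]_(w in A) (g w)%:E)%E ->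
  (forall w, A w -> f w <= g w) -> {ae P, forall w, A w -> f w = g w}.
Proof.
move=> mA fi gi fg fleg.
have fA : P.-integrable A (EFin \o f) by apply: integrableS fi.
have gA : P.-integrable A (EFin \o g) by apply: integrableS gi.
have mgf : measurable_fun A (fun w => (g w - f w)%:E).
  apply/measurable_EFinP; apply: measurable_funB.
    by apply/measurable_EFinP; exact: measurable_int gA.
  by apply/measurable_EFinP; exact: measurable_int fA.
have /(ae_eq_integral_abs P mA mgf) H : (\int[P]_(w in A) `|(g w - f w)%:E| = 0)%E.
  transitivity (\int[P]_(w in A) (g w - f w)%:E)%E.
    apply: eq_integral => w; rewrite inE => Aw.
    by rewrite gee0_abs// lee_fin subr_ge0 fleg.
  rewrite (integralB_EFin mA gA fA) fg subee//.
  exact: integrable_fin_num.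
apply: filterS H => w /= H Aw; have := H Aw; case => /eqP.
by rewrite subr_eq0 => /eqP.
Qed.

(** Under independence, freezing the second argument and averaging over the first gives a version of
    the conditional expectation. Versions agree almost surely, by testing on the two sets where one
    is at most the other. *)
Lemma cond_expectation_indep (F : T1 * T2 -> R) (G : T2 -> R) (C : Omega -> R) :
  independent P V D -> measurable_fun setT F -> (forall u, 0 <= F u) ->
  measurable_fun setT G ->
  (forall t, mean P (fun w => F (V w, t)) = (G t)%:E) ->
  is_cond_expectation P D (fun w => F (V w, D w)) C ->
  {ae P, forall w, C w = G (D w)}.
Proof.
move=> indep mF F0 mG FG [mC Ci CE].
have G0 t : 0 <= G t by rewrite -lee_fin -FG; exact: mean_ge0.
have mGD : measurable_fun setT (G \o D) by exact: measurableT_comp mG (measurable_funPT D).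
have CG A : g_sigma_algebra_preimage D A ->
    (\int[P]_(w in A) (C w)%:E = \int[P]_(w in A) (G (D w))%:E)%E.
  move=> sA; rewrite (CE _ sA); case: sA => B mB <-; rewrite setTI.
  rewrite [LHS]integral_mkcond [RHS]integral_mkcond.
  pose F' (u : T1 * T2) : \bar R := (\1_B u.2 * F u)%:E.
  have mF' : measurable_fun setT F'.
    apply/measurable_EFinP; apply: measurable_funM => //.
    exact: (measurableT_comp (measurable_indic mB) measurable_snd).
  have F'0 u : (0 <= F' u)%E by rewrite lee_fin mulr_ge0.
  transitivity (\int[P]_w F' (V w, D w))%E.
    apply: eq_integral => w _; rewrite patchE /F' indicE /=.
    rewrite (_ : (w \in _) = (D w \in B)); last by apply/idP/idP; rewrite !inE.
    by case: ifP => _; rewrite ?mul1r ?mul0r.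
  rewrite (independent_tonelli indep mF' F'0); apply: eq_integral => w _.
  rewrite patchE (_ : (w \in _) = (D w \in B)); last by apply/idP/idP; rewrite !inE.
  rewrite /F' /= indicE; case: ifP => _ /=.
    rewrite -FG; apply: eq_integral => w' _; by rewrite mul1r.
  by apply: integral0_eq => w' _; rewrite mul0r.
have GDi : P.-integrable setT (EFin \o (G \o D)).
  apply/integrableP; split; first exact/measurable_EFinP.
  rewrite (eq_integral (fun w => (G (D w))%:E)); last first.
    by move=> w _; rewrite /= ger0_norm.
  rewrite -(CG setT); last by exists setT => //; rewrite preimage_setT setTI.
  rewrite ltey_eq; apply/orP; left; exact: integrable_fin_num.
(* Measurability is read in the sigma-algebra generated by [D], since only its sets may be used for
   testing. *)
pose T' := g_sigma_algebra_preimageType D.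
have mC' : measurable_fun setT (C : T' -> R).
  by move=> _ B mB; rewrite setTI; exact: mC.
have mG' : measurable_fun setT (G \o D : T' -> R).
  move=> _ B mB; rewrite setTI; exists (G @^-1` B); last by rewrite setTI.
  by rewrite -[X in measurable X]setTI; exact: mG.
have le1 : g_sigma_algebra_preimage D [set w | C w <= G (D w)].
  have := measurable_fun_ler mC' mG'.
  by move=> /(_ measurableT [set true] I); rewrite setTI.
have le2 : g_sigma_algebra_preimage D [set w | G (D w) <= C w].
  have := measurable_fun_ler mG' mC'.
  by move=> /(_ measurableT [set true] I); rewrite setTI.
have meas A : g_sigma_algebra_preimage D A -> measurable A.
  by case=> B mB <-; exact: measurable_funPT.
have H1 := ae_eq_le_integral (meas _ le1) Ci GDi (CG _ le1) (fun w h => h).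
have H2 := ae_eq_le_integral (meas _ le2) GDi Ci (esym (CG _ le2)) (fun w h => h).
apply: filterS2 H1 H2 => w /= h1 h2.
by have [h|h] := leP (C w) (G (D w)); [exact: h1|rewrite h2// ltW].
Qed.

End ConditionalExpectation.

(** * Features and responses *)

Section LipschitzMeasurable.
Context (R : realType) (q : nat).
Implicit Types (x : 'cV[R]_q) (r : 'cV[rat]_q).

Let rat_point r : 'cV[R]_q := map_mx ratr r.

Let rat_point_dense x e : 0 < e -> exists r, l2norm (x - rat_point r) < e.
Proof.
(* Entrywise precision [e / (q + 1)] gives [q h ^ 2 < (q + 1) ^ 2 h ^ 2], strictly also for
   [q = 0]. *)
move=> e0; have [h h0 eE] : exists2 h, 0 < h & e = q.+1%:R * h.
  by exists (e / q.+1%:R); [rewrite divr_gt0|rewrite mulrC divfK].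
have /choice[r rP] : forall i : 'I_q, exists a : rat, `|x i 0 - ratr a| <= h.
  move=> i; have /rat_in_itvoo[a] : x i 0 < x i 0 + h by rewrite ltrDl.
  rewrite in_itv /= => /andP[a1 a2]; exists a.
  rewrite distrC ger0_norm ?subr_ge0 ?(ltW a1)//.
  by rewrite lerBlDl ltW.
exists (\col_i r i).
rewrite -ltr_sqr ?nnegrE ?l2norm_ge0 ?(ltW e0)// sqr_l2norm.
apply: (@le_lt_trans _ _ (\sum_(i < q) h ^+ 2)).
  apply: ler_sum => i _; rewrite !mxE -real_normK ?num_real//.
  by rewrite lerXn2r ?nnegrE// ltW.
rewrite sumr_const card_ord -[_ *+ q]mulr_natl.
rewrite eE exprMn ltr_pM2r ?exprn_gt0// -natrX ltr_nat.
by rewrite -mulnn (leq_trans (ltnSn q))// leq_pmulr.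
Qed.

(* [f x < c] iff [f r + l2norm (x - r) < c] for some rational [r]. *)
Lemma measurable_lipschitz (f : 'cV[R]_q -> R) : l2_lipschitz 1 f ->
  measurable_fun setT (f : borel_mx R q 1 -> measurableTypeR R).
Proof.
move=> fL.
pose rp k : 'cV[R]_q := rat_point (odflt 0 (unpickle k)).
pose g k (x : borel_mx R q 1) := f (rp k) + l2norm ((x : 'cV[R]_q) - rp k).
have mg k : measurable_fun setT (g k).
  apply: measurable_funD; first exact: measurable_cst.
  apply: measurable_l2norm; apply: measurable_mxB; last exact: measurable_mx_cst.
  exact: measurable_entry.
move=> _; apply: (measurability _ (RGenInftyO.measurableE R)) => // _ [_ [c ->] <-].
rewrite setTI (_ : _ @^-1` _ = \bigcup_k (g k @^-1` `]-oo, c[%classic)).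
  apply: bigcupT_measurable => k; rewrite -[X in measurable X]setTI; exact: mg.
apply/seteqP; split => x /=; rewrite in_itv /=.
  move=> fxc; have h : 0 < (c - f x) / 2 by rewrite divr_gt0// subr_gt0.
  have [r rx] := rat_point_dense x h.
  exists (pickle r) => //=; rewrite in_itv /= /g /rp pickleK /=.
  have := fL (rat_point r) x; rewrite mul1r -l2normN opprB => /(le_trans (ler_norm _)).
  by move: (l2norm _) rx => D; lra.
case=> k _ /=; rewrite in_itv /= /g; have := fL x (rp k).
rewrite mul1r => /(le_trans (ler_norm _)).
by move: (l2norm _) => D; lra.
Qed.

End LipschitzMeasurable.

Lemma has_law_mean (R : realType) (d d' : measure_display) (Omega : measurableType d)
    (T : measurableType d') (P : probability Omega R) (mu : probability T R)
    (Z : {RV P >-> T}) (F : T -> R) :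
  has_law P Z mu -> measurable_fun setT F -> (forall t, 0 <= F t) ->
  mean P (fun w => F (Z w)) = mean mu F.
Proof.
move=> lawZ mF F0.
have mF' : measurable_fun setT (EFin \o F) by exact/measurable_EFinP.
have F0' t : (0 <= (EFin \o F) t)%E by rewrite lee_fin.
rewrite /mean -(ge0_integral_distribution Z mF' F0').
by apply: eq_measure_integral => A mA _; exact: lawZ.
Qed.

Section OperatorNorm.
Context (R : realType).

(** [opnorm] is a real supremum, which bounds its set only once that set is known to be bounded. *)
Lemma l2norm_mulmx_bounded m n (A : 'M[R]_(m, n)) :
  exists C, forall v, l2norm v <= 1 -> l2norm (A *m v) <= C.
Proof.
exists (Num.sqrt (\sum_i l2norm (row i A)^T ^+ 2)) => v v1.
rewrite ler_wsqrtr//; apply: ler_sum => i _.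
have -> : (A *m v) i 0 = dot (row i A)^T v.
  by rewrite mxE dotE; apply: eq_bigr => j _; rewrite !mxE.
rewrite -real_normK ?num_real// lerXn2r ?nnegrE ?l2norm_ge0//.
by apply: le_trans (dot_le _ _) _; rewrite ler_piMr ?l2norm_ge0.
Qed.

Lemma l2norm_mulmx m n (A : 'M[R]_(m, n)) v :
  l2norm (A *m v) <= opnorm A * l2norm v.
Proof.
have [u vE u1] := l2norm_normalize v.
have [C AC] := l2norm_mulmx_bounded A.
rewrite {1}vE -scalemxAr l2normZ ger0_norm ?l2norm_ge0// mulrC.
rewrite ler_wpM2r ?l2norm_ge0//; apply: ub_le_sup.
  by exists C => _ [w /= w1 <-]; exact: AC.
by exists u.
Qed.

Lemma opnorm_ge0 m n (A : 'M[R]_(m, n)) : 0 <= opnorm A.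
Proof.
have [C AC] := l2norm_mulmx_bounded A.
apply: ub_le_sup; first by exists C => _ [w /= w1 <-]; exact: AC.
by exists 0; rewrite /= ?mulmx0 ?l2norm0.
Qed.

(** By symmetry of [S], the left side is the quadratic form of [A] at [v]. *)
Lemma sqr_l2norm_psd_sqrt m (S A : 'M[R]_m) v : is_psd_sqrt S A ->
  l2norm (S *m v) ^+ 2 <= opnorm A * l2norm v ^+ 2.
Proof.
move=> [[ST _] SS]; rewrite -dotvv dot_adj ST mulmxA SS dotC.
apply: le_trans (ler_norm _) _; apply: le_trans (dot_le _ _) _.
rewrite expr2 mulrCA ler_wpM2l ?l2norm_ge0//; exact: l2norm_mulmx.
Qed.

End OperatorNorm.

(** * Exponential moments of the features *)

Section Features.
Context (R : realType) (d : measure_display) (Omega : measurableType d).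
Variables (P : probability Omega R) (p : nat).
Variables (S A : 'M[R]_p) (z : 'I_p -> {RV P >-> measurableTypeR R}).
Variables (mu : probability (measurableTypeR R) R) (sigma_z sigma_A : R).
Hypothesis SA : is_psd_sqrt S A.
Hypothesis A_le : opnorm A <= sigma_A.
Hypothesis indepz : independent_family P z.
Hypothesis lawz : forall j, has_law P (z j) mu.
Hypothesis mu0 : ('E_mu[id] = 0)%E.
Hypothesis mu1 : ('V_mu[id] = 1)%E.
Hypothesis muT2 : T2_inequality mu sigma_z.

Definition feature w : 'cV[R]_(p + 1) := col_mx (S *m \col_j z j w) (const_mx 1).

Lemma measurable_feature : measurable_mx feature.
Proof.
move=> i k; rewrite /feature; under eq_fun do rewrite mxE.
case: (fintype.split i) => j /=; last by under eq_fun do rewrite mxE; exact: measurable_cst.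
under eq_fun do rewrite mxE; apply: measurable_sum => l.
apply: measurable_funM; first exact: measurable_cst.
by under eq_fun do rewrite mxE; exact: (measurable_funPT (z l)).
Qed.

Let sigma_A0 : 0 <= sigma_A. Proof. exact: le_trans (opnorm_ge0 A) A_le. Qed.

(** The intercept contributes [v2 <= l2norm v], the linear term of the exponent. The rest is a
    product over the independent coordinates of [z], with coefficients [S *m v1] of squared norm at
    most [sigma_A * l2norm v ^ 2]. *)
Lemma feature_mgf v : mean_le P (fun w => expR (dot (feature w) v))
  (expR ((1 + sigma_z ^+ 2 * sigma_A / 2) * (l2norm v + l2norm v ^+ 2))).
Proof.
pose v1 := usubmx v; pose v2 := dsubmx v 0 0.
pose a := S *m v1.
have dotE' w : dot (feature w) v = \sum_j a j 0 * z j w + v2.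
  rewrite dotE big_split_ord /= big_ord1; congr (_ + _); last first.
    by rewrite /v2 /feature col_mxEd !mxE mul1r.
  transitivity (dot (S *m \col_j z j w) v1).
    by rewrite dotE; apply: eq_bigr => j _; rewrite col_mxEu !mxE.
  have ST : S^T = S by case: SA => [[]].
  rewrite dotC dot_adj ST dotE; apply: eq_bigr => j _.
  by rewrite !mxE.
have sqr_v : l2norm v ^+ 2 = l2norm v1 ^+ 2 + v2 ^+ 2.
  rewrite !sqr_l2norm big_split_ord /= big_ord1; congr (_ + _).
    by apply: eq_bigr => j _; rewrite mxE.
  by rewrite /v2 mxE.
have v10 : 0 <= l2norm v1 ^+ 2 := sqr_ge0 _.
have v2le : v2 <= l2norm v.
  apply: le_trans (ler_norm _) _.
  rewrite -ler_sqr ?nnegrE ?l2norm_ge0// real_normK ?num_real// sqr_v.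
  by rewrite lerDr.
have a_le : l2norm a ^+ 2 <= sigma_A * l2norm v ^+ 2.
  apply: le_trans (sqr_l2norm_psd_sqrt _ SA) _.
  apply: ler_pM => //; first exact: opnorm_ge0.
  by rewrite sqr_v lerDl sqr_ge0.
have mexp (c : R) : measurable_fun setT (fun t : measurableTypeR R => expR (c * (t : R))).
  by apply: measurableT_comp => //; apply: measurable_funM => //; exact: measurable_cst.
have H : mean_le P (fun w => \prod_j expR (a j 0 * z j w))
    (\prod_j expR (a j 0 ^+ 2 * sigma_z ^+ 2 / 2)).
  apply: (mean_le_prod indepz (f := fun j (t : measurableTypeR R) => expR (a j 0 * (t : R)))
    (c := fun j => expR (a j 0 ^+ 2 * sigma_z ^+ 2 / 2))).
  - by move=> j; exact: mexp.
  - by move=> j u; exact: expR_ge0.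
  - by move=> j; exact: expR_ge0.
  - move=> j; rewrite /mean_le.
    rewrite (has_law_mean (lawz j) (mexp (a j 0))); last by move=> t; exact: expR_ge0.
    exact: T2_mgf.
have -> : (fun w => expR (dot (feature w) v)) =
    (fun w => expR v2 * \prod_j expR (a j 0 * z j w)).
  by apply/funext => w; rewrite dotE' expRD mulrC expR_sum.
have mprod : measurable_fun setT (fun w => \prod_j expR (a j 0 * z j w)).
  apply: measurable_prod => j _.
  exact: (measurableT_comp (mexp (a j 0)) (measurable_funPT (z j))).
have prod0 w : 0 <= \prod_j expR (a j 0 * z j w).
  by apply: prodr_ge0 => j _; exact: expR_ge0.
apply: le_trans (mean_leZ _ mprod _ (expR_ge0 v2) prod0 H (fun w => lexx _)) _.
- by apply: measurable_funM => //; exact: measurable_cst.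
- by move=> w; rewrite mulr_ge0// expR_ge0.
rewrite lee_fin -expR_sum -expRD ler_expR -!mulr_suml -sqr_l2norm.
have s0 : 0 <= sigma_z ^+ 2 / 2 by rewrite divr_ge0// sqr_ge0.
have h1 := ler_wpM2r s0 a_le; have h2 := l2norm_ge0 v.
have h3 := mulr_ge0 (mulr_ge0 s0 sigma_A0) h2.
have h4 := sqr_ge0 (l2norm v).
move: (l2norm v) (l2norm a) (sigma_z ^+ 2) h1 h2 h3 h4 v2le => x y s; lra.
Qed.

End Features.

(** * Almost sure convergence *)

Section BorelCantelli.
Context (R : realType) (d : measure_display) (Omega : measurableType d).
Variables (P : probability Omega R).

(** A telescoping majorant replaces a convergent series: the partial sums stay below [a 0]. *)
Lemma borel_cantelli_telescope (B : nat -> set Omega) (a : nat -> R) :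
  (forall n, measurable (B n)) -> (forall n, 0 <= a n) ->
  (forall n, (P (B n) <= (a n - a n.+1)%:E)%E) ->
  {ae P, forall w, \forall n \near \oo, ~ B n w}.
Proof.
move=> mB a0 Ba.
have fin : (\sum_(0 <= n <oo) P (B n) < +oo)%E.
  apply: le_lt_trans (ltry (a 0%N)); apply: lime_le.
    by apply: is_cvg_nneseries => n _ _; exact: measure_ge0.
  near=> N.
  apply: (@le_trans _ _ (\sum_(0 <= n < N) (a n - a n.+1)%:E)%E).
    by apply: lee_sum => n _; exact: Ba.
  rewrite sumEFin lee_fin.
  under eq_bigr do rewrite -opprB.
  by rewrite sumrN telescope_sumr// opprB lerBlDr lerDl.
have L0 := lim_sup_set_cvg0 mB fin.
exists (lim_sup_set B); split => //.
  apply: bigcap_measurable => // k _; apply: bigcup_measurable => n _; exact: mB.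
move=> w /= H k _; apply/not_notP => nB; apply: H; exists k => // n /= kn Bn.
by apply: nB; exists n.
Unshelve. all: by end_near. Qed.

Let b n : R := n%:R `^ 3^-1.

Let b3 n : b n ^+ 3 = n%:R.
Proof. by rewrite -powR_mulrn ?powR_ge0// -powRrM mulVf ?pnatr_eq0// powRr1. Qed.

Let b_ge1 n : (0 < n)%N -> 1 <= b n.
Proof.
move=> n0; rewrite leNgt; apply/negP => bn.
have : b n ^+ 3 < 1 by rewrite exprn_ilt1// powR_ge0.
by rewrite b3 ltNge ler1n n0.
Qed.

Let block n := Num.truncn (b n ^+ 2).

(** The block length is at least [b ^ 2 / 2], whence [4 / b ^ 4], and at most [b ^ 2], so that its
    ratio to [n = b ^ 3] is at most [1 / b]. *)
Let block_bounds n : (0 < n)%N -> [/\ (0 < block n)%N, (block n <= n)%N &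
  (block n)%:R^-2 + ((block n)%:R / n%:R) ^+ 4 <= 5 * b n ^- 4 :> R].
Proof.
move=> n0; have b1 := b_ge1 n0; have b0 : 0 < b n := lt_le_trans ltr01 b1.
have b21 : 1 <= b n ^+ 2 by rewrite exprn_ege1.
have b20 : 0 <= b n ^+ 2 := le_trans ler01 b21.
have m0 : (0 < block n)%N by rewrite truncn_gt0.
have /andP[m1 m2] := truncn_itv b20; rewrite -/(block n) in m1 m2.
have mn : (block n <= n)%N.
  rewrite -(ler_nat R) -(b3 n); apply: le_trans m1 _.
  by rewrite ler_weXn2l.
have m0R : 0 < (block n)%:R :> R by rewrite ltr0n.
have m1R : 1 <= (block n)%:R :> R by rewrite ler1n.
have n0R : 0 < n%:R :> R by rewrite ltr0n.
split => //.
have h1 : (block n)%:R^-2 <= 4 * b n ^- 4.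
  rewrite -[4]invrK -invfM lef_pV2 ?posrE ?exprn_gt0 ?mulr_gt0 ?invr_gt0 ?exprn_gt0//.
  have : b n ^+ 2 <= 2 * (block n)%:R.
    by move: m2 m1R; rewrite -[X in _ < X -> _]natr1; move: (b n ^+ 2) (_%:R : R) => ? ?; lra.
  move=> h; have : (b n ^+ 2) ^+ 2 <= (2 * (block n)%:R) ^+ 2.
    by rewrite lerXn2r// nnegrE// mulr_ge0.
  by rewrite -exprM exprMn; lra.
have h2 : ((block n)%:R / n%:R) ^+ 4 <= b n ^- 4.
  rewrite -exprVn lerXn2r ?nnegrE ?divr_ge0 ?invr_ge0 ?(ltW b0)//.
  rewrite ler_pdivrMr// -[X in _ <= _ * X]b3 (exprS _ 2) mulKf ?gt_eqF//.
lra.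
Qed.

(** For consecutive cube roots [x <= y], factoring [y ^ 3 - x ^ 3 = 1] gives [1 <= 3 y ^ 2 (y - x)],
    and [y ^ 3 = x ^ 3 + 1 <= 2 x ^ 3]; hence [6 = 3 * 2]. *)
Let b_telescope n : (0 < n)%N -> b n ^- 4 <= 6 * ((b n)^-1 - (b n.+1)^-1).
Proof.
move=> n0; have b1 := b_ge1 n0; have c1 := b_ge1 (ltn0Sn n).
have b0 : 0 < b n := lt_le_trans ltr01 b1; have c0 := lt_le_trans ltr01 c1.
have bc : b n <= b n.+1 by rewrite ge0_ler_powR// ?nnegrE// ?invr_ge0// ler_nat.
have cb3 : b n.+1 ^+ 3 = b n ^+ 3 + 1 by rewrite !b3 natr1.
have b31 : 1 <= b n ^+ 3 by rewrite b3 ler1n.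
move: (b n) (b n.+1) b1 c1 b0 c0 bc cb3 b31 => x y x1 y1 x0 y0 xy e x31.
have h : y <= 6 * (y - x) * x ^+ 3.
  have d0 : 0 <= y - x by rewrite subr_ge0.
  have s3 : y ^+ 2 + x * y + x ^+ 2 <= 3 * y ^+ 2.
    have : x * y <= y ^+ 2 by rewrite expr2 ler_wpM2r// ltW.
    have : x ^+ 2 <= y ^+ 2 by rewrite lerXn2r// nnegrE ltW.
    lra.
  have e1 : (y - x) * (y ^+ 2 + x * y + x ^+ 2) = 1.
    by transitivity (y ^+ 3 - x ^+ 3); [ring|rewrite e addrC addKr].
  rewrite -[leLHS]mul1r -[X in X * y <= _]e1 -mulrA [6 * _]mulrC -[leRHS]mulrA.
  rewrite ler_wpM2l// mulrC; have := ler_wpM2l (ltW y0) s3.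
  have -> : y * (3 * y ^+ 2) = 3 * y ^+ 3 by ring.
  by rewrite e; lra.
have -> : 6 * (x^-1 - y^-1) = (6 * (y - x) * x ^+ 3) / (x ^+ 4 * y).
  by field; rewrite !gt_eqF.
rewrite ler_pdivlMr ?mulr_gt0 ?exprn_gt0// mulrA mulVf ?mul1r//.
by rewrite expf_neq0// gt_eqF.
Qed.

(* Blocks of length about [n ^ (2 / 3)] bound both terms by a multiple of
   [n ^ (- 4 / 3)], which telescopes against [n ^ (- 1 / 3)]. *)
Lemma borel_cantelli_blocks (E : nat -> Omega -> Prop) (C : R) : 0 <= C ->
  (forall n m, (0 < m)%N -> (m <= n)%N -> exists2 B : set Omega,
    measurable B /\ (P B <= (C * (m%:R^-2 + (m%:R / n%:R) ^+ 4))%:E)%E &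
    forall w, ~ B w -> E n w) ->
  {ae P, forall w, \forall n \near \oo, E n w}.
Proof.
move=> C0 EB.
(* The sets are indexed from sample size 1, as the block bounds require. *)
have /choice[B BE] : forall n, exists B : set Omega,
    [/\ measurable B, (P B <= (C * (5 * b n.+1 ^- 4))%:E)%E &
    forall w, ~ B w -> E n.+1 w].
  move=> n; have [m0 mn mb] := block_bounds (ltn0Sn n).
  have [B [mB PB] BE] := EB _ _ m0 mn; exists B; split => //.
  by apply: le_trans PB _; rewrite lee_fin ler_wpM2l.
(* [30 = 5 * 6], from the block bounds and the telescoping. *)
have := @borel_cantelli_telescope B (fun n => C * 30 / b n.+1) _ _ _.
move=> H; apply: filterS (H _ _ _).
- move=> w /= [N _ HN]; exists N.+1 => // -[//|n] /= Nn.
  by have [_ _] := BE n; apply; exact: HN.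
- by move=> n; have [] := BE n.
- by move=> n; rewrite divr_ge0 ?powR_ge0// mulr_ge0.
- move=> n; have [_ + _] := BE n; move=> /le_trans; apply; rewrite lee_fin.
  have := b_telescope (ltn0Sn n); move: (b n.+1 ^- 4) (b n.+1)^-1 (b n.+2)^-1 => x y z h.
  have := ler_wpM2l C0 h; lra.
Qed.

End BorelCantelli.

Lemma eq_gd (R : realType) m q n (X : 'M[R]_(m, q)) (y : 'cV[R]_m)
    (delta delta' : nat -> R) (b0 : 'cV[R]_q) k :
  (forall l, (l < k)%N -> delta l = delta' l) ->
  gd n X y delta b0 k = gd n X y delta' b0 k.
Proof.
elim: k => //= k IH dd; rewrite dd// IH// => l lk; apply: dd; exact: ltnW.
Qed.

(** * Transfer to the original iterates and risks *)

Section LooRisk.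
Context (R : realType) (d : measure_display) (Omega : measurableType d).
Variables (P : probability Omega R) (n q : nat).
Notation T := (borel_mx R q 1 * measurableTypeR R)%type.
Variables (U : 'I_n -> {RV P >-> T}) (U0 : {RV P >-> T}) (kap m8 : R).
Hypothesis indepU : independent_family P U.
Hypothesis sameU : forall i, same_law P (U i) U0.
Hypothesis kap0 : 0 <= kap.
Hypothesis U0mgf : forall v, mean_le P (fun w => expR (dot (U0 w).1 v))
  (expR (kap * (l2norm v + l2norm v ^+ 2))).
Hypothesis U0y : mean_le P (fun w => (U0 w).2 ^+ 8) m8.
Variables (x : 'I_n -> Omega -> 'cV[R]_q) (y : 'I_n -> Omega -> R).
Hypothesis UE : forall i w, U i w = (x i w, y i w).
Variables (delta : nat -> R) (b0 : 'cV[R]_q) (K : nat) (D B0 Q : R).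
Hypotheses (n0 : (0 < n)%N) (q0 : (0 < q)%N).
Hypothesis delta0 : forall l, (l < K)%N -> 0 <= delta l.
Hypothesis deltaD : \sum_(l < K) delta l <= D.
Hypothesis b0B0 : l2norm b0 <= B0.
Hypothesis Q0 : 0 <= Q.
Hypothesis qQ : q%:R <= Q * n%:R.

Let t0 : R := 18 * (1 + Q) + 2 * kap + 1.
Let Y : R := Num.sqrt (2 + resid8_bound kap m8 0).

(* Step sizes beyond [K] are replaced by [0], so that all partial sums obey the bound. *)
Let delta' l : R := if (l < K)%N then delta l else 0.

Let delta'0 l : 0 <= delta' l.
Proof. by rewrite /delta'; case: ifP => // /delta0. Qed.

Let delta'D k : \sum_(l < k) delta' l <= D.
Proof.
apply: le_trans deltaD.
have kM : (k <= maxn k K)%N by rewrite leq_maxl.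
have KM : (K <= maxn k K)%N by rewrite leq_maxr.
rewrite (big_ord_widen _ delta' kM) (big_ord_widen _ delta KM).
rewrite big_mkcond [leRHS]big_mkcond /=; apply: ler_sum => l _.
case: ifP => // _; rewrite /delta'; case: ifP => // /delta0 //.
Qed.

Definition loo_risk_const (e : R) : R := loo_gap_const kap m8 t0 Y D B0 e.

Lemma loo_risk_prob m e : (0 < m)%N -> (m <= n)%N -> 0 < e ->
  exists2 B : set Omega, measurable B /\
    (P B <= (loo_risk_const e * (m%:R^-2 + (m%:R / n%:R) ^+ 4))%:E)%E &
  forall w, ~ B w -> forall k, (k <= K)%N ->
    `|loo_risk (x^~ w) (y^~ w) delta b0 k -
      pop_risk U0 (gd_iter (x^~ w) (y^~ w) delta b0 k)| < 3 * e.
Proof.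
move=> m0 mn e0.
have t00 : 0 <= t0 by rewrite !addr_ge0 ?mulr_ge0 ?addr_ge0.
have Y0 : 0 <= Y := sqrtr_ge0 _.
have r0 : 0 <= 2 + resid8_bound kap m8 0.
  rewrite /resid8_bound expr0n /= mulr0 mulr0 addr0; have := m8_ge0 U0y; lra.
have YE : 2 + resid8_bound kap m8 0 <= Y ^+ 2 by rewrite sqr_sqrtr.
have [B BP Bgap] := loo_gap_prob indepU sameU kap0 U0mgf U0y n0 q0 t00 Y0 delta'0
  delta'D b0B0 m0 mn qQ (lexx _) YE K e0.
exists B => // w /Bgap {}Bgap k kK; have := Bgap k kK.
congr (`| _ | < _); rewrite /loo_gap.
have XE : features (sample U w) = design_mx (x^~ w).
  by apply/matrixP => i j; rewrite !mxE tnth_mktuple UE.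
have yE : responses (sample U w) = response_vec (y^~ w).
  by apply/matrixP => i j; rewrite !mxE tnth_mktuple UE.
have dE l : (l < k)%N -> delta' l = delta l by move=> lk; rewrite /delta' (leq_trans lk).
congr (_ * _ - pop_risk U0 _).
  apply: eq_bigr => i _; rewrite tnth_mktuple UE /=; congr sq_loss.
  by rewrite /masked_gd /gd_iter_loo gd_row' XE yE; exact: eq_gd.
by rewrite /masked_gd !mask_rowsT XE yE; exact: eq_gd.
Qed.

End LooRisk.

Section PopulationRisk.
Context (R : realType) (d : measure_display) (Omega : measurableType d).
Variables (P : probability Omega R) (n q : nat).
Variables (U0 : {RV P >-> (borel_mx R q 1 * measurableTypeR R)%type}).
Variables (X : {RV P >-> (borel_mx R n q * borel_mx R n 1)%type}).
Hypothesis indep : independent P U0 X.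
Hypothesis risk_fin : forall b, mean P (fun w => sq_loss (U0 w).1 (U0 w).2 b) =
  (pop_risk U0 b)%:E.

Lemma cond_risk_ae (delta : nat -> R) (b0 : 'cV[R]_q) k (C : Omega -> R) :
  let b w := gd n (X w).1 (X w).2 delta b0 k in
  is_cond_expectation P X (fun w => sq_loss (U0 w).1 (U0 w).2 (b w)) C ->
  {ae P, forall w, C w = pop_risk U0 (b w)}.
Proof.
move=> b CE.
pose B (t : borel_mx R n q * borel_mx R n 1) : 'cV[R]_q := gd n t.1 t.2 delta b0 k.
have mB : measurable_mx B.
  apply: measurable_mx_gd => i j.
    exact: (measurableT_comp (measurable_entry i j) measurable_fst).
  exact: (measurableT_comp (measurable_entry i j) measurable_snd).
pose F (u : (borel_mx R q 1 * measurableTypeR R) * (borel_mx R n q * borel_mx R n 1)) : R :=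
  sq_loss u.1.1 u.1.2 (B u.2).
have mF : measurable_fun setT F.
  rewrite (_ : F = fun u => (u.1.2 - dot u.1.1 (B u.2)) ^+ 2); last first.
    by apply/funext => u; exact: sq_lossE.
  apply: measurable_funX; apply: measurable_funB.
    exact: (measurableT_comp measurable_snd measurable_fst).
  apply: measurable_dot => i j.
    exact: (measurableT_comp (measurable_mx_row _ _) measurable_fst).
  exact: (measurableT_comp (mB i j) measurable_snd).
have F0 u : 0 <= F u by exact: sqr_ge0.
pose G t := pop_risk U0 (B t).
have mG : measurable_fun setT G.
  pose F' (z : Omega * (borel_mx R n q * borel_mx R n 1)) : R := F (U0 z.1, z.2).
  apply: (@measurable_mean_param _ _ _ _ _ P F').
  apply: (measurableT_comp mF); apply: measurable_fun_pair => //.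
  exact: (measurableT_comp (measurable_funPT U0) measurable_fst).
exact: (cond_expectation_indep (F := F) (G := G) indep mF F0 mG (fun t => risk_fin (B t)) CE).
Qed.

End PopulationRisk.

Lemma RV_of_measurable (R : realType) (d d' : measure_display) (Omega : measurableType d)
    (T : measurableType d') (P : probability Omega R) (f : Omega -> T) :
  measurable_fun setT f -> exists U : {RV P >-> T}, (U : Omega -> T) = f.
Proof.
move=> mf; pose fM := isMeasurableFun.Build _ _ _ _ f mf.
by pose U : {RV P >-> T} := HB.pack f fM; exists U.
Qed.

Theorem theorem2
  (R : realType) (d : measure_display) (Omega : measurableType d)
  (P : probability Omega R)
  (* constants, which depend neither on n nor on p *)
  (sigma_z sigma_Sigma sigma_eps m2 m4 m8 Delta B0 zetaL zetaU : R)
  (* dimension, number of iterations, step sizes and initialization *)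
  (p K : nat -> nat) (delta : nat -> nat -> R)
  (beta0 : forall n : nat, 'cV[R]_(p n + 1))
  (* parameters of the data distribution *)
  (mu_z mu_eps : nat -> probability (measurableTypeR R) R)
  (Sigma sqrtSigma : forall n : nat, 'M[R]_(p n))
  (Lf : nat -> R) (f : forall n : nat, 'cV[R]_(p n + 1) -> R)
  (* training data *)
  (z : forall n : nat, 'I_n -> 'I_(p n) -> {RV P >-> measurableTypeR R})
  (eps : forall n : nat, 'I_n -> {RV P >-> measurableTypeR R})
  (x : forall n : nat, 'I_n -> Omega -> 'cV[R]_(p n + 1))
  (y : forall n : nat, 'I_n -> Omega -> R)
  (* test data (x_0, y_0) *)
  (xy0 : forall n : nat,
     {RV P >-> (borel_mx R (p n + 1) 1 * measurableTypeR R)%type})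
  (* conditional prediction risk of the k-th iterate *)
  (risk : nat -> nat -> Omega -> R) :
  let xy (n : nat) (i : 'I_n) (w : Omega)
      : (borel_mx R (p n + 1) 1 * measurableTypeR R)%type :=
    (x n i w, y n i w) in
  let train (n : nat) (w : Omega)
      : (borel_mx R n (p n + 1) * borel_mx R n 1)%type :=
    (design_mx (fun i => x n i w), response_vec (fun i => y n i w)) in
  let beta (n k : nat) (w : Omega) : 'cV[R]_(p n + 1) :=
    gd_iter (fun i => x n i w) (fun i => y n i w) (delta n) (beta0 n) k in
  let loo (n k : nat) (w : Omega) : R :=
    loo_risk (fun i => x n i w) (fun i => y n i w) (delta n) (beta0 n) k in
  (* (x_i, y_i), i in [n], are i.i.d. *)
  (forall n : nat, (0 < n)%N ->
     independent_family P (xy n) /\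
     forall i j, same_law P (xy n i) (xy n j)) ->
  (* (F1) *)
  (forall n : nat, (0 < n)%N ->
     is_psd (Sigma n) /\ is_psd_sqrt (sqrtSigma n) (Sigma n)) ->
  (forall (n : nat) (i : 'I_n), independent_family P (z n i)) ->
  (forall (n : nat) (i : 'I_n) j, has_law P (z n i j) (mu_z n)) ->
  (forall (n : nat) (i : 'I_n) w,
     x n i w = col_mx (sqrtSigma n *m \col_j z n i j w) (const_mx 1)) ->
  (* (F2) *)
  (forall n : nat, (0 < n)%N ->
     [/\ ('E_(mu_z n)[id] = 0)%E, ('V_(mu_z n)[id] = 1)%E &
         T2_inequality (mu_z n) sigma_z]) ->
  (* (F3) *)
  (forall n : nat, (0 < n)%N -> opnorm (Sigma n) <= sigma_Sigma) ->
  (* (Y1) *)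
  (forall (n : nat) (i : 'I_n) w, y n i w = f n (x n i w) + eps n i w) ->
  (forall (n : nat) (i : 'I_n),
     independent P (x n i : Omega -> borel_mx R (p n + 1) 1) (eps n i)) ->
  (forall (n : nat) (i : 'I_n), has_law P (eps n i) (mu_eps n)) ->
  (* (Y2) *)
  (forall n : nat, (0 < n)%N ->
     ('E_(mu_eps n)[id] = 0)%E /\ T2_inequality (mu_eps n) sigma_eps) ->
  (* (Y3) *)
  (forall n : nat, (0 < n)%N -> Lf n <= 1 /\ l2_lipschitz (Lf n) (f n)) ->
  (* (Y4) *)
  (forall (n : nat) (i : 'I_n),
     [/\ ('E_P[fun w => ((y n i w) ^+ 8)%R] <= m8%:E)%E,
         ('E_P[fun w => ((y n i w) ^+ 4)%R] <= m4%:E)%E &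
         ('E_P[fun w => ((y n i w) ^+ 2)%R] <= m2%:E)%E]) ->
  (* (x_0, y_0) is independent of the training data and distributed as
     (x_1, y_1) *)
  (forall n : nat, (0 < n)%N ->
     independent P (xy0 n) (train n) /\
     forall i, same_law P (xy0 n) (xy n i)) ->
  (* R(beta_k) = E[(y_0 - x_0^T beta_k)^2 | X, y] *)
  (forall n k : nat, (0 < n)%N -> (1 <= k <= K n)%N ->
     is_cond_expectation P (train n)
       (fun w => sq_loss (xy0 n w).1 (xy0 n w).2 (beta n k w)) (risk n k)) ->
  (* positive step sizes *)
  (forall n k : nat, (0 < n)%N -> (k < K n)%N -> 0 < delta n k) ->
  (* (1), (2), (3) *)
  (forall n : nat, (0 < n)%N ->
     \sum_(1 <= k < (K n).+1) delta n k.-1 <= Delta) ->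
  (forall n : nat, (0 < n)%N -> l2norm (beta0 n) <= B0) ->
  0 < zetaL ->
  (forall n : nat, (0 < n)%N -> zetaL <= (p n)%:R / n%:R <= zetaU) ->
  (* K = o(n (log n)^(-3/2)) *)
  (fun n : nat => (K n)%:R : R^o) =o_\oo
    (fun n : nat => n%:R * (ln n%:R) `^ (- (3 / 2)) : R^o) ->
  {ae P, forall w,
     (fun n : nat => \big[Num.max/0]_(1 <= k < (K n).+1)
        `|loo n k w - risk n k w|) @ \oo --> (0 : R)}.
Proof.
move=> xy train beta loo iid psd indz lawz xE z2 opS yE _ _ _ Lip y8 test cond
  dpos dsum b0B _ ratio _.
have zU0 : 0 <= zetaU.
  have /andP[_] := ratio 1%N isT; rewrite divr1; apply: le_trans; exact: ler0n.
have sS0 : 0 <= sigma_Sigma := le_trans (opnorm_ge0 _) (opS 1%N isT).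
pose kap := 1 + sigma_z ^+ 2 * sigma_Sigma / 2.
have kap0 : 0 <= kap.
  by apply: addr_ge0 => //; apply: divr_ge0 => //; apply: mulr_ge0 => //; exact: sqr_ge0.
(* The 1 accounts for the intercept column. *)
pose Q := zetaU + 1.
have Q0 : 0 <= Q by rewrite addr_ge0.
have qQ n : (0 < n)%N -> (p n + 1)%:R <= Q * n%:R :> R.
  move=> n0; have n0R : 0 < n%:R :> R by rewrite ltr0n.
  have /andP[_] := ratio n n0; rewrite ler_pdivrMr// => h.
  by rewrite natrD mulrDl mul1r lerD// ler1n.
have q0 n : (0 < p n + 1)%N by rewrite addn1.
have mx n i : (0 < n)%N -> measurable_mx (fun w => x n i w).
  move=> n0 j k; rewrite (_ : (fun w => _) =
    fun w => feature (sqrtSigma n) (z n i) w j k); last first.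
    by apply/funext => w; rewrite xE.
  exact: measurable_feature.
have mf n : (0 < n)%N -> measurable_fun setT
    (f n : borel_mx R (p n + 1) 1 -> measurableTypeR R).
  move=> n0; have [L1 fL] := Lip n n0; apply: measurable_lipschitz => u v.
  by apply: le_trans (fL u v) _; rewrite ler_wpM2r// l2norm_ge0.
have my n i : (0 < n)%N -> measurable_fun setT (y n i).
  move=> n0; rewrite (_ : y n i = fun w => f n (x n i w) + eps n i w); last first.
    by apply/funext => w; rewrite yE.
  apply: measurable_funD; last exact: (measurable_funPT (eps n i)).
  exact: (measurableT_comp (mf n n0) (measurable_borel_mx (mx n i n0))).
have mxy n i : (0 < n)%N -> measurable_fun setT (xy n i).
  move=> n0; apply: measurable_fun_pair; last exact: my.
  exact: measurable_borel_mx (mx n i n0).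
have rv n : (0 < n)%N -> exists U : 'I_n ->
    {RV P >-> (borel_mx R (p n + 1) 1 * measurableTypeR R)%type},
    forall i, (U i : Omega -> _) = xy n i.
  move=> n0; have /choice[U UE] := fun i => RV_of_measurable P (mxy n i n0).
  by exists U.
have mtrain n : (0 < n)%N -> measurable_fun setT (train n).
  move=> n0; apply: measurable_fun_pair; apply: measurable_borel_mx => i j.
    by under eq_fun do rewrite mxE; exact: mx.
  by under eq_fun do rewrite mxE; exact: my.
(* The test pair has the law of a training pair, so its moments are read off sample 0. *)
have data n : (0 < n)%N ->
    (forall v, mean_le P (fun w => expR (dot (xy0 n w).1 v))
      (expR (kap * (l2norm v + l2norm v ^+ 2)))) /\
    mean_le P (fun w => (xy0 n w).2 ^+ 8) m8.
  move=> n0; have [U UE] := rv n n0; pose i0 := Ordinal n0.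
  have same : same_law P (xy0 n) (U i0) by rewrite UE; exact: (test n n0).2.
  split=> [v|].
    have mE : measurable_fun setT
        (fun u : borel_mx R (p n + 1) 1 * measurableTypeR R => expR (dot u.1 v)).
      apply: measurableT_comp => //; apply: measurable_dot; last exact: measurable_mx_cst.
      exact: measurable_mx_row.
    rewrite /mean_le (same_law_mean same mE) UE /=.
    have [z0 z1 zT2] := z2 n n0; have [_ SS] := psd n n0.
    have -> : x n i0 = feature (sqrtSigma n) (z n i0) by apply/funext => w; exact: xE.
    exact: feature_mgf SS (opS n n0) (indz n i0) (lawz n i0) z0 z1 zT2 v.
  have mE : measurable_fun setT
      (fun u : borel_mx R (p n + 1) 1 * measurableTypeR R => (u.2 : R) ^+ 8).
    by apply: measurable_funX; exact: measurable_snd.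
  rewrite /mean_le (same_law_mean same mE) UE /=.
  by have [+ _ _] := y8 n i0; rewrite unlock.
have indepU n (U : 'I_n -> {RV P >-> (borel_mx R (p n + 1) 1 * measurableTypeR R)%type}) :
    (0 < n)%N -> (forall i, (U i : Omega -> _) = xy n i) -> independent_family P U.
  move=> n0 UE; have := (iid n n0).1.
  by congr (independent_family P _); apply/funext => i; rewrite UE.
have riskE : {ae P, forall w, forall n k, (0 < n)%N -> (1 <= k <= K n)%N ->
    risk n k w = pop_risk (xy0 n) (beta n k w)}.
  apply: ae_foralln => n; apply: ae_foralln => k.
  have [n0|] := boolP (0 < n)%N; last by move=> _; apply: aeW.
  have [kK|] := boolP (1 <= k <= K n)%N; last by move=> _; apply: aeW.
  have [X XE] := RV_of_measurable P (mtrain n n0).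
  have [mgf m8P] := data n n0.
  have ind : independent P (xy0 n) X by rewrite XE; exact: (test n n0).1.
  have := cond_risk_ae (delta := delta n) (b0 := beta0 n) (k := k) (C := risk n k) ind
    (pop_riskE kap0 mgf m8P).
  rewrite XE => /(_ (cond n k n0 kK)) H.
  by apply: filterS H => w.
have gap e : 0 < e -> {ae P, forall w, \forall n \near \oo, (0 < n)%N ->
    forall k, (k <= K n)%N -> `|loo n k w - pop_risk (xy0 n) (beta n k w)| < 3 * e}.
  move=> e0.
  have H n m : (0 < m)%N -> (m <= n)%N -> exists2 B : set Omega, measurable B /\
      (P B <= (loo_risk_const kap m8 Delta B0 Q e *
        (m%:R^-2 + (m%:R / n%:R) ^+ 4))%:E)%E &
      forall w, ~ B w -> (0 < n)%N -> forall k, (k <= K n)%N ->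
        `|loo n k w - pop_risk (xy0 n) (beta n k w)| < 3 * e.
    move=> m0 mn; have n0 := leq_trans m0 mn.
    have [U UE] := rv n n0; have [mgf m8P] := data n n0.
    have same i : same_law P (U i) (xy0 n).
      by move=> A mA; rewrite UE; apply/esym; exact: (test n n0).2.
    have dS : \sum_(l < K n) delta n l <= Delta.
      apply: le_trans (dsum n n0); rewrite big_add1 /= big_mkord.
      by [].
    have [B BP BE] := loo_risk_prob (indepU n U n0 UE) same kap0 mgf m8P
      (fun i w => f_equal (fun g : Omega -> _ => g w) (UE i)) n0 (q0 n)
      (fun l lK => ltW (dpos n l n0 lK)) dS (b0B n n0) Q0 (qQ n n0) m0 mn e0.
    by exists B => // w nB _ k kK; exact: BE.
  apply: (borel_cantelli_blocks _ H).
  (* Nonnegativity of the constant is read off the bound it gives for a probability at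
     [n = m = 1]. *)
  have [B [_ PB] _] := H 1%N 1%N isT isT.
  have c2 : 0 < 1 + 1 :> R by rewrite addr_gt0.
  have := le_trans (measure_ge0 P B) PB.
  by rewrite lee_fin divr1 !expr1n invr1 (pmulr_lge0 _ c2).
(* Countably many levels [1 / (N + 1)] leave a single null set. *)
have gaps := ae_foralln (fun N => gap (N.+1%:R^-1) (_ : 0 < N.+1%:R^-1 :> R)).
apply: filterS2 riskE (gaps _) => [w rE gE|N]; last by rewrite invr_gt0.
apply/cvgrPdist_lt => /= e e0.
have [N Ne] : exists N, 3 * N.+1%:R^-1 < e :> R.
  exists (Num.truncn (3 / e)); rewrite ltr_pdivrMr// mulrC -ltr_pdivrMr//.
  by rewrite truncnS_gt// divr_ge0// ltW.
apply: filterS2 (gE N) (nbhs_infty_gt 0%N) => n nG n0.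
rewrite sub0r normrN ger0_norm; last exact: bigmax_ge_id.
rewrite big_nat; apply: bigmax_lt => // k /andP[k0 kK].
have kn : (1 <= k <= K n)%N by rewrite k0 -ltnS.
rewrite rE//; apply: lt_trans (nG n0 k _) Ne; by case/andP: kn.
Qed.
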